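(* Assume (G1) and (G2) (stated in the context) and let $p>1$. Set $p^*=\frac{N+\gamma}{N+\gamma-2s}$. For $\lambda>0$ and $\mu\in\mathcal{M}^+(\Omega,\delta^\gamma)$ consider the problem $$(P_\lambda)\qquad \mathbb{L}u=u^p+\lambda\mu\ \text{ in }\Omega,\qquad u=0\ \text{ on }\partial\Omega\ \text{ (and } u=0 \text{ in } \mathbb{R}^N\setminus\overline\Omega \text{ if applicable)},$$ understood in the weak-dual sense. 1. (Subcritical case) Let $1<p<p^*$ and let $\mu\in\mathcal{M}^+(\Omega,\delta^\gamma)$ with $\|\mu\|_{\mathcal{M}(\Omega,\delta^\gamma)}=1$. Then there exists a threshold value $\lambda^*\in(0,+\infty)$ such that the following hold. (i) If $\lambda\in(0,\lambda^*]$, then $(P_\lambda)$ has a minimal positive weak-dual solution $\underline{u}_\lambda$. Moreover $$\lambda\,\mathbb{G}^\Omega[\mu]\le \underline{u}_\lambda\le T(\lambda)\,\mathbb{G}^\Omega[\mu]\quad\text{a.e. in }\Omega,$$ where $T$ is an increasing function (of $\lambda$) and $T(\lambda)\to0$ as $\lambda\to0$. (ii) If $\lambda\in(\lambda^*,+\infty)$, then $(P_\lambda)$ does not admit any nonnegative weak-dual solution. 2. (Supercritical case) Let $p\ge p^*$ and $\lambda>0$. Then there exists $\mu\in\mathcal{M}^+(\Omega,\delta^\gamma)$ with $\|\mu\|_{\mathcal{M}(\Omega,\delta^\gamma)}=1$ such that $(P_\lambda)$ does not admit any nonnegative weak-dual solution.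
   Context: Setting: $s,\gamma\in(0,1]$, $N>2s$, $\Omega\subset\mathbb{R}^N$ is a bounded domain with $C^2$ boundary, $\delta(x)=\mathrm{dist}(x,\partial\Omega)$, $a\wedge b=\min\{a,b\}$. Write $f\sim g$ if $C^{-1}g\le f\le Cg$ for some constant $C>0$. $\mathbb{L}$ is a linear operator in $L^2(\Omega)$ with domain $\mathrm{dom}(\mathbb{L})$. (G1) There is an operator $\mathbb{G}^\Omega$ such that for every $f\in C_c^\infty(\Omega)$ one has $\mathbb{G}^\Omega[f]\in\mathrm{dom}(\mathbb{L})$ and $\mathbb{L}[\mathbb{G}^\Omega[f]]=f$ in $L^2(\Omega)$. (G2) $\mathbb{G}^\Omega[f](x)=\int_\Omega G^\Omega(x,y)f(y)\,dy$, where $G^\Omega:\Omega\times\Omega\setminus\{(x,x):x\in\Omega\}\to(0,\infty)$ is Borel measurable, symmetric, and $$G^\Omega(x,y)\sim\frac{1}{|x-y|^{N-2s}}\Big(\frac{\delta(x)}{|x-y|}\wedge1\Big)^\gamma\Big(\frac{\delta(y)}{|x-y|}\wedge1\Big)^\gamma,\quad x,y\in\Omega,\ x\ne y.$$ Spaces: $L^q(\Omega,\delta^\gamma)$ is the set of $f$ with $\int_\Omega|f|^q\delta^\gamma dx<\infty$; $\delta^\gamma L^\infty(\Omega)=\{\delta^\gamma v: v\in L^\infty(\Omega)\}$; $\mathcal{M}(\Omega,\delta^\gamma)$ is the space of Radon measures $\mu$ on $\Omega$ with $\|\mu\|_{\mathcal{M}(\Omega,\delta^\gamma)}:=\int_\Omega\delta^\gamma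 d|\mu|<\infty$, and $\mathcal{M}^+(\Omega,\delta^\gamma)$ is its cone of positive measures. For a measure $\mu$, $\mathbb{G}^\Omega[\mu](x)=\int_\Omega G^\Omega(x,y)\,d\mu(y)$. Weak-dual solution of $(P_\lambda)$: a nonnegative function $u\in L^p(\Omega,\delta^\gamma)$ with $$\int_\Omega u\xi\,dx=\int_\Omega u^p\,\mathbb{G}^\Omega[\xi]\,dx+\lambda\int_\Omega\mathbb{G}^\Omega[\xi]\,d\mu\quad\forall\,\xi\in\delta^\gamma L^\infty(\Omega).$$ The boundary/exterior condition is encoded in this formulation. A solution $\underline u$ is minimal if $\underline u\le u$ a.e. in $\Omega$ for every nonnegative weak-dual solution $u$. *)

(* Defs.v *)
From HB Require Import structures.
From mathcomp Require Import all_boot all_order all_algebra.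
From mathcomp Require Import all_classical all_reals all_analysis measurable_realfun.
Import Order.TTheory GRing.Theory Num.Theory numFieldNormedType.Exports.

Set Implicit Arguments.
Unset Strict Implicit.
Unset Printing Implicit Defensive.

Local Open Scope classical_set_scope.
Local Open Scope ring_scope.

Fact borel_mx_display : measure_display.
Proof. exact: default_measure_display. Qed.

Section borel_mx.
Context (R : realType) (m n : nat).

Definition borel_mx : set (set 'M[R]_(m, n)) :=
  <<s [set U : set 'M[R]_(m, n) | open U] >>.

Let borel0 : borel_mx set0. Proof. exact: sigma_algebra0. Qed.

Let borelC A : borel_mx A -> borel_mx (~` A). Proof. exact: sigma_algebraC. Qed.

Let borelU (F : (set 'M[R]_(m, n))^nat) :
  (forall i, borel_mx (F i)) -> borel_mx (\bigcup_i F i).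
Proof. exact: sigma_algebra_bigcup. Qed.

HB.instance Definition _ := @isMeasurable.Build borel_mx_display
  'M[R]_(m, n) borel_mx borel0 borelC borelU.

Lemma open_measurable_mx (U : set 'M[R]_(m, n)) : open U -> measurable U.
Proof. by move=> oU; exact: sub_sigma_algebra. Qed.

End borel_mx.

Section coordinates.
Context (R : realType) (n : nat).

Lemma measurable_coord (i : 'I_n) :
  measurable_fun setT (fun x : 'rV[R]_n => x ord0 i).
Proof.
apply: (measurability _ (RGenOInfty.measurableE R)) => _ [_ [a ->] <-].
rewrite setTI; apply: open_measurable_mx.
apply: open_comp; last exact: interval_open.
by move=> x _; exact: coord_continuous.
Qed.

Lemma open_bigcup_ball (U : set 'rV[R]_n) : open U ->
  U = \bigcup_(qk in [set qk : 'rV[rat]_n * nat |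
        ball (map_mx ratr qk.1 : 'rV[R]_n) qk.2.+1%:R^-1 `<=` U])
      ball (map_mx ratr qk.1 : 'rV[R]_n) qk.2.+1%:R^-1.
Proof.
move=> oU; apply/seteqP; split=> [x Ux|x [qk /= + ]]; last exact.
have /nbhs_ballP[e /= e0 xeU] := open_nbhs_nbhs (conj oU Ux).
pose k := (Num.trunc (2 / e)).
have ke : k.+1%:R^-1 + k.+1%:R^-1 <= e :> R.
  have : 2 / e < k.+1%:R by rewrite truncnS_gt.
  rewrite ltr_pdivrMr// => h.
  rewrite -mulr2n -[_ *+ 2]mulr_natl ler_pdivrMr ?ltr0n// mulrC; exact: ltW.
have k0 : 0 < k.+1%:R^-1 :> R by rewrite invr_gt0 ltr0n.
have qP i : exists q : rat, `|x ord0 i - ratr q| < k.+1%:R^-1.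
  have : x ord0 i - k.+1%:R^-1 < x ord0 i + k.+1%:R^-1.
    by rewrite ltrBlDr -addrA ltrDl addr_gt0.
  move=> /rat_in_itvoo[q]; rewrite in_itv/= => /andP[h1 h2].
  by exists q; rewrite ltr_distlC h1 h2.
have [q qx] := choice qP.
exists (\row_i q i, k) => /=; last first.
  split=> // i j; rewrite (ord1 i) !mxE /ball/= distrC; exact: qx.
move=> y qy; apply: xeU.
apply: (@le_ball _ _ _ _ e ke).
apply: ball_triangle qy.
split=> // i j; rewrite (ord1 i) !mxE /ball/=; exact: qx.
Qed.

Lemma measurable_fun_rowP d (T : measurableType d) (f : T -> 'rV[R]_n) :
  measurable_fun setT f <->
  forall i, measurable_fun setT (fun x => f x ord0 i).
Proof.
split=> [mf i|mf]; first exact: measurableT_comp (measurable_coord i) mf.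
apply: (measurability [set U : set 'rV[R]_n | open U]) => // _ [U /= oU <-].
rewrite (open_bigcup_ball oU) setTI preimage_bigcup bigcup_mkcond.
apply: countable_bigcupT_measurable => [|[q k]]; first exact: countableP.
case: ifPn => // _.
rewrite (_ : _ @^-1` _ = \bigcap_(i in [set: 'I_n])
    ((fun x => f x ord0 i) @^-1` ball (ratr (q ord0 i) : R) k.+1%:R^-1)).
  apply: fin_bigcap_measurable => // i _; rewrite -[X in measurable X]setTI.
  by apply: mf => //; apply: open_measurable; exact: ball_open.
apply/seteqP; split=> [x [_ /= h] i _|x /= h].
  by have := h ord0 i; rewrite mxE.
by split=> [|i j]; rewrite ?invr_gt0 ?ltr0n// (ord1 i) mxE; exact: h.
Qed.

End coordinates.

(* Lebesgue measure on R^n, as an iterated product of the one on R transported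
   to row vectors; lebesgue_rV_box computes it on boxes. *)
Section lebesgue_rV.
Context (R : realType).

Definition rVcons n (xv : R * 'rV[R]_n) : 'rV[R]_n.+1 :=
  row_mx (const_mx xv.1 : 'rV_1) xv.2.

Definition rVuncons n (v : 'rV[R]_n.+1) : R * 'rV[R]_n :=
  (v ord0 ord0, \row_i v ord0 (lift ord0 i)).

Lemma rVcons0 n (xv : R * 'rV[R]_n) : rVcons xv ord0 ord0 = xv.1.
Proof.
rewrite /rVcons (_ : ord0 = lshift n (ord0 : 'I_1)); last exact/val_inj.
by rewrite (row_mxEl (m := 1) (n1 := 1)) mxE.
Qed.

Lemma rVconsS n (xv : R * 'rV[R]_n) (i : 'I_n) :
  rVcons xv ord0 (lift ord0 i) = xv.2 ord0 i.
Proof.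
rewrite /rVcons (_ : lift ord0 i = rshift 1 i); last exact/val_inj.
by rewrite (row_mxEr (m := 1) (n1 := 1)).
Qed.

Lemma rVconsK n : cancel (@rVcons n) (@rVuncons n).
Proof.
move=> xv; rewrite /rVuncons rVcons0; case: xv => x v /=; congr pair.
by apply/rowP => i; rewrite mxE rVconsS.
Qed.

Lemma rVunconsK n : cancel (@rVuncons n) (@rVcons n).
Proof.
move=> v; apply/rowP => i; have [j ->|->] := unliftP ord0 i.
  by rewrite rVconsS mxE.
by rewrite rVcons0.
Qed.

Lemma measurable_rVcons n : measurable_fun setT (@rVcons n).
Proof.
apply/measurable_fun_rowP => i; have [j ->|->] := unliftP ord0 i.
  under eq_fun do rewrite rVconsS.
  exact: (measurableT_comp (measurable_coord j) measurable_snd).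
under eq_fun do rewrite rVcons0.
exact: measurable_fst.
Qed.

Lemma measurable_rVuncons n : measurable_fun setT (@rVuncons n).
Proof.
apply/measurable_fun_pairP; split => /=; first exact: measurable_coord.
apply/measurable_fun_rowP => i; rewrite /comp/=.
under eq_fun do rewrite mxE.
exact: measurable_coord.
Qed.

Section step.
Context (n : nat) (m : {sigma_finite_measure set 'rV[R]_n -> \bar R}).

Definition lebesgue_step : set 'rV[R]_n.+1 -> \bar R :=
  pushforward (@lebesgue_measure R \x m)%E (@rVcons n).

Let measurable_rVcons_preimage A :
  measurable A -> measurable (@rVcons n @^-1` A).
Proof.
by move=> mA; rewrite -[X in measurable X]setTI; exact: measurable_rVcons.
Qed.

Let lebesgue_step0 : lebesgue_step set0 = 0%E.
Proof. by rewrite /lebesgue_step /pushforward preimage_set0 measure0. Qed.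

Let lebesgue_step_ge0 A : (0 <= lebesgue_step A)%E.
Proof. by rewrite /lebesgue_step /pushforward measure_ge0. Qed.

Let lebesgue_step_sigma_additive : semi_sigma_additive lebesgue_step.
Proof.
move=> F mF tF mUF; rewrite /lebesgue_step /pushforward preimage_bigcup.
apply: measure_semi_sigma_additive.
- by move=> k; exact: measurable_rVcons_preimage.
- apply/trivIsetP => /= i j _ _ ij; rewrite -preimage_setI.
  by move/trivIsetP : tF => /(_ _ _ _ _ ij) ->//; rewrite preimage_set0.
- by rewrite -preimage_bigcup; exact: measurable_rVcons_preimage.
Qed.

HB.instance Definition _ := isMeasure.Build _ _ _ lebesgue_step
  lebesgue_step0 lebesgue_step_ge0 lebesgue_step_sigma_additive.

Let lebesgue_step_sigma_finite : sigma_finite setT lebesgue_step.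
Proof.
have /sigma_finiteP[F [TF ndF Foo]] := sigma_finiteT (@lebesgue_measure R).
have /sigma_finiteP[H [TH ndH Hoo]] := sigma_finiteT m.
exists (fun k => @rVuncons n @^-1` (F k `*` H k)).
  apply/seteqP; split=> // v _.
  have [i _ Fi] : (\bigcup_i F i) (v ord0 ord0) by rewrite -TF.
  have [j _ Hj] : (\bigcup_i H i) (rVuncons v).2 by rewrite -TH.
  exists (maxn i j) => //; split => /=.
  - by move: Fi; exact/subsetPset/ndF/leq_maxl.
  - by move: Hj; exact/subsetPset/ndH/leq_maxr.
move=> k; have [mF Fk] := Foo k; have [mH Hk] := Hoo k; split.
  rewrite -[X in measurable X]setTI.
  by apply: measurable_rVuncons => //; exact: measurableX.
rewrite /lebesgue_step /pushforward -comp_preimage.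
rewrite (_ : @rVuncons n \o @rVcons n = id) ?preimage_id//.
  by rewrite product_measure1E// lte_mul_pinfty// ge0_fin_numE.
by apply/funext => x /=; rewrite rVconsK.
Qed.

HB.instance Definition _ := Measure_isSigmaFinite.Build _ _ _ lebesgue_step
  lebesgue_step_sigma_finite.

End step.

Fixpoint lebesgue_rV n : {sigma_finite_measure set 'rV[R]_n -> \bar R} :=
  match n with
  | 0 => \d_ (0 : 'rV[R]_0)
  | n'.+1 => lebesgue_step (lebesgue_rV n')
  end.

Lemma measurable_rV_box n (a b : 'I_n -> R) :
  measurable [set v : 'rV[R]_n | forall i, a i <= v ord0 i <= b i].
Proof.
rewrite (_ : mkset _ = \bigcap_(i in [set: 'I_n])
    ((fun v : 'rV[R]_n => v ord0 i) @^-1` `[a i, b i]%classic)).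
  apply: fin_bigcap_measurable => // i _; rewrite -[X in measurable X]setTI.
  exact: measurable_coord.
apply/seteqP; split=> [v /= h i _|v /= h i]; first by rewrite /= ?in_itv/= h.
by have := h i I; rewrite /= ?in_itv.
Qed.

Lemma lebesgue_rV_box n (a b : 'I_n -> R) : (forall i, a i <= b i) ->
  lebesgue_rV n [set v | forall i, a i <= v ord0 i <= b i] =
  (\prod_(i < n) (b i - a i))%:E.
Proof.
elim: n => [|n IH] in a b * => ab.
  by rewrite big_ord0 /= diracE mem_set// => -[].
transitivity ((@lebesgue_measure R \x lebesgue_rV n)%E
    (`[a ord0, b ord0]%classic `*`
     [set v : 'rV[R]_n | forall i, a (lift ord0 i) <= v ord0 i <= b (lift ord0 i)])).
  rewrite -[LHS]/((@lebesgue_measure R \x lebesgue_rV n)%E (@rVcons n @^-1` _)).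
  congr (product_measure1 _ _ _); apply/seteqP.
  split=> [xv /= h|xv /= [h0 h] i].
    split=> [|i]; first by have := h ord0; rewrite rVcons0 ?in_itv.
    by have := h (lift ord0 i); rewrite rVconsS.
  have [j ->|->] := unliftP ord0 i; first by rewrite rVconsS.
  by move: h0; rewrite rVcons0 ?in_itv.
rewrite product_measure1E//=; last exact: measurable_rV_box.
rewrite lebesgue_measure_itv/= lte_fin IH// big_ord_recl EFinM.
congr (_ * _)%E; have := ab ord0; rewrite le_eqVlt => /predU1P[->|->//].
by rewrite ltxx subrr.
Qed.

End lebesgue_rV.

Arguments lebesgue_rV {R} n.

Section domains.
Context (R : realType) (N : nat).
Implicit Types (Omega A : set 'rV[R]_N) (f : 'rV[R]_N -> R).

(* The library norm on 'rV[R]_N is the sup norm; |x| in the kernel estimate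
   and in the distance is the Euclidean norm. *)
Definition enorm (x : 'rV[R]_N) : R := Num.sqrt (\sum_i x ord0 i ^+ 2).

Definition boundary A : set 'rV[R]_N := closure A `\` interior A.

(* A junk value when A has empty boundary; a nonempty bounded open set in
   positive dimension has nonempty boundary. *)
Definition bdist A (x : 'rV[R]_N) : R :=
  inf [set enorm (x - y) | y in boundary A].

End domains.

Section smoothness.
Context (R : realType).

Fixpoint class_C (k n : nat) (f : 'rV[R]_n -> R) : Prop :=
  continuous f /\
  if k is k'.+1 then
    forall i : 'I_n, (forall x, derivable f x (delta_mx ord0 i)) /\
                     class_C k' ('D_(delta_mx ord0 i) f)
  else True.

(* Near every boundary point, after relabeling and possibly reversing a
   coordinate axis, the set is the region above the graph of a C^2 function
   of the other coordinates. *)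
Definition C2_boundary N (A : set 'rV[R]_N) : Prop :=
  forall z, boundary A z ->
    exists (r : R) (i : 'I_N) (b : bool) (phi : 'rV[R]_(N.-1) -> R),
      [/\ 0 < r, class_C 2 phi &
        forall x, enorm (x - z) < r ->
          (A x <-> phi (col' i x) < (-1) ^+ b * x ord0 i)].

Record bounded_C2_domain N (Omega : set 'rV[R]_N) : Prop := {
  domain_nonempty : Omega !=set0 ;
  domain_open : open Omega ;
  domain_connected : connected Omega ;
  domain_bounded : bounded_set Omega ;
  domain_C2 : C2_boundary Omega
}.

Definition Cc_infty N (Omega : set 'rV[R]_N) : set ('rV[R]_N -> R) :=
  [set f | [/\ forall k, class_C k f,
               compact (closure [set x | f x != 0]) &
               closure [set x | f x != 0] `<=` Omega]].

End smoothness.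

Section green.
Context (R : realType) (N : nat) (Omega : set 'rV[R]_N).
Local Notation E := 'rV[R]_N.
Local Notation leb := (@lebesgue_rV R N).
Local Notation delta := (bdist Omega).
Implicit Types (f g xi u v w : E -> R) (G : E -> E -> R).

Definition Lq (q : R) w : set (E -> R) :=
  [set f : E -> R | measurable_fun Omega f /\
           (\int[leb]_(x in Omega) (`|f x| `^ q * w x)%:E < +oo)%E].

Definition Linfty : set (E -> R) :=
  [set v : E -> R | measurable_fun Omega v /\
           exists M : R, {ae leb, forall x, Omega x -> `|v x| <= M}].

Definition delta_Linfty (gamma : R) : set (E -> R) :=
  [set (fun x => delta x `^ gamma * v x) | v in Linfty].

(* A linear operator in L^2(Omega), acting on representatives: both the
   domain and the operator are compatible with a.e. equality in Omega. *)
Record linear_operator_L2 (dom : set (E -> R)) (L : (E -> R) -> (E -> R)) :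
    Prop := {
  dom_L2 : dom `<=` Lq 2 (cst 1) ;
  op_L2 : forall f, dom f -> Lq 2 (cst 1) (L f) ;
  dom_ae : forall f g, dom f -> Lq 2 (cst 1) g -> ae_eq leb Omega f g -> dom g ;
  op_ae : forall f g, dom f -> dom g -> ae_eq leb Omega f g ->
    ae_eq leb Omega (L f) (L g) ;
  dom_zero : dom (cst 0) ;
  dom_linear : forall (a : R) f g, dom f -> dom g ->
    dom (fun x => a * f x + g x) ;
  op_linear : forall (a : R) f g, dom f -> dom g ->
    ae_eq leb Omega (L (fun x => a * f x + g x)) (fun x => a * L f x + L g x)
}.

Definition green_fun G f (x : E) : \bar R :=
  (\int[leb]_(y in Omega) (G x y * f y)%:E)%E.

Definition green_measure G (mu : {measure set E -> \bar R}) (x : E) : \bar R :=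
  (\int[mu]_(y in Omega) (G x y)%:E)%E.

Definition hyp_G1 (dom : set (E -> R)) (L GO : (E -> R) -> (E -> R)) : Prop :=
  forall f, Cc_infty Omega f -> dom (GO f) /\ ae_eq leb Omega (L (GO f)) f.

Definition off_diagonal : set (E * E) :=
  [set z | [/\ Omega z.1, Omega z.2 & z.1 <> z.2]].

Definition kernel_profile (s gamma : R) (x y : E) : R :=
  (enorm (x - y) `^ (N%:R - 2 * s))^-1 *
  Num.min (delta x / enorm (x - y)) 1 `^ gamma *
  Num.min (delta y / enorm (x - y)) 1 `^ gamma.

(* GO is the Green operator on test functions; on delta^gamma L^oo and on
   measures the paper's symbol denotes the integral against the kernel, i.e.
   green_fun and green_measure. The values of G on the diagonal and outside
   Omega x Omega are irrelevant. *)
Record hyp_G2 (s gamma : R) (GO : (E -> R) -> (E -> R)) G : Prop := {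
  green_representation : forall f, Cc_infty Omega f ->
    {ae leb, forall x, Omega x -> (GO f x)%:E = green_fun G f x} ;
  green_pos : forall x y, off_diagonal (x, y) -> 0 < G x y ;
  green_measurable : measurable_fun off_diagonal (fun z => G z.1 z.2) ;
  green_sym : forall x y, off_diagonal (x, y) -> G x y = G y x ;
  green_estimate : exists2 C : R, 0 < C & forall x y, off_diagonal (x, y) ->
    C^-1 * kernel_profile s gamma x y <= G x y <= C * kernel_profile s gamma x y
}.

(* A positive Radon measure on Omega is encoded as a Borel measure on R^N
   carried by Omega; on an open subset of R^N, finiteness on compact sets
   already implies regularity. *)
Definition radon_on (mu : {measure set E -> \bar R}) : Prop :=
  mu (~` Omega) = 0%E /\
  forall K : set E, compact K -> K `<=` Omega -> (mu K < +oo)%E.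

(* For a positive measure |mu| = mu. *)
Definition Mnorm (gamma : R) (mu : {measure set E -> \bar R}) : \bar R :=
  (\int[mu]_(x in Omega) (delta x `^ gamma)%:E)%E.

Definition Mplus (gamma : R) (mu : {measure set E -> \bar R}) : Prop :=
  radon_on mu /\ (Mnorm gamma mu < +oo)%E.

Definition weak_dual_solution (gamma p : R) G (lambda : R)
    (mu : {measure set E -> \bar R}) : set (E -> R) :=
  [set u : E -> R | [/\ {ae leb, forall x, Omega x -> 0 <= u x},
    Lq p (fun x => delta x `^ gamma) u &
    forall xi, delta_Linfty gamma xi ->
      (\int[leb]_(x in Omega) (u x * xi x)%:E =
       \int[leb]_(x in Omega) ((u x `^ p)%:E * green_fun G xi x) +
       lambda%:E * \int[mu]_(x in Omega) green_fun G xi x)%E]].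

Definition minimal_solution (gamma p : R) G (lambda : R)
    (mu : {measure set E -> \bar R}) : set (E -> R) :=
  [set u : E -> R | weak_dual_solution gamma p G lambda mu u /\
    forall v, weak_dual_solution gamma p G lambda mu v ->
      {ae leb, forall x, Omega x -> u x <= v x}].

End green.

(* Main.v *)
From HB Require Import structures.
Require Import Defs.
From mathcomp Require Import all_boot all_order all_algebra.
From mathcomp Require Import all_classical all_reals all_analysis.
From mathcomp Require Import ring lra measurable_realfun.
Import Order.TTheory GRing.Theory Num.Theory numFieldNormedType.Exports.

(** Write D for the weight delta^gamma and g for the Green kernel, both
extended by zero outside Omega (g also on the diagonal), and G[sigma] for the
potential of a measure or of a function.

Put rho(x,y) = |x-y|^(N-2s) max(|x-y|,delta x)^gamma max(|x-y|,delta y)^gamma.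
The two-sided estimate of the Green kernel says that g(x,y) is comparable with
D(x) D(y) / rho(x,y), and rho is a quasi-metric: on a path x, z, y one of the
two legs is at least half as long as |x-y|, and delta is 1-Lipschitz
([qdist_triangle]). Inverting the quasi-triangle inequality gives the 3G
inequality [off_diag_3G],
  g(x,z) g(z,y) <= C g(x,y) D(z) (g(x,z)/D(x) + g(z,y)/D(y)).
Keeping only powers of |x-y| in rho bounds the integral of D (g(.,y)/D(y))^p
uniformly in y as soon as (N-2s+gamma) p - gamma < N, which is the condition
p < pstar ([off_diag_moment]). The subcritical case uses these two facts, the
lower bound g(x,y) >= D(x) D(y) / C and the upper bound G[D] <= C D, and
nothing else about the domain; it is therefore proved for an abstract kernel.

The analytic core is the estimate [potential_weight]: for all A > 0 and w >= 0,
  G[w^(p-1) G[sigma]] <= 2 C (A int D w^p + C A^(1-p)) G[sigma].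
By Tonelli the left-hand side is a double integral of a product of two kernels
against w^(p-1); the 3G inequality turns it into G[sigma] times integrals of
D k w^(p-1) with k = g/D, and k w^(p-1) <= A w^p + A^(1-p) k^p. For
w = G[mu] it says G[G[mu]^p] <= K G[mu]; for int D w^p small, a suitable A
makes the constant at most 1/2.

A weak-dual solution is, up to null sets, a function u in L^p(D) with
u = G[u^p] + lambda G[mu] almost everywhere: test with D times an indicator, and
conversely apply Tonelli ([weak_pointwise], [pointwise_weak]). The supremum
u_lambda of the Picard iteration started at 0 solves this equation in [0,+oo]
and lies below every solution, so the problem is solvable exactly when
u_lambda belongs to L^p(D), and u_lambda is then the minimal solution. It is
increasing in lambda, and:
- for small lambda, 2 lambda G[mu] is a supersolution ([picard_sup_small]);
- integrating the equation against D bounds both lambda and int D u_lambda^p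
  over all solvable lambda ([solvable_bound]), so the solvable parameters form
  an interval ending at a finite lambdastar, which is solvable itself by
  monotone convergence ([solvable_limit]);
- u_lambdastar <= M G[mu] for some M ([picard_sup_regular]): the part of u^p
  which is at most k D has a potential at most k C D, hence at most a multiple
  of G[mu], and the rest is w^(p-1) u with int D w^p small, so that its
  potential is absorbed by u with the constant 1/2.
The function T is 2 lambda for small lambda and M + 2 lambda beyond.

In the supercritical case let z0 be a boundary point nearest to some x1 in
Omega. The point at distance t from z0 on the segment from z0 to x1 has
distance exactly t to the boundary. Around the points with t = d/4^k there are
disjoint cubes of side comparable with t, and for p >= pstar each of them
contributes at least a fixed amount to the integral of D (g(.,y)/D(y))^p
when y lies further along the sequence. These integrals are thus unbounded in y
([moment_unbounded]), and a convergent series of Dirac masses at suitable points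
y_i gives a measure mu of norm 1 with lambda G[mu] outside L^p(D) for all
lambda > 0 ([potential_not_Lp]). A solution would dominate lambda G[mu]. *)

Set Implicit Arguments.
Unset Strict Implicit.
Unset Printing Implicit Defensive.

Local Open Scope classical_set_scope.
Local Open Scope ring_scope.

(** * Potentials of a symmetric kernel *)
Section potential.
Local Open Scope ereal_scope.
Context d (T : measurableType d) (R : realType).
Implicit Types (s t m : {sigma_finite_measure set T -> \bar R}).
Implicit Types (g : T -> T -> R) (f h : T -> \bar R) (D : T -> R).

Definition potential g (s : {measure set T -> \bar R}) f (x : T) : \bar R :=
  \int[s]_y ((g x y)%:E * f y).

Definition sym_kernel g : Prop := [/\ forall x y, (0 <= g x y)%R,
  forall x y, g x y = g y x &
  measurable_fun setT (fun z : T * T => g z.1 z.2)].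

Lemma measurable_kernel1 g x : sym_kernel g -> measurable_fun setT (g x).
Proof.
move=> [_ _ mg].
exact: (measurableT_comp mg (pair1_measurable x)).
Qed.

Lemma potential_ge0 g (s : {measure set T -> \bar R}) f x : sym_kernel g ->
  (forall y, 0 <= f y) -> 0 <= potential g s f x.
Proof.
by move=> [g0 _ _] f0; apply: integral_ge0 => y _; rewrite mule_ge0// lee_fin.
Qed.

Lemma measurable_kernelM g f x : sym_kernel g -> measurable_fun setT f ->
  measurable_fun setT (fun y => (g x y)%:E * f y).
Proof.
move=> kg mf; apply: emeasurable_funM => //.
by apply/measurable_EFinP; exact: measurable_kernel1.
Qed.

Lemma measurable_kernelM2 g f h : sym_kernel g ->
  measurable_fun setT f -> measurable_fun setT h ->
  measurable_fun setT (fun z : T * T => h z.1 * ((g z.1 z.2)%:E * f z.2)).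
Proof.
move=> [_ _ mg] mf mh; apply: emeasurable_funM; last apply: emeasurable_funM.
- exact: measurableT_comp mh measurable_fst.
- exact/measurable_EFinP.
- exact: measurableT_comp mf measurable_snd.
Qed.

Lemma measurable_potential g s f : sym_kernel g -> measurable_fun setT f ->
  (forall y, 0 <= f y) -> measurable_fun setT (potential g s f).
Proof.
move=> kg mf f0.
apply: (measurable_fun_fubini_tonelli_F (fun z : T * T => (g z.1 z.2)%:E * f z.2)).
- have := @measurable_kernelM2 _ _ (cst 1) kg mf (@measurable_cst _ _ _ _ _ _).
  by congr measurable_fun; apply/funext => z; rewrite mul1e.
- by move=> z; case: kg => g0 _ _; rewrite mule_ge0// lee_fin.
Qed.

(** Tonelli, with the symmetry of the kernel. *)
Lemma potential_duality g s t f h : sym_kernel g ->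
  measurable_fun setT f -> (forall y, 0 <= f y) ->
  measurable_fun setT h -> (forall y, 0 <= h y) ->
  \int[t]_x (h x * potential g s f x) = \int[s]_y (f y * potential g t h y).
Proof.
move=> kg mf f0 mh h0; have [g0 gC _] := kg.
pose F (z : T * T) := h z.1 * ((g z.1 z.2)%:E * f z.2).
transitivity (\int[t]_x \int[s]_y F (x, y)).
  apply: eq_integral => x _; rewrite /potential -ge0_integralZl//.
  - exact: measurable_kernelM.
  - by move=> y _; rewrite mule_ge0// lee_fin.
rewrite fubini_tonelli//; last 2 first.
- exact: measurable_kernelM2.
- by move=> z; rewrite !mule_ge0// lee_fin.
apply: eq_integral => y _; rewrite /potential -ge0_integralZl//.
- by apply: eq_integral => x _; rewrite /F/= gC muleA muleC; congr (_ * _); rewrite muleC.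
- exact: measurable_kernelM.
- by move=> x _; rewrite mule_ge0// lee_fin.
Qed.

Lemma le_potential g (s : {measure set T -> \bar R}) f h x : sym_kernel g ->
  measurable_fun setT f -> measurable_fun setT h ->
  (forall y, 0 <= f y) -> (forall y, 0 <= h y) ->
  {ae s, forall y, f y <= h y} -> potential g s f x <= potential g s h x.
Proof.
move=> kg mf mh f0 h0 fh; have [g0 _ _] := kg; apply: ae_ge0_le_integral => //.
- by move=> y _; rewrite mule_ge0// lee_fin.
- exact: measurable_kernelM.
- by move=> y _; rewrite mule_ge0// lee_fin.
- exact: measurable_kernelM.
- by apply: filterS fh => y fhy _; rewrite lee_wpmul2l// lee_fin.
Qed.

Lemma potentialZ g (s : {measure set T -> \bar R}) f k x : sym_kernel g ->
  measurable_fun setT f -> (forall y, 0 <= f y) -> 0 <= k ->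
  potential g s (fun y => k * f y) x = k * potential g s f x.
Proof.
move=> kg mf f0 k0; have [g0 _ _] := kg; rewrite /potential -ge0_integralZl//.
- by apply: eq_integral => y _; rewrite muleCA.
- exact: measurable_kernelM.
- by move=> y _; rewrite mule_ge0// lee_fin.
Qed.

Lemma potentialD g (s : {measure set T -> \bar R}) f h x : sym_kernel g ->
  measurable_fun setT f -> (forall y, 0 <= f y) ->
  measurable_fun setT h -> (forall y, 0 <= h y) ->
  potential g s (fun y => f y + h y) x = potential g s f x + potential g s h x.
Proof.
move=> kg mf f0 mh h0; have [g0 _ _] := kg; rewrite /potential -ge0_integralD//.
- by apply: eq_integral => y _; rewrite ge0_muleDr.
- by move=> y _; rewrite mule_ge0// lee_fin.
- exact: measurable_kernelM.
- by move=> y _; rewrite mule_ge0// lee_fin.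
- exact: measurable_kernelM.
Qed.

End potential.

(** * An estimate for iterated potentials *)

(** If k <= A w the left-hand side is at most A w^p; otherwise w < k / A, and
it is at most A^(1-p) k^p. This replaces the Young and Jensen inequalities
throughout, and leaves A free. *)
Lemma young_split (R : realType) (p A k w : R) : 1 < p -> 0 < A ->
  0 <= k -> 0 <= w ->
  k * w `^ (p - 1) <= A * w `^ p + A `^ (1 - p) * k `^ p.
Proof.
move=> p1 A0 k0 w0.
have p0 : p != 0 by rewrite gt_eqF// (lt_trans _ p1).
have pE a : 0 <= a -> a * a `^ (p - 1) = a `^ p.
  by move=> a0; rewrite -{1}(powRr1 a0) -powRD ?subrKC//; rewrite (negbTE p0).
have [kw|wk] := leP k (A * w).
  rewrite -[leLHS]addr0 lerD// ?mulr_ge0 ?powR_ge0//.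
  by rewrite -pE// mulrA ler_wpM2r ?powR_ge0.
rewrite -[leLHS]add0r lerD// ?mulr_ge0 ?powR_ge0 ?(ltW A0)//.
rewrite -pE// mulrCA ler_wpM2l//.
rewrite -(opprB p 1) powRN mulrC ler_pdivlMr ?powR_gt0// -powRM//; last exact: ltW.
apply: ge0_ler_powR.
- by rewrite subr_ge0 ltW.
- by rewrite nnegrE mulr_ge0// ltW.
- by [].
- by rewrite mulrC ltW.
Qed.

Section green_kernel.
Local Open Scope ereal_scope.
Context d (T : measurableType d) (R : realType).
Implicit Types (s t m : {sigma_finite_measure set T -> \bar R}).
Implicit Types (g : T -> T -> R) (f h : T -> \bar R) (D : T -> R).

(** The properties of the Green kernel and of D = delta^gamma which do not
depend on p. One constant serves in all bounds, to keep them readable. *)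
Record green_kernel m g D (C : R) : Prop := {
  gk_kernel : sym_kernel g ;
  gk_ge0 : forall x, (0 <= D x)%R ;
  gk_measurable : measurable_fun setT D ;
  gk_integrable : \int[m]_x (D x)%:E < +oo ;
  gk_nontrivial : 0 < \int[m]_x (D x * D x)%:E ;
  gk_point : forall x : T, measurable [set x] ;
  gk_atomless : forall x : T, m [set x] = 0 ;
  gk_const : (0 < C)%R ;
  gk_support : forall x y, D x = 0%R -> g x y = 0%R ;
  gk_lower : forall x y, x <> y -> (D x * D y <= C * g x y)%R ;
  gk_upper : forall x, potential g m (EFin \o D) x <= (C * D x)%:E }.

(** [sk_moment] is where p < pstar enters; [sk_3G] is the 3G inequality, with
the ratios k = g/D that also appear in [sk_moment]. *)
Record subcritical_kernel m g D (C p : R) : Prop := {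
  sk_gt1 : (1 < p)%R ;
  sk_moment : forall y, \int[m]_z (D z * (g z y / D y) `^ p)%:E <= C%:E ;
  sk_3G : forall x y z, x <> y ->
    (g x z * g z y <= C * g x y * D z * (g x z / D x + g z y / D y))%R }.

Section green.
Variables (m : {sigma_finite_measure set T -> \bar R}).
Variables (g : T -> T -> R) (D : T -> R) (C : R) (gk : green_kernel m g D C).
Let kg := gk_kernel gk.
Let g0 : forall x y, (0 <= g x y)%R. Proof. by case: kg. Qed.
Let gC : forall x y, g x y = g y x. Proof. by case: kg. Qed.
Let C0 := gk_const gk.
Let D0 := gk_ge0 gk.
Let mD : measurable_fun setT (EFin \o D).
Proof. exact/measurable_EFinP/(gk_measurable gk). Qed.

Section subcritical.
Variables (p : R) (sk : subcritical_kernel m g D C p).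
Let p1 := sk_gt1 sk.

Let measurable_moment y :
  measurable_fun setT (fun z => (D z * (g z y / D y) `^ p)%:E).
Proof.
apply/measurable_EFinP; apply: measurable_funM; first exact: gk_measurable gk.
have -> : (fun z => (g z y / D y) `^ p)%R =
    (fun a : R => a `^ p)%R \o (fun z => g y z * (D y)^-1)%R.
  by apply/funext => z /=; rewrite gC.
apply: measurableT_comp; first exact: measurable_powR.
by apply: measurable_funM => //; exact: measurable_kernel1.
Qed.

(** The potential of w^(p-1) G[s,f] is a double integral of the product
g(x,z) w(z)^(p-1) g(z,y) over z and y. The 3G inequality takes out g(x,y), and
[young_split] with k = g(x,z)/D(x) and k = g(z,y)/D(y) leaves only int D w^p
and the moments of the kernel; the factor 2 counts these two terms. The point x
must carry no mass since the 3G inequality says nothing for y = x. *)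
Lemma potential_weight s f (w : T -> R) (A : R) x : (0 < A)%R ->
  measurable_fun setT f -> (forall y, 0 <= f y) ->
  measurable_fun setT w -> (forall z, (0 <= w z)%R) ->
  s [set x] = 0 ->
  potential g m (fun z => (w z `^ (p - 1))%:E * potential g s f z) x <=
  (2 * C)%:E * (A%:E * \int[m]_z (D z * w z `^ p)%:E + (A `^ (1 - p) * C)%:E) *
  potential g s f x.
Proof.
move=> A0 mf f0 mw w0 sx0.
have mwp (q : R) : measurable_fun setT (fun z => w z `^ q)%R.
  by apply: (@measurableT_comp _ _ _ _ _ _ (fun a : R => a `^ q)%R);
    [exact: measurable_powR|exact: mw].
pose h z := (g x z * w z `^ (p - 1))%:E.
have mh : measurable_fun setT h.
  apply/measurable_EFinP; apply: measurable_funM => //.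
  exact: measurable_kernel1.
have h0 z : 0 <= h z by rewrite lee_fin mulr_ge0// powR_ge0.
set I := \int[m]_z _.
have I0 : 0 <= I.
  by apply: integral_ge0 => z _; rewrite lee_fin mulr_ge0// powR_ge0.
set K := (2 * C)%:E * _.
have K0 : 0 <= K.
  rewrite mule_ge0// ?lee_fin ?mulr_ge0 ?(ltW C0)// adde_ge0// ?mule_ge0//.
    by rewrite lee_fin ltW.
  by rewrite lee_fin mulr_ge0 ?powR_ge0// ltW.
have mI : measurable_fun setT (fun z => (D z * w z `^ p)%:E).
  by apply/measurable_EFinP; apply: measurable_funM => //; exact: gk_measurable gk.
have mom y : \int[m]_z ((A `^ (1 - p))%:E * (D z * (g z y / D y) `^ p)%:E) <=
    (A `^ (1 - p) * C)%:E.
  rewrite ge0_integralZl//; last 2 first.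
  - by move=> z _; rewrite lee_fin mulr_ge0// powR_ge0.
  - by rewrite lee_fin powR_ge0.
  by rewrite EFinM lee_wpmul2l// ?lee_fin ?powR_ge0//; exact: sk_moment sk y.
(* Bound of the inner integral in z, for fixed y off x; F y collects what
   remains after the 3G inequality and the splitting with k = g(z,y)/D(y). *)
have hle y : x <> y -> potential g m h y <= K * (g x y)%:E.
  move=> xy.
  pose F y z := A%:E * (D z * w z `^ p)%:E +
    (A `^ (1 - p))%:E * (D z * (g z y / D y) `^ p)%:E.
  have F0 y' z : 0 <= F y' z.
    by rewrite adde_ge0// mule_ge0// lee_fin ?mulr_ge0// ?powR_ge0// ltW.
  have mF y' : measurable_fun setT (F y').
    apply: emeasurable_funD; apply: emeasurable_funM => //.
  have F1 y' : \int[m]_z F y' z <= A%:E * I + (A `^ (1 - p) * C)%:E.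
    rewrite /F ge0_integralD//=; last 4 first.
    - by move=> z _; rewrite mule_ge0// lee_fin ?mulr_ge0 ?powR_ge0// ltW.
    - by apply: emeasurable_funM => //.
    - by move=> z _; rewrite mule_ge0// lee_fin ?mulr_ge0 ?powR_ge0.
    - by apply: emeasurable_funM.
    apply: leeD (mom _); rewrite /I -ge0_integralZl//.
      by move=> z _; rewrite lee_fin mulr_ge0// powR_ge0.
    by rewrite lee_fin ltW.
  have -> : K * (g x y)%:E = (C * g x y)%:E *
      ((A%:E * I + (A `^ (1 - p) * C)%:E) + (A%:E * I + (A `^ (1 - p) * C)%:E)).
    rewrite /K; set J := (_ + _)%E.
    have -> : J + J = 2%:E * J by rewrite -mule2n mule_natl.
    by rewrite !EFinM -!muleA muleCA; congr (_ * _); rewrite [RHS]muleCA [J * _]muleC.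
  apply: (@le_trans _ _ (\int[m]_z ((C * g x y)%:E * (F x z + F y z)))).
    apply: ge0_le_integral => //.
    - by move=> z _; rewrite mule_ge0// lee_fin.
    - exact: measurable_kernelM.
    - apply: emeasurable_funM; first exact: measurable_cst.
      by apply: emeasurable_funD; exact: mF.
    move=> z _; rewrite /h /F -!EFinM lee_fin.
    have := sk_3G sk z xy; rewrite mulrA (mulrC (g y z)) (gC y z) => G3.
    apply: le_trans (ler_wpM2r (powR_ge0 _ _) G3) _.
    rewrite -!mulrA; rewrite ler_wpM2l ?(ltW C0)// ler_wpM2l//.
    have Ya := @young_split _ p A (g x z / D x) (w z) p1 A0
      (divr_ge0 (g0 x z) (D0 x)) (w0 z).
    have Yb := @young_split _ p A (g z y / D y) (w z) p1 A0
      (divr_ge0 (g0 z y) (D0 y)) (w0 z).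
    have := ler_wpM2l (D0 z) (lerD Ya Yb); rewrite (gC z x).
    by move=> h1; apply: le_trans (le_trans h1 _); rewrite le_eqVlt; apply/orP; left; apply/eqP; ring.
  rewrite ge0_integralZl//; last 3 first.
  - by apply: emeasurable_funD; exact: mF.
  - by move=> z _; rewrite adde_ge0.
  - by rewrite lee_fin mulr_ge0// ltW.
  rewrite lee_wpmul2l// ?lee_fin ?mulr_ge0 ?(ltW C0)//.
  by rewrite ge0_integralD// leeD.
have -> : potential g m (fun z => (w z `^ (p - 1))%:E * potential g s f z) x =
    \int[s]_y (f y * potential g m h y).
  rewrite -potential_duality//; apply: eq_integral => z _.
  by rewrite /h EFinM muleA.
rewrite /potential -ge0_integralZl//; last 2 first.
- exact: measurable_kernelM.
- by move=> y _; rewrite mule_ge0// lee_fin.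
apply: ae_ge0_le_integral => //.
- by move=> y _; rewrite mule_ge0//; exact: potential_ge0.
- by apply: emeasurable_funM => //; exact: measurable_potential.
- by move=> y _; apply: mule_ge0 => //; apply: mule_ge0 => //; rewrite lee_fin.
- by apply: emeasurable_funM; [exact: measurable_cst|exact: measurable_kernelM].
exists [set x]; split=> //; first exact: gk_point gk x.
move=> y /=; apply: contra_notP => /nesym xy _.
by rewrite muleA [leRHS]muleC lee_wpmul2l// hle.
Qed.

End subcritical.
End green.
End green_kernel.

(** * The Picard iteration *)

Section ereal_sup_range.
Local Open Scope ereal_scope.
Context (R : realType).
Implicit Types (a b : (\bar R)^nat).

Lemma le_poweR (p : R) (x y : \bar R) : (0 <= p)%R -> 0 <= x -> x <= y ->
  x `^ p <= y `^ p.
Proof.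
move=> p0 x0 xy; apply: gt0_ler_poweR => //.
- by rewrite in_itv/= x0 leey.
- by rewrite in_itv/= (le_trans x0 xy) leey.
Qed.

(** The power map of exponent p is an order isomorphism of [0,+oo], with
inverse the power map of exponent 1/p. *)
Lemma poweR_ereal_sup (p : R) a : (0 < p)%R -> (forall n, 0 <= a n) ->
  ereal_sup (range a) `^ p = ereal_sup (range (fun n => a n `^ p)).
Proof.
move=> p0 a0.
have S0 : 0 <= ereal_sup (range a).
  by apply: le_trans (a0 0%N) _; apply: ereal_sup_ubound; exists 0%N.
apply/eqP; rewrite eq_le; apply/andP; split; last first.
  apply: ge_ereal_sup => _ [n _ <-]; apply: le_poweR (ltW p0) _ _ => //.
  by apply: ereal_sup_ubound; exists n.
set S := ereal_sup (range (fun n => a n `^ p)).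
have pVp : (p^-1 * p = 1)%R by rewrite mulVf// gt_eqF.
have S'0 : 0 <= S.
  apply: le_trans (poweR_ge0 (a 0%N) p) _.
  by apply: ereal_sup_ubound; exists 0%N.
rewrite -[leRHS]poweRe1// -pVp poweRrM; apply: le_poweR (ltW p0) S0 _.
apply: ge_ereal_sup => _ [n _ <-].
rewrite -[leLHS]poweRe1// -pVp mulrC poweRrM; apply: le_poweR.
- by rewrite invr_ge0 ltW.
- exact: poweR_ge0.
- by apply: ereal_sup_ubound; exists n.
Qed.

Lemma ereal_supD a b : nondecreasing_seq a -> nondecreasing_seq b ->
  (forall n, 0 <= a n) -> (forall n, 0 <= b n) ->
  ereal_sup (range (fun n => a n + b n)) =
  ereal_sup (range a) + ereal_sup (range b).
Proof.
move=> nda ndb a0 b0.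
have ndab : nondecreasing_seq (fun n => a n + b n).
  by move=> i j ij; apply: leeD; [exact: nda|exact: ndb].
have ge0 (c : (\bar R)^nat) : (forall n, 0 <= c n) -> 0 <= ereal_sup (range c).
  move=> c0; apply: le_trans (c0 0%N) _; apply: ereal_sup_ubound.
  by exists 0%N.
have /cvg_lim <- // := ereal_nondecreasing_cvgn ndab.
apply/cvg_lim => //; apply: cvgeD.
- by apply: ge0_adde_def; rewrite inE; exact: ge0.
- exact: ereal_nondecreasing_cvgn.
- exact: ereal_nondecreasing_cvgn.
Qed.

Lemma ereal_sup_shift a : nondecreasing_seq a ->
  ereal_sup (range (fun n => a n.+1)) = ereal_sup (range a).
Proof.
move=> nda; apply/eqP; rewrite eq_le; apply/andP; split.
  by apply: ge_ereal_sup => _ [n _ <-]; apply: ereal_sup_ubound; exists n.+1.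
apply: ge_ereal_sup => _ [n _ <-]; apply: le_trans (nda _ _ (leqnSn n)) _.
by apply: ereal_sup_ubound; exists n.
Qed.

End ereal_sup_range.

Section picard.
Local Open Scope ereal_scope.
Context d (T : measurableType d) (R : realType).
Variables (m mu : {sigma_finite_measure set T -> \bar R}).
Variables (g : T -> T -> R) (kg : sym_kernel g) (p : R) (p1 : (1 < p)%R).
Let p0 : (0 < p)%R. Proof. exact: lt_trans p1. Qed.

Lemma measurable_poweR_comp (h : T -> \bar R) (q : R) : measurable_fun setT h ->
  measurable_fun setT (fun x => h x `^ q).
Proof. by move=> mh; exact: (measurableT_comp (measurable_poweR q) mh). Qed.

Lemma measurable_ereal_sup (a : nat -> T -> \bar R) :
  (forall n, measurable_fun setT (a n)) ->
  measurable_fun setT (fun x => ereal_sup (range (a ^~ x))).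
Proof.
move=> ma; rewrite [X in measurable_fun _ X](_ : _ = (fun x => esups (a ^~ x) 0%N)).
  exact: measurable_fun_esups.
apply/funext => x; rewrite /esups /sdrop; congr ereal_sup.
by apply/seteqP; split=> [_ [n _ <-]|_ [n _ <-]]; exists n.
Qed.

Lemma potential_ereal_sup (s : {measure set T -> \bar R}) (a : nat -> T -> \bar R) x :
  (forall n, measurable_fun setT (a n)) -> (forall n y, 0 <= a n y) ->
  (forall y, nondecreasing_seq (a ^~ y)) ->
  potential g s (fun y => ereal_sup (range (a ^~ y))) x =
  ereal_sup (range (fun n => potential g s (a n) x)).
Proof.
move=> ma a0 nda; have [g0 _ _] := kg.
have nd y : nondecreasing_seq (fun n => (g x y)%:E * a n y).
  by move=> i j ij; rewrite lee_wpmul2l ?lee_fin//; exact: nda.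
have ndP : nondecreasing_seq (fun n => potential g s (a n) x).
  move=> i j ij; apply: le_potential => //; apply: nearW => y; exact: nda.
have /cvg_lim <- // := ereal_nondecreasing_cvgn ndP.
rewrite /potential -monotone_convergence//.
- apply: eq_integral => y _; apply/esym/cvg_lim => //; apply: cvgeZl => //.
  exact: ereal_nondecreasing_cvgn.
- by move=> n; exact: measurable_kernelM.
- by move=> n y _; rewrite mule_ge0// lee_fin.
Qed.

Let P := potential g mu (cst 1).

Let P0 x : 0 <= P x. Proof. exact: potential_ge0. Qed.
Let mP : measurable_fun setT P. Proof. exact: measurable_potential. Qed.

(** The iteration starts at 0 and takes values in [0,+oo], so that it needs no
integrability assumption; solvability is decided afterwards by the size of its
supremum. *)
Fixpoint picard (l : R) (n : nat) : T -> \bar R :=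
  if n is n'.+1 then
    fun x => potential g m (fun y => picard l n' y `^ p) x + l%:E * P x
  else cst 0.

Lemma picard_ge0 l n x : (0 <= l)%R -> 0 <= picard l n x.
Proof.
move=> l0; case: n => [|n]//=; rewrite adde_ge0// ?mule_ge0//.
by apply: potential_ge0 => // y; exact: poweR_ge0.
Qed.

Lemma measurable_picard l n : measurable_fun setT (picard l n).
Proof.
elim: n => [|n IH] /=; first exact: measurable_cst.
apply: emeasurable_funD; last exact: emeasurable_funM.
apply: measurable_potential => //; last by move=> y; exact: poweR_ge0.
exact: measurable_poweR_comp.
Qed.

Lemma picard_nondecreasing l x : (0 <= l)%R ->
  nondecreasing_seq (fun n => picard l n x).
Proof.
move=> l0; apply/nondecreasing_seqP => n; elim: n x => [|n IH] x.
  exact: picard_ge0.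
rewrite /= leeD2r//; apply: le_potential => //.
- exact/measurable_poweR_comp/measurable_picard.
- exact: (measurable_poweR_comp p (measurable_picard l n.+1)).
- by move=> y; exact: poweR_ge0.
- by move=> y; exact: poweR_ge0.
by apply: nearW => y; apply: le_poweR (ltW p0) (picard_ge0 _ _ _) _.
Qed.

Definition picard_sup (l : R) (x : T) : \bar R :=
  ereal_sup (range (fun n => picard l n x)).

Lemma picard_sup_ge0 l x : (0 <= l)%R -> 0 <= picard_sup l x.
Proof.
move=> l0; apply: le_trans (picard_ge0 0 x l0) _.
by apply: ereal_sup_ubound; exists 0%N.
Qed.

Lemma measurable_picard_sup l : measurable_fun setT (picard_sup l).
Proof. by apply: measurable_ereal_sup => n; exact: measurable_picard. Qed.

(** Monotone convergence in both terms of the recursion. *)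
Lemma picard_supE l x : (0 <= l)%R ->
  picard_sup l x = potential g m (fun y => picard_sup l y `^ p) x + l%:E * P x.
Proof.
move=> l0; rewrite {1}/picard_sup -ereal_sup_shift; last exact: picard_nondecreasing.
rewrite /= ereal_supD//.
- congr (_ + _); last first.
    by rewrite (_ : range _ = [set l%:E * P x]) ?ereal_sup1//;
       apply/seteqP; split=> [_ [n _ <-]//|_ ->]; exists 0%N.
  rewrite -potential_ereal_sup//.
  + by apply: eq_integral => y _; rewrite -poweR_ereal_sup// => n; exact: picard_ge0.
  + by move=> n; exact/measurable_poweR_comp/measurable_picard.
  + by move=> n y; exact: poweR_ge0.
  + move=> y i j ij; apply: le_poweR (ltW p0) (picard_ge0 _ _ l0) _.
    exact: picard_nondecreasing.
- move=> i j ij; apply: le_potential => //.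
  + exact/measurable_poweR_comp/measurable_picard.
  + exact/measurable_poweR_comp/measurable_picard.
  + by move=> y; exact: poweR_ge0.
  + by move=> y; exact: poweR_ge0.
  + apply: nearW => y; apply: le_poweR (ltW p0) (picard_ge0 _ _ l0) _.
    exact: picard_nondecreasing.
- by move=> n; apply: potential_ge0 => // y; exact: poweR_ge0.
- by move=> n; rewrite mule_ge0.
Qed.

(** Each iterate stays below a supersolution, by monotonicity of the recursion;
as the potential only sees its density up to null sets, an inequality almost
everywhere is enough. *)
Lemma picard_sup_min l (v : T -> \bar R) : (0 <= l)%R ->
  measurable_fun setT v -> (forall x, 0 <= v x) ->
  {ae m, forall x, potential g m (fun y => v y `^ p) x + l%:E * P x <= v x} ->
  {ae m, forall x, picard_sup l x <= v x}.
Proof.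
move=> l0 mv v0 sv.
suff : {ae m, forall x n, picard l n x <= v x}.
  by apply: filterS => x h; apply: ge_ereal_sup => _ [n _ <-].
apply/ae_foralln => n; elim: n => [|n IH]; first exact: nearW.
apply: filterS sv => x; apply: le_trans; rewrite /= leeD2r//.
apply: le_potential => //.
- exact/measurable_poweR_comp/measurable_picard.
- exact/measurable_poweR_comp.
- by move=> y; exact: poweR_ge0.
- by move=> y; exact: poweR_ge0.
by apply: filterS IH => y; apply: le_poweR (ltW p0) (picard_ge0 _ _ l0).
Qed.

End picard.

(** * Bounds for weighted integrals of potentials *)

Section estimates.
Local Open Scope ereal_scope.
Context d (T : measurableType d) (R : realType).
Variables (m mu : {sigma_finite_measure set T -> \bar R}).
Variables (g : T -> T -> R) (D : T -> R) (C : R) (gk : green_kernel m g D C).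
Implicit Types (f h : T -> \bar R) (s : {sigma_finite_measure set T -> \bar R}).
Let kg := gk_kernel gk.
Let g0 : forall x y, (0 <= g x y)%R. Proof. by case: kg. Qed.
Let gC : forall x y, g x y = g y x. Proof. by case: kg. Qed.
Let C0 := gk_const gk.
Let D0 := gk_ge0 gk.
Let mD : measurable_fun setT (EFin \o D).
Proof. exact/measurable_EFinP/(gk_measurable gk). Qed.

Lemma potential_support (s : {measure set T -> \bar R}) f x : D x = 0%R ->
  potential g s f x = 0.
Proof.
move=> Dx; rewrite /potential integral0_eq// => y _.
by rewrite (gk_support gk)// mul0e.
Qed.

Lemma measurable_weight f : measurable_fun setT f ->
  measurable_fun setT (fun x => (D x)%:E * f x).
Proof. by move=> mf; exact: emeasurable_funM. Qed.

Lemma ae_off_point (s : {measure set T -> \bar R}) x (Q : T -> Prop) :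
  s [set x] = 0 -> (forall y, x <> y -> Q y) -> {ae s, forall y, Q y}.
Proof.
move=> sx0 Qy; exists [set x]; split=> //; first exact: gk_point gk x.
by move=> y /=; apply: contra_notP => /nesym xy; exact: Qy.
Qed.

(** Integrated form of the lower bound g(x,y) >= D(x) D(y) / C. *)
Lemma potential_lower s f x : measurable_fun setT f -> (forall y, 0 <= f y) ->
  s [set x] = 0 ->
  (D x)%:E * \int[s]_y ((D y)%:E * f y) <= C%:E * potential g s f x.
Proof.
move=> mf f0 sx0; rewrite /potential -!ge0_integralZl//; last 6 first.
- exact: measurable_weight.
- by move=> y _; rewrite mule_ge0// lee_fin.
- by rewrite lee_fin.
- exact: measurable_kernelM.
- by move=> y _; rewrite mule_ge0// lee_fin.
- by rewrite lee_fin ltW.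
apply: ae_ge0_le_integral => //.
- by move=> y _; rewrite !mule_ge0// lee_fin.
- by apply: emeasurable_funM => //; exact: measurable_weight.
- by move=> y _; rewrite !mule_ge0// lee_fin// ltW.
- by apply: emeasurable_funM => //; exact: measurable_kernelM.
apply: ae_off_point sx0 _ => y xy _.
by rewrite !muleA -!EFinM lee_wpmul2r// lee_fin; exact: gk_lower gk _ _ xy.
Qed.

(** [potential_lower] for f = D, as int D^2 is positive. *)
Lemma weight_potential_lower : exists2 c : R, (0 < c)%R &
  forall x, (c * D x)%:E <= potential g m (EFin \o D) x.
Proof.
have Q0 := gk_nontrivial gk.
have [q q0 qQ] : exists2 q : R, (0 < q)%R &
    q%:E <= \int[m]_y ((D y)%:E * (EFin \o D) y).
  move: Q0; under eq_integral do rewrite EFinM; case: (integral _ _ _) => [r|_|//].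
    by rewrite lte_fin => r0; exists r.
  by exists 1%R; rewrite ?leey.
exists (C^-1 * q)%R => [|x]; first by rewrite mulr_gt0// invr_gt0.
have := @potential_lower m (EFin \o D) x mD D0 (gk_atomless gk x).
rewrite -lee_pdivrMl//; apply: le_trans.
by rewrite -mulrA EFinM lee_wpmul2l ?lee_fin ?invr_ge0 ?(ltW C0)// mulrC EFinM
  lee_wpmul2l// lee_fin.
Qed.

(** Duality with G[D] <= C D. *)
Lemma weight_potential_upper s f : measurable_fun setT f -> (forall y, 0 <= f y) ->
  \int[m]_x ((D x)%:E * potential g s f x) <=
  C%:E * \int[s]_x ((D x)%:E * f x).
Proof.
move=> mf f0.
rewrite (@potential_duality _ _ _ g s m f (EFin \o D) kg)//.
rewrite -ge0_integralZl//; last 3 first.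
- exact: measurable_weight.
- by move=> y _; rewrite mule_ge0// lee_fin.
- by rewrite lee_fin ltW.
apply: ge0_le_integral => //.
- by move=> x _; rewrite mule_ge0//; exact: potential_ge0.
- by apply: emeasurable_funM => //; exact: measurable_potential.
- by apply: emeasurable_funM => //; exact: measurable_weight.
move=> x _; rewrite muleC muleA lee_wpmul2r//.
by rewrite -EFinM; exact: gk_upper gk x.
Qed.

Lemma weight_ae_fin f (q : R) : (0 < q)%R -> measurable_fun setT f ->
  (forall x, 0 <= f x) -> \int[m]_x ((D x)%:E * f x `^ q) < +oo ->
  {ae m, forall x, D x != 0%R -> f x < +oo}.
Proof.
move=> q0 mf f0 foo.
have : m.-integrable setT (fun x => (D x)%:E * f x `^ q).
  apply/integrableP; split.
    by apply: measurable_weight; exact: measurable_poweR_comp.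
  under eq_integral do rewrite gee0_abs ?mule_ge0 ?poweR_ge0 ?lee_fin//.
  by [].
move/integrable_ae => /(_ measurableT); apply: filterS => x /(_ I) fx Dx.
have Dx0 : (0 < D x)%R by rewrite lt_neqAle eq_sym Dx/=.
rewrite ltNge leye_eq; apply: contraTN fx => /eqP ->.
by rewrite poweRyr ?gt_eqF// gt0_muley ?lte_fin.
Qed.

Section measure_data.
Hypothesis mu1 : \int[mu]_x (D x)%:E = 1.
Hypothesis mu_atom : {ae m, forall x, mu [set x] = 0}.
Let P := potential g mu (cst 1).
Let P0 x : 0 <= P x. Proof. exact: potential_ge0. Qed.
Let mP : measurable_fun setT P. Proof. exact: measurable_potential. Qed.

Let muD1 : \int[mu]_x ((D x)%:E * cst 1 x) = 1.
Proof. by under eq_integral do rewrite mule1. Qed.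

(** G[mu] is integrable against D, and vanishes where D does. *)
Lemma green_potential_fin : {ae m, forall x, P x < +oo}.
Proof.
have : \int[m]_x ((D x)%:E * P x `^ 1) < +oo.
  under eq_integral do rewrite poweRe1//.
  apply: le_lt_trans (weight_potential_upper mu _ _) _ => //.
  by rewrite muD1 mule1 ltry.
move/(weight_ae_fin ltr01 mP P0); apply: filterS => x h.
have [Dx|/h//] := eqVneq (D x) 0%R.
by rewrite /P potential_support.
Qed.

Lemma green_potential_lower :
  {ae m, forall x, (D x)%:E <= C%:E * P x}.
Proof.
apply: filterS mu_atom => x mux.
by have := @potential_lower mu (cst 1) x (measurable_cst _) (fun=> lee01) mux;
  rewrite muD1 mule1.
Qed.

Section subcritical.
Variables (p : R) (sk : subcritical_kernel m g D C p).
Let p1 := sk_gt1 sk.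
Let p0 : (0 < p)%R. Proof. exact: lt_trans p1. Qed.

Let mkDp : measurable_fun setT (fun z : T * T => ((g z.1 z.2 / D z.2) `^ p)%R).
Proof.
have mdiv : measurable_fun setT (fun z : T * T => g z.1 z.2 / D z.2)%R.
  apply: measurable_funM; first by case: kg.
  have -> : (fun z : T * T => (D z.2)^-1)%R = (@powR R ^~ (-1)%R) \o (D \o snd).
    by apply/funext => z /=; rewrite powR_inv1.
  apply: (measurableT_comp (measurable_powR (-1)%R)).
  exact: (measurableT_comp (gk_measurable gk) measurable_snd).
exact: (measurableT_comp (measurable_powR p) mdiv).
Qed.

(** As int D dmu = 1, G[mu](x) is the mean of k(y) = g(x,y)/D(y) for the
probability measure D mu, so that G[mu]^p is controlled by the mean of k^p, up
to a constant; int D k^p is bounded by [sk_moment], uniformly in y. The convexity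
inequality is obtained from [young_split] with w = G[mu](x) and A = 1/2: the term
A G[mu]^p is absorbed, since G[mu](x) is finite for almost every x. *)
Lemma green_potential_Lp : \int[m]_x ((D x)%:E * P x `^ p) < +oo.
Proof.
pose J x := \int[mu]_y ((D y)%:E * ((g x y / D y) `^ p)%:E).
have J0 x : 0 <= J x.
  by apply: integral_ge0 => y _; rewrite mule_ge0// lee_fin ?powR_ge0.
have mF : measurable_fun setT (fun z : T * T => (D z.2)%:E * ((g z.1 z.2 / D z.2) `^ p)%:E).
  apply: emeasurable_funM; last exact/measurable_EFinP.
  exact: measurableT_comp mD measurable_snd.
have mJ : measurable_fun setT J.
  apply: (measurable_fun_fubini_tonelli_F
    (fun z : T * T => (D z.2)%:E * ((g z.1 z.2 / D z.2) `^ p)%:E)) => // z.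
  by rewrite mule_ge0// lee_fin ?powR_ge0.
have mJx x : measurable_fun setT (fun y => (D y)%:E * ((g x y / D y) `^ p)%:E).
  exact: (measurableT_comp mF (pair1_measurable x)).
pose A : R := (2^-1)%R; pose B : R := (A `^ (1 - p))%R.
have A0 : (0 < A)%R by rewrite invr_gt0.
have B_gt0 : (0 < B)%R by exact: powR_gt0.
have B0 := ltW B_gt0.
have PJ : {ae m, forall x, P x `^ p <= (2 * B)%:E * J x}.
  apply: filterS green_potential_fin => x Pfin.
  have [r Pr r0] : exists2 r : R, P x = r%:E & (0 <= r)%R.
    by case: (P x) Pfin (P0 x) => // r _; exists r.
  suff : P x `^ p <= A%:E * P x `^ p + B%:E * J x.
    rewrite Pr poweR_EFin; case: (J x) (J0 x) => [j|_ _|//].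
      rewrite -!EFinM -EFinD !lee_fin /A => j0; lra.
    by rewrite gt0_muley ?lte_fin ?mulr_gt0// leey.
  have PpE : P x `^ p = \int[mu]_y ((g x y)%:E * (r `^ (p - 1))%:E).
    rewrite ge0_integralZr//; last 3 first.
    - by apply/measurable_EFinP; exact: measurable_kernel1.
    - by move=> y _; rewrite lee_fin.
    - by rewrite lee_fin powR_ge0.
    have -> : \int[mu]_y (g x y)%:E = P x.
      by apply: eq_integral => y _; rewrite mule1.
    rewrite Pr poweR_EFin -EFinM -{2}(powRr1 r0) -powRD ?subrKC//.
    by apply/implyP => /eqP; have := p1; lra.
  rewrite [leLHS]PpE Pr poweR_EFin.
  have -> : A%:E * (r `^ p)%:E = \int[mu]_y ((A * r `^ p)%:E * (D y)%:E).
    rewrite ge0_integralZl ?mu1 ?mule1 ?EFinM//.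
    - by move=> y _; rewrite lee_fin.
    - by rewrite lee_fin mulr_ge0 ?powR_ge0 ?ltW.
  rewrite -ge0_integralZl//; last first.
    by move=> y _; rewrite mule_ge0// lee_fin ?powR_ge0.
  rewrite -ge0_integralD//; last 4 first.
  - by move=> y _; rewrite mule_ge0// lee_fin// mulr_ge0 ?powR_ge0 ?ltW.
  - exact: emeasurable_funM.
  - by move=> y _; rewrite !mule_ge0// lee_fin ?powR_ge0.
  - exact: emeasurable_funM.
  apply: ge0_le_integral => //.
  - by move=> y _; rewrite mule_ge0// lee_fin// powR_ge0.
  - by apply: emeasurable_funM => //; apply/measurable_EFinP/measurable_kernel1.
  - by apply: emeasurable_funD; apply: emeasurable_funM.
  move=> y _; rewrite -!EFinM -EFinD lee_fin.
  have [Dy|Dy] := eqVneq (D y) 0%R.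
    by rewrite gC (gk_support gk)// Dy !(mul0r, mulr0) addr0.
  have -> : g x y = (D y * (g x y / D y))%R by rewrite mulrC divfK.
  have -> : ((D y * (g x y / D y)) / D y = g x y / D y)%R.
    by rewrite [(D y * _)%R]mulrC divfK.
  have := ler_wpM2l (D0 y)
    (@young_split _ p A (g x y / D y) r p1 A0 (divr_ge0 (g0 x y) (D0 y)) r0).
  by rewrite -/B; lra.
apply: (@le_lt_trans _ _ (\int[m]_x ((2 * B)%:E * ((D x)%:E * J x)))).
  apply: ae_ge0_le_integral => //.
  - by move=> x _; rewrite mule_ge0 ?poweR_ge0// lee_fin.
  - by apply: measurable_weight; exact: measurable_poweR_comp.
  - by move=> x _; rewrite !mule_ge0// lee_fin// mulr_ge0.
  - by apply: emeasurable_funM => //; exact: measurable_weight.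
  apply: filterS PJ => x PJx _.
  by rewrite muleCA lee_wpmul2l// lee_fin.
rewrite ge0_integralZl//; last 3 first.
- exact: measurable_weight.
- by move=> x _; rewrite mule_ge0// lee_fin.
- by rewrite lee_fin mulr_ge0.
suff : \int[m]_x ((D x)%:E * J x) <= C%:E.
  move=> h; apply: le_lt_trans (lee_wpmul2l _ h) _; last by rewrite -EFinM ltry.
  by rewrite lee_fin mulr_ge0.
pose F (z : T * T) := (D z.1)%:E * ((D z.2)%:E * ((g z.1 z.2 / D z.2) `^ p)%:E).
have F0 z : 0 <= F z by rewrite /F !mule_ge0// lee_fin ?powR_ge0.
have -> : \int[m]_x ((D x)%:E * J x) = \int[m]_x \int[mu]_y F (x, y).
  apply: eq_integral => x _; rewrite /J -ge0_integralZl//.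
  - by move=> y _; rewrite mule_ge0// lee_fin ?powR_ge0.
  - by rewrite lee_fin.
rewrite fubini_tonelli//; last first.
  apply: emeasurable_funM => //.
  exact: measurableT_comp mD measurable_fst.
apply: (@le_trans _ _ (\int[mu]_y (C%:E * (D y)%:E))); last first.
  by rewrite ge0_integralZl// ?mu1 ?mule1// ?lee_fin ?ltW// => y _; rewrite lee_fin.
apply: ge0_le_integral => //.
- by move=> y _; apply: integral_ge0 => x _; exact: F0.
- apply: (@measurable_fun_fubini_tonelli_G _ _ _ _ _ m F) => //.
  apply: emeasurable_funM => //.
  exact: measurableT_comp mD measurable_fst.
- exact: emeasurable_funM.
move=> y _; rewrite /F/=.
under eq_integral do rewrite muleCA.
rewrite ge0_integralZl//; last 3 first.
- apply: emeasurable_funM => //; apply/measurable_EFinP.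
  exact: (measurableT_comp mkDp (pair2_measurable y)).
- by move=> x _; rewrite mule_ge0// lee_fin ?powR_ge0.
- by rewrite lee_fin.
rewrite muleC lee_wpmul2r// ?lee_fin//.
by under eq_integral do rewrite -EFinM; exact: (sk_moment sk).
Qed.

(** [potential_weight] with w = G[mu] and A = 1, as G[mu]^p = w^(p-1) G[mu] and
int D w^p is finite. *)
Lemma potential_green_potential : exists2 K : R, (0 < K)%R &
  {ae m, forall x, potential g m (fun y => P y `^ p) x <= K%:E * P x}.
Proof.
have Poo := green_potential_Lp.
pose w x := fine (P x).
have w0 x : (0 <= w x)%R by exact: fine_ge0.
have mw : measurable_fun setT w by exact: measurableT_comp mP.
have wE : {ae m, forall x, P x = (w x)%:E}.
  by apply: filterS green_potential_fin => x Px; rewrite /w fineK// ge0_fin_numE.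
set I := \int[m]_z (D z * w z `^ p)%:E.
have [i [i0 Ii]] : exists i : R, (0 <= i)%R /\ I <= i%:E.
  suff : I < +oo.
    have : 0 <= I by apply: integral_ge0 => x _; rewrite lee_fin mulr_ge0 ?powR_ge0.
    by case: I => // r r0 _; exists r.
  apply: le_lt_trans _ Poo; apply: ge0_le_integral => //.
  - by move=> x _; rewrite lee_fin mulr_ge0 ?powR_ge0.
  - apply/measurable_EFinP; apply: measurable_funM; first exact: gk_measurable gk.
    exact: (measurableT_comp (measurable_powR p) mw).
  - by apply: measurable_weight; exact: measurable_poweR_comp.
  move=> x _; rewrite EFinM lee_wpmul2l ?lee_fin// -poweR_EFin.
  apply: le_poweR (ltW p0) _ _; first by rewrite lee_fin.
  by rewrite /w; case: (P x) (P0 x) => [r|_|]//.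
exists (2 * C * (i + 1 `^ (1 - p) * C))%R.
  by rewrite powR1 !mulr_gt0// ltr_wpDl// mul1r.
apply: filterS mu_atom => x mux.
have := @potential_weight _ _ _ _ _ _ _ gk p sk mu (cst 1) w 1 x ltr01
  (measurable_cst _) (fun=> lee01) mw w0 mux.
rewrite -/P => h; apply: le_trans (le_trans h _).
  apply: le_potential => //.
  - exact: measurable_poweR_comp.
  - apply: emeasurable_funM => //; apply/measurable_EFinP.
    exact: (measurableT_comp (measurable_powR (p - 1)) mw).
  - by move=> y; exact: poweR_ge0.
  - by move=> y; rewrite mule_ge0// lee_fin powR_ge0.
  apply: filterS wE => y ->; rewrite poweR_EFin -EFinM lee_fin.
  rewrite -{3}(powRr1 (w0 y)) -powRD ?subrK//.
  by apply/implyP => /eqP; have := p1; lra.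
rewrite lee_wpmul2r// [(2 * C * (_ + _))%:E]EFinM lee_wpmul2l// ?lee_fin ?mulr_ge0 ?(ltW C0)//.
by rewrite mul1e EFinD leeD2r.
Qed.

End subcritical.
End measure_data.
End estimates.

(** * The threshold for an abstract kernel *)

Lemma powR_onto (R : realType) (q a : R) : q != 0 -> 0 < a ->
  exists2 A : R, 0 < A & A `^ q = a.
Proof.
move=> q0 a0; exists (a `^ q^-1); first exact: powR_gt0.
by rewrite -powRrM mulVf// powRr1// ltW.
Qed.

Section threshold.
Local Open Scope ereal_scope.
Context d (T : measurableType d) (R : realType).
Variables (m mu : {sigma_finite_measure set T -> \bar R}).
Variables (g : T -> T -> R) (D : T -> R) (C : R) (gk : green_kernel m g D C).
Variables (p : R) (p1 : (1 < p)%R).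
Hypothesis mu1 : \int[mu]_x (D x)%:E = 1.
Hypothesis mu_atom : {ae m, forall x, mu [set x] = 0}.
Let p0 : (0 < p)%R. Proof. exact: lt_trans p1. Qed.
Let kg := gk_kernel gk.
Let g0 : forall x y, (0 <= g x y)%R. Proof. by case: kg. Qed.
Let C0 := gk_const gk.
Let D0 := gk_ge0 gk.
Let mD : measurable_fun setT (EFin \o D).
Proof. exact/measurable_EFinP/(gk_measurable gk). Qed.
Let P := potential g mu (cst 1).
Let P0 x : 0 <= P x. Proof. exact: potential_ge0. Qed.
Let mP : measurable_fun setT P. Proof. exact: measurable_potential. Qed.
Let U := picard_sup m mu g p.
Let U0 l x : (0 <= l)%R -> 0 <= U l x. Proof. exact: picard_sup_ge0. Qed.
Let mU l : measurable_fun setT (U l). Proof. exact: measurable_picard_sup. Qed.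
Let mUp l : measurable_fun setT (fun x => U l x `^ p).
Proof. exact: measurable_poweR_comp. Qed.
Let UE l x : (0 <= l)%R ->
  U l x = potential g m (fun y => U l y `^ p) x + l%:E * P x.
Proof. exact: picard_supE. Qed.

(** By [picard_sup_min] any solution in L^p(D) forces the smallest one to be
in L^p(D), so this is the solvability of the equation with parameter l. *)
Definition solvable (l : R) : Prop :=
  \int[m]_x ((D x)%:E * picard_sup m mu g p l x `^ p) < +oo.

Lemma solvable_le l (v : T -> \bar R) : (0 <= l)%R -> measurable_fun setT v ->
  (forall x, 0 <= v x) -> \int[m]_x ((D x)%:E * v x `^ p) < +oo ->
  {ae m, forall x, U l x <= v x} -> solvable l.
Proof.
move=> l0 mv v0 voo Uv; apply: le_lt_trans _ voo.
apply: ae_ge0_le_integral => //.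
- by move=> x _; rewrite mule_ge0 ?lee_fin// poweR_ge0.
- exact: (measurable_weight gk).
- by move=> x _; rewrite mule_ge0 ?lee_fin// poweR_ge0.
- by apply: (measurable_weight gk); exact: measurable_poweR_comp.
apply: filterS Uv => x Uvx _; rewrite lee_wpmul2l ?lee_fin//.
by apply: le_poweR (ltW p0) _ Uvx; exact: U0.
Qed.

Lemma picard_sup_homo x : {in `[0%R, +oo[ &, {homo U ^~ x : l l' / (l <= l')%R >-> l <= l'}}.
Proof.
move=> l l'; rewrite !in_itv/= !andbT => l0 l0' ll'.
apply: ge_ereal_sup => _ [n _ <-].
apply: (@le_trans _ _ (picard m mu g p l' n x)); last first.
  by apply: ereal_sup_ubound; exists n.
elim: n x => [|n IH] x//=; rewrite leeD//; last first.
  by rewrite lee_wpmul2r// lee_fin.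
apply: le_potential => //.
- exact/measurable_poweR_comp/measurable_picard.
- exact/measurable_poweR_comp/measurable_picard.
- by move=> y; exact: poweR_ge0.
- by move=> y; exact: poweR_ge0.
by apply: nearW => y; apply: le_poweR (ltW p0) _ (IH y); exact: picard_ge0.
Qed.

(** The function 2 l G[mu] is a supersolution, since
G[(2 l G[mu])^p] + l G[mu] <= ((2 l)^p K + l) G[mu], and (2 l)^p K <= l. *)
Lemma picard_sup_small (K l : R) : (0 < K)%R -> (0 < l)%R ->
  {ae m, forall x, potential g m (fun y => P y `^ p) x <= K%:E * P x} ->
  (K * 2 `^ p * l `^ (p - 1) <= 1)%R ->
  {ae m, forall x, U l x <= (2 * l)%:E * P x}.
Proof.
move=> K0 l0 PK Kl.
have l2 : (0 <= 2 * l)%R by rewrite mulr_ge0// ltW.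
apply: picard_sup_min => //; first exact: ltW.
- exact: emeasurable_funM.
- by move=> x; rewrite mule_ge0.
apply: filterS PK => x PKx; rewrite -/P.
have -> : (fun y => ((2 * l)%:E * P y) `^ p) =
    (fun y => ((2 * l) `^ p)%:E * P y `^ p).
  by apply/funext => y; rewrite poweRM.
rewrite potentialZ//; last 3 first.
- exact: measurable_poweR_comp.
- by move=> y; exact: poweR_ge0.
- by rewrite lee_fin powR_ge0.
apply: (@le_trans _ _ (((2 * l) `^ p)%:E * (K%:E * P x) + l%:E * P x)).
  by rewrite leeD2r// lee_wpmul2l// lee_fin powR_ge0.
rewrite muleA -ge0_muleDl ?mule_ge0 ?lee_fin ?powR_ge0 ?(ltW l0) ?(ltW K0)//.
rewrite lee_wpmul2r// -EFinM -EFinD lee_fin.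
have -> : ((2 * l) `^ p = 2 `^ p * (l * l `^ (p - 1)))%R.
  rewrite powRM ?(ltW l0)//; congr (_ * _)%R.
  rewrite -{2}(powRr1 (ltW l0)) -powRD ?subrKC//.
  by apply/implyP => /eqP; have := p1; lra.
by have := ler_wpM2l (ltW l0) Kl; lra.
Qed.

(** Integrate u = G[u^p] + l G[mu] against D. By duality and G[D] >= c D, the
right-hand side is at least c int D u^p + c l, while u <= A + (c/2) u^p by
[young_split] bounds the left-hand side. *)
Lemma solvable_bound : exists B : R, forall l, (0 <= l)%R -> solvable l ->
  (l <= B)%R /\ \int[m]_x ((D x)%:E * U l x `^ p) <= B%:E.
Proof.
have [c c0 cD] := weight_potential_lower gk.
have [A A0 Ac] : exists2 A : R, (0 < A)%R & (A `^ (1 - p) = c / 2)%R.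
  by apply: powR_onto; [rewrite subr_eq0 lt_eqF|rewrite divr_gt0].
have [dD dDE dD0] : exists2 r : R, \int[m]_x (D x)%:E = r%:E & (0 <= r)%R.
  have := gk_integrable gk.
  have : 0 <= \int[m]_x (D x)%:E by apply: integral_ge0 => x _; rewrite lee_fin.
  by case: (integral _ _ _) => // r r0 _; exists r.
exists (2 * (A * dD / c))%R => l l0 sl.
have mDU : measurable_fun setT (fun x => (D x)%:E * U l x `^ p).
  by apply: (measurable_weight gk).
have DU0 x : 0 <= (D x)%:E * U l x `^ p.
  by rewrite mule_ge0 ?lee_fin// poweR_ge0.
have [X XE X0] : exists2 X : R,
    \int[m]_x ((D x)%:E * U l x `^ p) = X%:E & (0 <= X)%R.
  move: sl; rewrite /solvable -/(U l).
  have : 0 <= \int[m]_x ((D x)%:E * U l x `^ p) by exact: integral_ge0.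
  by case: (integral _ _ _) => // r r0 _; exists r.
have lo : (c * X + l * c)%:E <= \int[m]_x ((D x)%:E * U l x).
  have -> : \int[m]_x ((D x)%:E * U l x) =
      \int[m]_x ((D x)%:E * potential g m (fun y => U l y `^ p) x) +
      l%:E * \int[m]_x ((D x)%:E * P x).
    rewrite -ge0_integralZl//; last 2 first.
    - exact: (measurable_weight gk).
    - by move=> x _; rewrite mule_ge0 ?lee_fin.
    rewrite -ge0_integralD//.
    - apply: eq_integral => x _; rewrite UE// ge0_muleDr ?mule_ge0 ?lee_fin//.
        by rewrite [_%:E * (l%:E * _)]muleCA.
      by apply: potential_ge0 => // y; exact: poweR_ge0.
    - move=> x _; rewrite mule_ge0 ?lee_fin//.
      by apply: potential_ge0 => // y; exact: poweR_ge0.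
    - apply: (measurable_weight gk); apply: measurable_potential => //.
      by move=> y; exact: poweR_ge0.
    - by move=> x _; rewrite !mule_ge0 ?lee_fin.
    - by apply: emeasurable_funM => //; exact: (measurable_weight gk).
  have pD0 x : 0 <= potential g m (EFin \o D) x by exact: potential_ge0.
  have mpD : measurable_fun setT (potential g m (EFin \o D)).
    exact: measurable_potential.
  rewrite EFinD; apply: leeD.
    rewrite (@potential_duality _ _ _ g m m (fun y => U l y `^ p) (EFin \o D) kg)//; last first.
      by move=> y; exact: poweR_ge0.
    rewrite EFinM -XE -ge0_integralZl//; last by rewrite lee_fin ltW.
    apply: ge0_le_integral => //.
    - by move=> x _; rewrite mule_ge0// lee_fin ltW.
    - exact: emeasurable_funM.
    - exact: emeasurable_funM.
    move=> x _; rewrite muleA -EFinM [leRHS]muleC; apply: lee_wpmul2r (cD x).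
    exact: poweR_ge0.
  rewrite EFinM lee_wpmul2l ?lee_fin//.
  rewrite (@potential_duality _ _ _ g mu m (cst 1) (EFin \o D) kg)//.
  rewrite -[c%:E]mule1 -[X in _ * X <= _]mu1 -ge0_integralZl//; last 2 first.
  - by move=> x _; rewrite lee_fin.
  - by rewrite lee_fin ltW.
  apply: ge0_le_integral => //.
  - by move=> x _; rewrite mule_ge0// lee_fin// ltW.
  - exact: emeasurable_funM.
  - exact: emeasurable_funM.
  by move=> x _ /=; rewrite mul1e; exact: cD.
have up : \int[m]_x ((D x)%:E * U l x) <= (A * dD + c / 2 * X)%:E.
  rewrite EFinD !EFinM -XE -dDE -ge0_integralZl//; last 2 first.
  - by move=> x _; rewrite lee_fin.
  - by rewrite lee_fin ltW.
  have c20 : (0 <= c / 2)%R by rewrite divr_ge0// ltW.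
  rewrite -EFinM -ge0_integralZl// -ge0_integralD//; last 4 first.
  - by move=> x _; rewrite mule_ge0// lee_fin// ltW.
  - exact: emeasurable_funM.
  - by move=> x _; rewrite mule_ge0.
  - exact: emeasurable_funM.
  apply: ge0_le_integral => //.
  - by move=> x _; rewrite mule_ge0 ?lee_fin// U0.
  - exact: (measurable_weight gk).
  - by apply: emeasurable_funD; exact: emeasurable_funM.
  move=> x _; rewrite [A%:E * _]muleC muleCA -ge0_muleDr ?mule_ge0 ?poweR_ge0 ?lee_fin ?(ltW A0)//.
  rewrite lee_wpmul2l ?lee_fin//.
  case: (U l x) (U0 x l0) => [r|_|//].
    rewrite lee_fin => r0; rewrite poweR_EFin -EFinM -EFinD lee_fin.
    by have := @young_split _ p A r 1 p1 A0 r0 ler01; rewrite !powR1 !mulr1 Ac.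
  by rewrite poweRyr ?gt_eqF// gt0_muley ?lte_fin ?divr_gt0// leey.
have := le_trans lo up; rewrite lee_fin XE lee_fin => h.
have h' : (l + X / 2 <= A * dD / c)%R.
  rewrite ler_pdivlMr//; move: h; lra.
by split; lra.
Qed.

(** Cut u^p at the level k D: u^p <= k D + w^(p-1) u, where w = u on the set
u^p > k D and w = 0 elsewhere. Since int D w^p tends to 0 as k grows,
[potential_weight] gives G[w^(p-1) G[sigma]] <= (1/2) G[sigma] for k large, first
with sigma = u^p and then with sigma = l mu. These two add up to
G[w^(p-1) u] <= u/2, whence u <= k C D + u/2 + l G[mu], and D <= C G[mu]. The
truncation thus takes the place of a bootstrap over Lebesgue exponents. *)
Lemma picard_sup_regular l (sk : subcritical_kernel m g D C p) :
  (0 <= l)%R -> solvable l ->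
  exists2 M : R, (0 <= M)%R & {ae m, forall x, U l x <= M%:E * P x}.
Proof.
move=> l0 sl.
have Ufin : {ae m, forall x, U l x < +oo}.
  apply: filterS (weight_ae_fin gk p0 (@mU l) (fun x => U0 x l0) sl) => x h.
  have [Dx|/h//] := eqVneq (D x) 0%R.
  rewrite UE// (potential_support gk)// add0e /P (potential_support gk)// mule0.
  by rewrite ltry.
pose w (k : nat) x := if U l x `^ p <= (k%:R * D x)%:E then 0%R else fine (U l x).
have w0 k x : (0 <= w k x)%R by rewrite /w; case: ifP => // _; exact/fine_ge0/U0.
have mkD k : measurable_fun setT (fun x => (k%:R * D x)%:E).
  by apply/measurable_EFinP; apply: measurable_funM => //; exact: gk_measurable gk.
have mw k : measurable_fun setT (w k).
  apply: measurable_fun_ifT => //.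
  - by apply: measurable_fun_lee.
  - by apply: measurableT_comp => //; exact: mU.
have mwp (q : R) k : measurable_fun setT (fun x => w k x `^ q)%R.
  exact: (measurableT_comp (measurable_powR q) (mw k)).
(* With this A, and with int D w^p at most 1/(8 C A), the constant of
   [potential_weight] is 2 C (1/(8 C) + 1/(8 C)) = 1/2. *)
have [A A0 Ac] : exists2 A : R, (0 < A)%R & (A `^ (1 - p) = (8 * C * C)^-1)%R.
  by apply: powR_onto; [rewrite subr_eq0 lt_eqF|rewrite invr_gt0 !mulr_gt0].
pose I k := \int[m]_x (D x * w k x `^ p)%:E.
have Icvg : I k @[k --> \oo] --> 0.
  have -> : 0 = \int[m]_x (cst 0 x) :> \bar R by rewrite integral0.
  have [| | | | |//] := @dominated_convergence _ _ _ m setT measurableT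
    (fun k x => (D x * w k x `^ p)%:E) (cst 0) (fun x => (D x)%:E * U l x `^ p).
  - move=> k; apply/measurable_EFinP; apply: measurable_funM => //.
    exact: gk_measurable gk.
  - exact: measurable_cst.
  - apply: filterS Ufin => x Uoo _; apply: cvg_near_cst.
    have [Dx|Dx] := eqVneq (D x) 0%R; first by apply: nearW => k; rewrite Dx mul0r.
    have Dx0 : (0 < D x)%R by rewrite lt_neqAle eq_sym Dx/=.
    have [r Ur r0] : exists2 r : R, U l x = r%:E & (0 <= r)%R.
      by case: (U l x) Uoo (U0 x l0) => // r _; exists r.
    near=> k; rewrite /w ifT; first by rewrite powR0 ?gt_eqF// mulr0.
    rewrite Ur poweR_EFin lee_fin -ler_pdivrMr//; near: k.
    exact: nbhs_infty_ger.
  - apply/integrableP; split; first exact: (measurable_weight gk).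
    under eq_integral do rewrite gee0_abs ?mule_ge0 ?poweR_ge0 ?lee_fin//.
    exact: sl.
  - apply: filterS Ufin => x Uoo k _; rewrite gee0_abs ?lee_fin ?mulr_ge0 ?powR_ge0//.
    rewrite EFinM lee_wpmul2l ?lee_fin// -poweR_EFin; apply: le_poweR (ltW p0) _ _.
      by rewrite lee_fin.
    rewrite /w; case: ifP => _; first exact: U0.
    by rewrite fineK// ge0_fin_numE// U0.
have [k Ik] : exists k, I k <= (8 * C * A)^-1%:E.
  have e0 : 0 < (8 * C * A)^-1%:E by rewrite lte_fin invr_gt0 !mulr_gt0.
  have [k _ /(_ k (leqnn _))/ltW h] := Icvg _ (open_ereal_lt' e0).
  by exists k.
pose V x := U l x `^ p.
have V0 x : 0 <= V x by exact: poweR_ge0.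
pose W h x := (w k x `^ (p - 1))%:E * h x.
have W0 h x : (forall x, 0 <= h x) -> 0 <= W h x.
  by move=> h0; rewrite mule_ge0// lee_fin powR_ge0.
have mW h : measurable_fun setT h -> measurable_fun setT (W h).
  by move=> mh; apply: emeasurable_funM => //; exact/measurable_EFinP.
have kap (s : {sigma_finite_measure set T -> \bar R}) f x : measurable_fun setT f -> (forall y, 0 <= f y) ->
    s [set x] = 0 ->
    potential g m (W (potential g s f)) x <= (2^-1)%:E * potential g s f x.
  move=> mf f0 sx0.
  apply: le_trans (@potential_weight _ _ _ _ _ _ _ gk p sk s f (w k) A x A0 mf
    f0 (mw k) (w0 k) sx0) _.
  rewrite lee_wpmul2r//; first exact: potential_ge0.
  apply: (@le_trans _ _ ((2 * C)%:E * (A%:E * (8 * C * A)^-1%:E + (A `^ (1 - p) * C)%:E))).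
    by rewrite lee_wpmul2l ?lee_fin ?mulr_ge0 ?(ltW C0)// leeD2r// lee_wpmul2l// lee_fin ltW.
  rewrite -!EFinM lee_fin Ac.
  rewrite le_eqVlt; apply/orP; left; apply/eqP; field.
  by rewrite !gt_eqF.
exists (2 * (k%:R * C * C + l))%R.
  by rewrite mulr_ge0// addr_ge0// !mulr_ge0// ltW.
have mpV : measurable_fun setT (potential g m V).
  by apply: measurable_potential => //; exact: mUp.
have pV0 x : 0 <= potential g m V x by exact: potential_ge0.
have UV x : U l x = potential g m V x + l%:E * P x by exact: UE.
have VW : {ae m, forall x, V x <= (k%:R * D x)%:E + W (U l) x}.
  apply: filterS Ufin => x Uoo; rewrite /V /W /w; case: ifP => [h|_].
    by rewrite -[leLHS]adde0 leeD// mule_ge0 ?lee_fin ?powR_ge0// U0.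
  have [r Ur r0] : exists2 r : R, U l x = r%:E & (0 <= r)%R.
    by case: (U l x) Uoo (U0 x l0) => // r _; exists r.
  rewrite Ur poweR_EFin/= -EFinM -EFinD lee_fin.
  rewrite -{3}(powRr1 r0) -powRD ?subrK ?lerDr ?mulr_ge0//.
  by apply/implyP => /eqP; have := p1; lra.
apply: filterS3 Ufin mu_atom (filterI (green_potential_lower gk mu1 mu_atom)
  (green_potential_fin gk mu1)) => x Uoo mux [DP Poo].
have h1 : potential g m V x <= (k%:R * C * D x)%:E + (2^-1)%:E * U l x.
  apply: le_trans (le_potential x kg (@mUp l) _ V0 _ VW) _.
  - by apply: emeasurable_funD => //; apply: mW.
  - move=> y; rewrite adde_ge0// ?W0// => [|z]; last exact: U0.
    by rewrite lee_fin mulr_ge0.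
  rewrite potentialD//; last 3 first.
  - by move=> y; rewrite lee_fin mulr_ge0.
  - exact: mW.
  - by move=> y; apply: W0 => z; exact: U0.
  apply: leeD.
    under [X in potential _ _ X]eq_fun do rewrite EFinM.
    rewrite potentialZ// -mulrA EFinM lee_wpmul2l ?lee_fin//.
    exact: gk_upper gk x.
  have -> : W (U l) = (fun y => W (potential g m V) y + l%:E * W P y).
    apply/funext => y; rewrite /W UV ge0_muleDr ?mule_ge0//.
    by rewrite [l%:E * (_ * _)]muleCA.
  rewrite potentialD//; last 4 first.
  - exact: mW.
  - by move=> y; exact: W0.
  - by apply: emeasurable_funM => //; exact: mW.
  - by move=> y; rewrite mule_ge0// W0.
  rewrite potentialZ//; last 2 first.
  - exact: mW.
  - by move=> y; exact: W0.
  rewrite UV [leRHS]ge0_muleDr ?mule_ge0 ?lee_fin//; apply: leeD.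
    by apply: kap; [exact: mUp|exact: V0|exact: gk_atomless gk x].
  by rewrite muleCA lee_wpmul2l ?lee_fin// kap.
have := UV x; have [r Ur r0] : exists2 r : R, U l x = r%:E & (0 <= r)%R.
  by case: (U l x) Uoo (U0 x l0) => // r _; exists r.
rewrite Ur => rE.
have : r%:E <= (k%:R * C * D x)%:E + (2^-1)%:E * r%:E + l%:E * P x.
  by rewrite {1}rE leeD2r// -Ur.
move: DP Poo; rewrite -/P; case: (P x) (P0 x) => // q.
rewrite -![_%:E * q%:E]EFinM -[_%:E * r%:E]EFinM -!EFinD !lee_fin => q0 Dq _ h.
by have := ler_wpM2l (mulr_ge0 (ler0n R k) (ltW C0)) Dq; lra.
Unshelve. all: by end_near. Qed.

Lemma solvable_downward l l' : (0 <= l)%R -> (l <= l')%R -> solvable l' ->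
  solvable l.
Proof.
move=> l0 ll' sl'; have l0' := le_trans l0 ll'.
apply: (@solvable_le l (U l')) => //; first by move=> x; exact: U0.
by apply: nearW => x; apply: picard_sup_homo; rewrite // in_itv/= ?l0 ?l0'.
Qed.

(** The solutions for l_k increasing to l increase to a function V with
int D V^p bounded by [solvable_bound]; V is a supersolution for l by monotone
convergence, hence dominates the smallest solution. *)
Lemma solvable_limit l : (0 < l)%R ->
  (forall l', (0 < l')%R -> (l' < l)%R -> solvable l') -> solvable l.
Proof.
move=> l_gt0 sl; have [B HB] := solvable_bound.
(* The index is shifted by 2 so that the ratio lies strictly between 0 and 1. *)
pose r k : R := (1 - k.+2%:R^-1)%R.
have r01 k : (0 < r k < 1)%R.
  rewrite /r subr_gt0 invf_lt1 ?ltr0n// ltr1n/= gtrBl.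
  by rewrite invr_gt0 ltr0n.
pose lk k : R := (l * r k)%R.
have lk0 k : (0 < lk k)%R by rewrite mulr_gt0//; case/andP: (r01 k).
have lkl k : (lk k < l)%R by rewrite gtr_pMr//; case/andP: (r01 k).
have lk_nd : {homo lk : i j / (i <= j)%N >-> (i <= j)%R}.
  move=> i j ij; rewrite ler_wpM2l ?(ltW l_gt0)// lerB// lef_pV2 ?posrE ?ltr0n//.
  by rewrite ler_nat.
have lk_cvg : lk k @[k --> \oo] --> l.
  rewrite -[X in _ --> X]mulr1; apply: cvgMr; rewrite -[X in _ --> X]subr0.
  apply: cvgB; first exact: cvg_cst.
  by have := @cvg_harmonic R; rewrite -cvg_shiftS.
have slk k : solvable (lk k) by exact: sl.
pose V x := ereal_sup (range (fun k => U (lk k) x)).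
have UV k x : U (lk k) x <= V x by apply: ereal_sup_ubound; exists k.
have Und x : nondecreasing_seq (fun k => U (lk k) x).
  move=> i j ij; apply: picard_sup_homo; rewrite ?in_itv/= ?andbT ?(ltW (lk0 _))//.
  exact: lk_nd.
have Uk0 k x : 0 <= U (lk k) x by rewrite U0// ltW.
have V0 x : 0 <= V x by apply: le_trans (UV 0%N x).
have mV : measurable_fun setT V by exact: measurable_ereal_sup.
have VpE x : V x `^ p = ereal_sup (range (fun k => U (lk k) x `^ p)).
  by rewrite /V poweR_ereal_sup.
have Upnd x : nondecreasing_seq (fun k => U (lk k) x `^ p).
  by move=> i j ij; apply: le_poweR (ltW p0) _ _ => //; exact: Und.
have pV : {ae m, forall x, potential g m (fun y => V y `^ p) x + l%:E * P x <= V x}.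
  apply: filterS (green_potential_fin gk mu1) => x; rewrite -/P => Poo.
  have PE : P x = (fine (P x))%:E by rewrite fineK// ge0_fin_numE.
  have pVE : potential g m (fun y => V y `^ p) x =
      ereal_sup (range (fun k => potential g m (fun y => U (lk k) y `^ p) x)).
    rewrite -potential_ereal_sup//; last by move=> k y; exact: poweR_ge0.
    by apply: eq_integral => y _; rewrite VpE.
  have ndp : nondecreasing_seq (fun k => potential g m (fun y => U (lk k) y `^ p) x).
    move=> i j ij; apply: le_potential => //; try by move=> y; exact: poweR_ge0.
    by apply: nearW => y; exact: Upnd.
  have c1 := ereal_nondecreasing_cvgn ndp; rewrite -pVE in c1.
  have c2 : (lk k)%:E * P x @[k --> \oo] --> l%:E * P x.
    rewrite PE -EFinM; under eq_fun do rewrite -EFinM.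
    by apply: cvg_EFin; [exact: nearW|exact: cvgMl].
  have pV_ge0 : 0 <= potential g m (fun y => V y `^ p) x.
    by apply: potential_ge0 => // y; exact: poweR_ge0.
  have def : potential g m (fun y => V y `^ p) x +? l%:E * P x.
    by apply: ge0_adde_def; rewrite inE// mule_ge0// lee_fin ltW.
  have c3 := cvgeD def c1 c2; have {}c3 := c3 eventually_filter.
  rewrite -(cvg_lim (@ereal_hausdorff R) c3); apply: lime_le.
    by apply/cvg_ex; eexists; exact: c3.
  apply: nearW => k; apply: le_trans (UV k x).
  by rewrite -UE// ltW.
apply: (@solvable_le l V) => //; first exact: ltW.
  have -> : \int[m]_x ((D x)%:E * V x `^ p) =
      ereal_sup (range (fun k => \int[m]_x ((D x)%:E * U (lk k) x `^ p))).
    have nd : nondecreasing_seq (fun k => \int[m]_x ((D x)%:E * U (lk k) x `^ p)).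
      move=> i j ij; apply: ge0_le_integral => //.
      - by move=> x _; rewrite mule_ge0 ?lee_fin ?poweR_ge0.
      - exact: (measurable_weight gk).
      - exact: (measurable_weight gk).
      - by move=> x _; rewrite lee_wpmul2l ?lee_fin//; exact: Upnd.
    have /cvg_lim <- // := ereal_nondecreasing_cvgn nd.
    rewrite -monotone_convergence//.
    - apply: eq_integral => x _; apply/esym/cvg_lim => //; apply: cvgeZl => //.
      by rewrite VpE; exact: ereal_nondecreasing_cvgn.
    - by move=> k; exact: (measurable_weight gk).
    - by move=> k x _; rewrite mule_ge0 ?lee_fin ?poweR_ge0.
    - by move=> x _ i j ij; rewrite lee_wpmul2l ?lee_fin//; exact: Upnd.
  apply: (@le_lt_trans _ _ B%:E); last exact: ltry.
  apply: ge_ereal_sup => _ [k _ <-].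
  by have [] := HB (lk k) (ltW (lk0 k)) (slk k).
by apply: picard_sup_min => //; exact: ltW.
Qed.

(** Solvable parameters are bounded, contain a neighbourhood of 0 in the
positive reals and form an interval, whose supremum is again solvable. A bound
M at this supremum serves for all smaller parameters. *)
Lemma solvable_threshold : subcritical_kernel m g D C p ->
  exists l0 ls M : R, [/\ (0 < l0 <= ls)%R, (0 <= M)%R,
    forall l, (0 < l <= l0)%R -> {ae m, forall x, U l x <= (2 * l)%:E * P x},
    forall l, (0 < l <= ls)%R ->
      solvable l /\ {ae m, forall x, U l x <= M%:E * P x} &
    forall l, (ls < l)%R -> ~ solvable l].
Proof.
move=> sk; have [B HB] := solvable_bound.
have [K K0 PK] := potential_green_potential gk mu1 mu_atom sk.
have PLp := green_potential_Lp gk mu1 sk.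
have K2 : (0 < K * 2 `^ p)%R by rewrite mulr_gt0// powR_gt0.
have pB : (p - 1 != 0)%R by rewrite subr_eq0 gt_eqF.
have [l0 l0_gt0 l0E] := powR_onto pB (etrans (invr_gt0 _) K2).
have small l : (0 < l <= l0)%R -> {ae m, forall x, U l x <= (2 * l)%:E * P x}.
  move=> /andP[l_gt0 ll0]; apply: (picard_sup_small K0 l_gt0 PK).
  rewrite mulrC -ler_pdivlMr// mul1r -l0E.
  by apply: ge0_ler_powR; rewrite ?nnegrE ?subr_ge0 ?(ltW p1) ?(ltW l_gt0) ?(ltW l0_gt0).
have sol0 : solvable l0.
  have l20 : (0 <= 2 * l0)%R by rewrite mulr_ge0// ltW.
  apply: (@solvable_le l0 (fun x => (2 * l0)%:E * P x)) => //.
  - exact: ltW.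
  - exact: emeasurable_funM.
  - by move=> x; rewrite mule_ge0.
  - under eq_integral do rewrite poweRM// poweR_EFin muleCA.
    rewrite ge0_integralZl//; last 3 first.
    + by apply: (measurable_weight gk); exact: measurable_poweR_comp.
    + by move=> x _; rewrite mule_ge0 ?lee_fin ?poweR_ge0.
    + by rewrite lee_fin powR_ge0.
    apply: lte_mul_pinfty => //; first by rewrite lee_fin powR_ge0.
    by apply: small; rewrite l0_gt0 lexx.
pose S := [set l : R | (0 < l)%R /\ solvable l].
have S0 : S l0 by [].
have hS : has_sup S.
  split; first by exists l0.
  by exists B => l [l_gt0 sl]; have [] := HB l (ltW l_gt0) sl.
pose ls := sup S.
have l0ls : (l0 <= ls)%R by exact: sup_ubound hS.2 _ S0.
have ls0 : (0 < ls)%R by exact: lt_le_trans l0ls.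
have sls : solvable ls.
  apply: solvable_limit => // l l_gt0 lls.
  have [l' [l'0 sl'] ll'] := sup_gt hS.1 lls.
  by apply: solvable_downward sl'; exact: ltW.
have [M M0 UM] := picard_sup_regular sk (ltW ls0) sls.
exists l0, ls, M; split => //; first by rewrite l0_gt0.
- move=> l /andP[l_gt0 lls]; split.
    exact: solvable_downward (ltW l_gt0) lls sls.
  apply: filterS UM => x; apply: le_trans; apply: picard_sup_homo => //.
    by rewrite in_itv/= andbT ltW.
  by rewrite in_itv/= andbT ltW.
- move=> l lsl sl; have l_gt0 := lt_trans ls0 lsl.
  have := sup_ubound hS.2 (conj l_gt0 sl : S l).
  by rewrite leNgt lsl.
Qed.

End threshold.

(** * Euclidean norm and distance to the boundary *)

Section euclidean_norm.
Context (R : realType) (N : nat).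
Implicit Types (x y z : 'rV[R]_N) (a : R).

Lemma enorm_ge0 x : 0 <= enorm x. Proof. exact: sqrtr_ge0. Qed.

Lemma sqr_enorm x : enorm x ^+ 2 = \sum_i x ord0 i ^+ 2.
Proof. by rewrite sqr_sqrtr// sumr_ge0// => i _; rewrite sqr_ge0. Qed.

Lemma coord_le_enorm x i : `|x ord0 i| <= enorm x.
Proof.
rewrite -(@ler_pXn2r _ 2) ?nnegrE ?enorm_ge0// sqr_enorm real_normK ?num_real//.
by rewrite (bigD1 i)//= lerDl sumr_ge0// => j _; rewrite sqr_ge0.
Qed.

Lemma enorm_eq0 x : (enorm x == 0) = (x == 0).
Proof.
apply/eqP/eqP => [x0|->].
  apply/rowP => i; rewrite mxE; apply/eqP; rewrite -normr_le0 -x0.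
  exact: coord_le_enorm.
by rewrite /enorm big1 ?sqrtr0// => i _; rewrite mxE expr0n.
Qed.

Lemma enorm_gt0 x : (0 < enorm x) = (x != 0).
Proof. by rewrite lt_def enorm_eq0 enorm_ge0 andbT. Qed.

Lemma enormZ a x : enorm (a *: x) = `|a| * enorm x.
Proof.
rewrite /enorm -sqrtr_sqr -sqrtrM ?sqr_ge0// mulr_sumr; congr Num.sqrt.
by apply: eq_bigr => i _; rewrite mxE exprMn.
Qed.

Lemma enormN x : enorm (- x) = enorm x.
Proof. by rewrite -scaleN1r enormZ normrN1 mul1r. Qed.

Lemma enormB x y : enorm (x - y) = enorm (y - x).
Proof. by rewrite -enormN opprB. Qed.

(** Lagrange identity: the difference of the squares is half the sum of the
squares (x_i y_j - x_j y_i)^2. *)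
Lemma cauchy_schwarz x y :
  \sum_i x ord0 i * y ord0 i <= enorm x * enorm y.
Proof.
set S := \sum_i _.
apply: le_trans (ler_norm S) _.
rewrite -(@ler_pXn2r _ 2) ?nnegrE ?mulr_ge0 ?enorm_ge0//.
rewrite real_normK ?num_real// exprMn !sqr_enorm -subr_ge0.
have -> : (\sum_i x ord0 i ^+ 2) * (\sum_i y ord0 i ^+ 2) - S ^+ 2 =
    2^-1 * \sum_i \sum_j (x ord0 i * y ord0 j - x ord0 j * y ord0 i) ^+ 2.
  have -> : \sum_i \sum_j (x ord0 i * y ord0 j - x ord0 j * y ord0 i) ^+ 2 =
      \sum_i \sum_j (x ord0 i ^+ 2 * y ord0 j ^+ 2) +
      \sum_i \sum_j (x ord0 j ^+ 2 * y ord0 i ^+ 2) -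
      2 * \sum_i \sum_j (x ord0 i * y ord0 i) * (x ord0 j * y ord0 j).
    rewrite mulr_sumr -big_split -sumrB/=; apply: eq_bigr => i _.
    rewrite mulr_sumr -big_split -sumrB/=; apply: eq_bigr => j _.
    by ring.
  have E (f h : 'I_N -> R) : \sum_i \sum_j (f i * h j) = (\sum_i f i) * (\sum_j h j).
    by rewrite mulr_suml; apply: eq_bigr => i _; rewrite mulr_sumr.
  rewrite [X in _ + X - _]exchange_big/= !E.
  by rewrite -/S expr2; lra.
rewrite mulr_ge0 ?invr_ge0// sumr_ge0// => i _; rewrite sumr_ge0// => j _.
by rewrite sqr_ge0.
Qed.

Lemma enormD x y : enorm (x + y) <= enorm x + enorm y.
Proof.
rewrite -(@ler_pXn2r _ 2) ?nnegrE ?addr_ge0 ?enorm_ge0// sqrrD !sqr_enorm.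
have -> : \sum_i (x + y) ord0 i ^+ 2 = \sum_i x ord0 i ^+ 2 +
    (\sum_i x ord0 i * y ord0 i) *+ 2 + \sum_i y ord0 i ^+ 2.
  rewrite -sumrMnl -!big_split/=; apply: eq_bigr => i _.
  by rewrite mxE sqrrD.
by rewrite lerD2r lerD2l lerMn2r cauchy_schwarz.
Qed.

Lemma enorm_triangle z x y : enorm (x - y) <= enorm (x - z) + enorm (z - y).
Proof. by apply: le_trans (enormD _ _); rewrite addrA subrK. Qed.

End euclidean_norm.

Section boundary_distance.
Context (R : realType) (n : nat).
Local Notation N := n.+1.
Local Notation E := 'rV[R]_N.
Implicit Types (x y z : E) (a : R) (A Omega : set E).

Lemma enorm_le_coord x a : (forall i, `|x ord0 i| <= a) -> enorm x <= N%:R * a.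
Proof.
move=> xa; have a0 : 0 <= a by apply: le_trans (xa ord0).
rewrite -(@ler_pXn2r _ 2) ?nnegrE ?enorm_ge0 ?mulr_ge0// sqr_enorm.
apply: (@le_trans _ _ (\sum_(i < N) a ^+ 2)).
  by apply: ler_sum => i _; rewrite -real_normK ?num_real// lerXn2r ?nnegrE.
rewrite sumr_const card_ord exprMn -[leLHS]mulr_natl ler_wpM2r ?sqr_ge0//.
by rewrite -natrX ler_nat leq_pmull.
Qed.

Lemma coord_le_norm x i : `|x ord0 i| <= `|x|.
Proof.
rewrite [leRHS]mx_normrE.
exact: (@le_bigmax _ _ _ 0 (fun ij => `|x ij.1 ij.2|) (ord0, i)).
Qed.

Lemma norm_le_enorm x : `|x| <= enorm x.
Proof.
rewrite [leLHS]mx_normrE; apply/bigmax_leP; split; first exact: enorm_ge0.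
by move=> [i j] _ /=; rewrite (ord1 i) coord_le_enorm.
Qed.

Lemma enorm_le_norm x : enorm x <= N%:R * `|x|.
Proof. by apply: enorm_le_coord => i; exact: coord_le_norm. Qed.

(** The topology of row vectors is defined by the sup norm, which is equivalent
to the Euclidean norm. *)
Lemma nbhs_enormP x (B : set E) :
  nbhs x B <-> exists2 e, 0 < e & forall y, enorm (x - y) < e -> B y.
Proof.
split => [/nbhs_normP[e /= e0 xB]|[e e0 xB]].
  exists e => // y xy; apply: xB; apply: le_lt_trans xy; exact: norm_le_enorm.
apply: (iffRL (nbhs_normP x B)); exists (e / N%:R) => /=; first by rewrite divr_gt0.
move=> y /= xy; apply: xB; apply: le_lt_trans (enorm_le_norm _) _.
by rewrite mulrC -ltr_pdivlMr.
Qed.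

Lemma continuous_lipschitz (f : E -> R) (k : R) :
  (forall x y, f x <= f y + k * enorm (x - y)) -> continuous f.
Proof.
move=> fL x; apply/(@cvgrPdist_lt _ _ _ _ (@nbhs_filter E x)) => e e0.
have k0 : 0 < `|k| + 1 by rewrite ltr_wpDl.
apply/nbhs_enormP; exists (e / (`|k| + 1)) => [|y xy]; first by rewrite divr_gt0.
have h : k * enorm (x - y) < e.
  rewrite -(@mulfVK _ (`|k| + 1) _ e) ?gt_eqF// mulrC.
  apply: le_lt_trans (_ : enorm (x - y) * (`|k| + 1) < _); last by rewrite ltr_pM2r.
  by rewrite ler_wpM2l ?enorm_ge0//; have := ler_norm k; lra.
have := fL x y; have := fL y x; rewrite (enormB y x) ltr_distl => h1 h2.
by apply/andP; split; lra.
Qed.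

Lemma measurable_continuous (f : E -> R) : continuous f -> measurable_fun setT f.
Proof.
move=> cf; apply: (measurability _ (RGenOInfty.measurableE R)) => _ [_ [a ->] <-].
rewrite setTI; apply: open_measurable_mx.
by apply: open_comp; [move=> x _; exact: cf|exact: interval_open].
Qed.

(** The first point of the segment from x to y that is not in Omega. *)
Lemma segment_boundary Omega x y : open Omega -> Omega x -> ~ Omega y ->
  exists2 z, boundary Omega z & enorm (x - z) <= enorm (x - y).
Proof.
move=> oO Ox Oy; pose c t : E := x + t *: (y - x).
pose A := [set t : R | 0 <= t <= 1 /\ ~ Omega (c t)].
have A1 : A 1 by split; rewrite ?ler01 ?lexx//= /c scale1r subrKC.
have infA : has_inf A.
  by split; [exists 1|exists 0 => t [/andP[]]].
have cc t t' : enorm (c t - c t') = `|t - t'| * enorm (y - x).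
  by rewrite /c opprD addrACA subrr add0r -scalerBl enormZ.
pose L := enorm (y - x) + 1.
have L0 : 0 < L by rewrite ltr_wpDl ?enorm_ge0.
have cL t t' e : `|t - t'| < e / L -> enorm (c t - c t') < e.
  move=> tt; rewrite cc; rewrite ltr_pdivlMr// in tt.
  by apply: le_lt_trans tt; rewrite ler_wpM2l// lerDl.
pose t0 := inf A.
have t00 : 0 <= t0 by apply: lb_le_inf; [exists 1|move=> t [/andP[]]].
have t01 : t0 <= 1 by exact: (ge_inf infA.2 A1).
have Ot0 : ~ Omega (c t0).
  move=> /oO /nbhs_enormP[e e0 eO].
  have [t At tt0] := inf_adherent (divr_gt0 e0 L0) infA; have [_ Ot] := At.
  apply: Ot; apply: eO; apply: cL; rewrite distrC ger0_norm.
    by rewrite ltrBlDl.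
  by rewrite subr_ge0; apply: (ge_inf infA.2).
have t0_gt0 : 0 < t0.
  rewrite lt_neqAle t00 andbT; apply/eqP => t0E; apply: Ot0.
  by rewrite -t0E /c scale0r addr0.
exists (c t0); last first.
  rewrite -{1}[x](_ : c 0 = x); last by rewrite /c scale0r addr0.
  rewrite cc sub0r normrN ger0_norm// (enormB x y) ler_piMl ?enorm_ge0//.
split; last by move=> /interior_subset.
move=> B /nbhs_enormP[e e0 eB].
pose t := t0 - Num.min t0 (e / L / 2).
have e2 : 0 < e / L / 2 by rewrite !divr_gt0.
have m0 : 0 < Num.min t0 (e / L / 2) by rewrite lt_min t0_gt0.
exists (c t); split; last first.
  apply: eB; apply: cL; rewrite /t opprB addrC subrK gtr0_norm//.
  by apply: (@le_lt_trans _ _ (e / L / 2)); [rewrite ge_min lexx orbT|rewrite ltr_pdivrMr//; have := divr_gt0 e0 L0; lra].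
apply: contrapT => Oct; have : t0 <= t.
  apply: (ge_inf infA.2); split => //; rewrite subr_ge0 ge_min lexx/=.
  by apply: le_trans t01; rewrite gerBl ltW.
by rewrite leNgt /t gtrBl m0.
Qed.

Section domain.
Variable (Omega : set E).
Hypotheses (oO : open Omega) (bO : bounded_set Omega) (O0 : Omega !=set0).
Local Notation delta := (bdist Omega).

Lemma bounded_enorm : exists2 M, 0 < M & forall x y, Omega x -> Omega y -> enorm (x - y) <= M.
Proof.
have [M [_ /(_ (M + 1))]] := bO; rewrite ltrDl => /(_ ltr01) OM.
pose K := `|M + 1| + 1.
exists (N%:R * (2 * K)) => [|x y Ox Oy]; first by rewrite !mulr_gt0// ltr_wpDl.
apply: enorm_le_coord => i; rewrite !mxE.
apply: le_trans (ler_normB _ _) _.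
have B z : Omega z -> `|z ord0 i| <= K.
  move=> Oz; apply: le_trans (coord_le_norm _ _) _; apply: le_trans (OM z Oz) _.
  by apply: le_trans (ler_norm _) _; rewrite lerDl.
by have := B x Ox; have := B y Oy; lra.
Qed.

Lemma boundary_nonempty : boundary Omega !=set0.
Proof.
have [M M0 OM] := bounded_enorm; have [x Ox] := O0.
pose y : E := x + const_mx (M + 1).
have Oy : ~ Omega y.
  move=> Oy; have := OM y x Oy Ox; rewrite /y addrC addKr.
  have := coord_le_enorm (const_mx (M + 1) : E) ord0; rewrite mxE => h1 h2.
  by have := le_trans (ler_norm _) (le_trans h1 h2); lra.
by have [z Bz _] := segment_boundary oO Ox Oy; exists z.
Qed.

Lemma bdist_le x y : boundary Omega y -> delta x <= enorm (x - y).
Proof.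
move=> By; apply: ge_inf; last by exists y.
by exists 0 => _ [z _ <-]; exact: enorm_ge0.
Qed.

Lemma bdist_ge x r : (forall y, boundary Omega y -> r <= enorm (x - y)) -> r <= delta x.
Proof.
move=> h; apply: lb_le_inf; last by move=> _ [y By <-]; exact: h.
by have [y By] := boundary_nonempty; exists (enorm (x - y)); exists y.
Qed.

Lemma bdist_ge0 x : 0 <= delta x.
Proof. by apply: bdist_ge => y _; exact: enorm_ge0. Qed.

Lemma bdist_lipschitz x y : delta x <= delta y + enorm (x - y).
Proof.
rewrite -lerBlDr; apply: bdist_ge => z Bz; rewrite lerBlDr addrC.
exact: le_trans (bdist_le x Bz) (enorm_triangle _ _ _).
Qed.

Lemma continuous_bdist : continuous delta.
Proof.
apply: (@continuous_lipschitz _ 1) => x y; rewrite mul1r.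
exact: bdist_lipschitz.
Qed.

Lemma bdist_gt0 x : Omega x -> 0 < delta x.
Proof.
move=> /oO /nbhs_enormP[e e0 eO]; apply: lt_le_trans e0 _.
apply: bdist_ge => y [_]; rewrite ((interior_id Omega).1 oO) => Oy.
by rewrite leNgt; apply/negP => /eO.
Qed.

(** Otherwise the segment from x to y meets the boundary too early. *)
Lemma bdist_ball x y : Omega x -> enorm (x - y) < delta x -> Omega y.
Proof.
move=> Ox xy; apply: contrapT => Oy.
have [z Bz xz] := segment_boundary oO Ox Oy.
by have := le_lt_trans (le_trans (bdist_le x Bz) xz) xy; rewrite ltxx.
Qed.

(** The boundary is closed and bounded: a boundary point has a point of Omega
within distance 1. *)
Lemma bdist_attained x : exists2 z, boundary Omega z & delta x = enorm (x - z).
Proof.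
have cB : compact (boundary Omega).
  apply: bounded_closed_compact; last first.
    apply: closedI; first exact: closed_closure.
    by apply: open_closedC; exact: open_interior.
  have [M M0 OM] := bounded_enorm; have [x0 Ox0] := O0.
  exists (M + 1 + `|x0|); split; first exact: num_real.
  move=> K MK z [clz _].
  have [y [Oy zy]] := clz _ ((nbhs_enormP z _).2 (ex_intro2 _ _ 1 ltr01 (fun y h => h))).
  apply/ltW; apply: le_lt_trans MK.
  have -> : z = (z - y) + (y - x0) + x0 by rewrite addrA !subrK.
  apply: le_trans (ler_normD _ _) _; rewrite lerD2r.
  apply: le_trans (ler_normD _ _) _; rewrite addrC lerD//.
    by apply: le_trans (norm_le_enorm _) _; exact: OM.
  by apply: le_trans (norm_le_enorm _) _; exact: ltW.
have [|z zB zmin] := @compact_EVT_min E R (fun y => enorm (x - y)) _ boundary_nonempty cB.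
  apply: continuous_subspaceT; apply: (@continuous_lipschitz _ 1) => y y'.
  by rewrite mul1r (enormB y y'); exact: enorm_triangle.
exists z; first by rewrite inE in zB.
apply/eqP; rewrite eq_le bdist_le/=; last by rewrite inE in zB.
by apply: bdist_ge => y By; apply: zmin; rewrite inE.
Qed.

End domain.
End boundary_distance.

(** * Integrability of a point singularity *)

Lemma geometric_series_le (R : realType) (K q : R) : 0 <= K -> 0 <= q < 1 ->
  (\sum_(k <oo) (K * q ^+ k)%:E <= (K / (1 - q))%:E)%E.
Proof.
move=> K0 /andP[q0 q1].
apply: lime_le.
  by apply: is_cvg_nneseries => k _ _; rewrite lee_fin mulr_ge0// exprn_ge0.
apply: nearW => n; rewrite sumEFin lee_fin -mulr_sumr ler_wpM2l//.
rewrite -[leRHS]mul1r ler_pdivlMr ?subr_gt0//.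
have -> : (\sum_(0 <= i < n) q ^+ i) * (1 - q) = 1 - q ^+ n.
  elim: n => [|n IH]; first by rewrite big_geq// mul0r expr0 subrr.
  by rewrite big_nat_recr//= mulrDl IH exprS; ring.
by rewrite gerBl exprn_ge0.
Qed.

Section cubes.
Context (R : realType) (n : nat).
Local Notation N := n.+1.
Local Notation E := 'rV[R]_N.
Local Notation leb := (@lebesgue_rV R N).
Implicit Types (x y z : E) (r : R).

(** Cubes are used instead of Euclidean balls because their volume is
immediate. *)
Definition cube y r : set E :=
  [set z | forall i, y ord0 i - r <= z ord0 i <= y ord0 i + r].

Lemma measurable_cube y r : measurable (cube y r).
Proof. exact: measurable_rV_box. Qed.

Lemma lebesgue_cube y r : 0 <= r -> leb (cube y r) = ((2 * r) ^+ N)%:E.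
Proof.
move=> r0; rewrite /cube (@lebesgue_rV_box R N (fun i => y ord0 i - r)
  (fun i => y ord0 i + r)).
  rewrite (eq_bigr (fun=> 2 * r)) ?prodr_const ?card_ord// => i _; ring.
by move=> i; rewrite lerBlDr -addrA lerDl addr_ge0.
Qed.

Lemma set1_cube x : [set x] = cube x 0.
Proof.
apply/seteqP; split=> [_ -> i|z /= xz]; first by rewrite subr0 addr0 lexx.
apply/rowP => i; apply/eqP; rewrite eq_le.
by have := xz i; rewrite subr0 addr0 andbC.
Qed.

Lemma measurable_rV1 x : measurable [set x].
Proof. by rewrite set1_cube; exact: measurable_cube. Qed.

Lemma lebesgue_rV1 x : leb [set x] = 0%E.
Proof. by rewrite set1_cube lebesgue_cube// mulr0 expr0n. Qed.

Lemma cubeP y r z : cube y r z <-> forall i, `|(z - y) ord0 i| <= r.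
Proof.
by split=> h i; have := h i; rewrite !mxE ler_norml => /andP[? ?]; apply/andP; split; lra.
Qed.

Lemma measurable_sub : measurable_fun setT (fun z : E * E => z.1 - z.2).
Proof.
apply/measurable_fun_rowP => i; under eq_fun do rewrite !mxE.
apply: measurable_funB.
  exact: (measurableT_comp (measurable_coord i) measurable_fst).
exact: (measurableT_comp (measurable_coord i) measurable_snd).
Qed.

Lemma continuous_enorm : continuous (@enorm R N).
Proof.
apply: (@continuous_lipschitz _ _ _ 1) => x y; rewrite mul1r.
by rewrite -{1}(subrK y x) addrC; exact: enormD.
Qed.

Lemma measurable_enorm : measurable_fun setT (@enorm R N).
Proof. by apply: measurable_continuous; exact: continuous_enorm. Qed.

Lemma measurable_enormB y : measurable_fun setT (fun z => enorm (z - y)).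
Proof.
exact: (measurableT_comp measurable_enorm
  (measurableT_comp measurable_sub (pair2_measurable y))).
Qed.

(** Dyadic shells: outside the cube of half-side M/2^(k+1) the integrand is at
most (M/2^(k+1))^(-a), and the cube of half-side M/2^k has volume (2M/2^k)^N, so
that the sum over k is geometric with ratio 2^a/2^N < 1. *)
Lemma singular_integral (a M : R) : 0 < a < N%:R -> 0 < M ->
  exists2 C : R, 0 <= C & forall y,
    (\int[leb]_(z in cube y M) (enorm (z - y) `^ (- a))%:E <= C%:E)%E.
Proof.
move=> /andP[a0 aN] M0.
pose r k := M / 2 ^+ k.
have r0 k : 0 < r k by rewrite divr_gt0// exprn_gt0.
pose q := 2 `^ a / 2 ^+ N.
have q01 : 0 <= q < 1.
  rewrite divr_ge0 ?powR_ge0 ?exprn_ge0//= ltr_pdivrMr ?exprn_gt0// mul1r.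
  by rewrite -powR_mulrn// /powR pnatr_eq0/= ltr_expR ltr_pM2r// ln_gt0 ?ltr1n.
pose K := M `^ (- a) * 2 `^ a * (2 * M) ^+ N.
have K0 : 0 <= K by rewrite !mulr_ge0 ?powR_ge0 ?exprn_ge0 ?mulr_ge0 ?(ltW M0).
have rE k : r k.+1 `^ (- a) * (2 * r k) ^+ N = K * q ^+ k.
  have -> : r k.+1 `^ (- a) = M `^ (- a) * (2 `^ a) ^+ k.+1.
    rewrite /r powRM ?(ltW M0) ?invr_ge0 ?exprn_ge0//; congr (_ * _).
    rewrite -[2 ^+ k.+1]powR_mulrn// -[(2 `^ a) ^+ k.+1]powR_mulrn ?powR_ge0//.
    rewrite -(powRN 2 k.+1%:R).
    by rewrite -!powRrM; congr (_ `^ _); ring.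
  rewrite /K /q /r (mulrA 2) !expr_div_n -!exprM (mulnC k) exprS.
  set c := 2 ^+ _; set e := (2 * M) ^+ _; ring.
exists (K / (1 - q)).
  by rewrite divr_ge0// subr_ge0; case/andP: q01 => _ /ltW.
move=> y; apply: le_trans (geometric_series_le K0 q01).
pose F k z : \bar R := ((r k.+1 `^ (- a))%:E * (\1_(cube y (r k)) z)%:E)%E.
have F0 k z : (0 <= F k z)%E.
  by rewrite mule_ge0// lee_fin ?powR_ge0.
have mF k : measurable_fun (cube y M) (F k).
  apply: emeasurable_funM => //; apply/measurable_EFinP.
  by apply: measurable_indic; exact: measurable_cube.
apply: (@le_trans _ _ (\int[leb]_(z in cube y M) (\sum_(k <oo) F k z)))%E; last first.
  rewrite integral_nneseries//; last exact: measurable_cube.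
  apply: lee_nneseries => [k _ _|k _]; first exact: integral_ge0.
  rewrite ge0_integralZl//; last 3 first.
  - exact: measurable_cube.
  - by apply/measurable_EFinP; apply: measurable_indic; exact: measurable_cube.
  - by rewrite lee_fin powR_ge0.
  rewrite integral_indic//; [|exact: measurable_cube|exact: measurable_cube].
  rewrite -rE EFinM lee_wpmul2l// ?lee_fin ?powR_ge0//.
  rewrite -(lebesgue_cube y) ?(ltW (r0 k))//; apply: le_measure; rewrite ?inE.
  - by apply: measurableI; exact: measurable_cube.
  - exact: measurable_cube.
  - exact: subIsetl.
apply: ge0_le_integral; first exact: measurable_cube.
- by move=> z _; rewrite lee_fin powR_ge0.
- apply/measurable_EFinP; apply: (@measurable_funS _ _ _ _ setT) => //.
  exact: (measurableT_comp (measurable_powR (- a)) (measurable_enormB y)).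
- by apply: ge0_emeasurable_sum.
move=> z yz.
have [->|zy] := eqVneq z y.
  rewrite subrr (eqP (_ : enorm 0 == 0)) ?enorm_eq0// powR0 ?oppr_eq0 ?gt_eqF//.
  exact: nneseries_ge0.
have zy0 : 0 < enorm (z - y) by rewrite enorm_gt0 subr_eq0.
have ex : exists k, ~~ `[< cube y (r k) z >].
  pose e := enorm (z - y) / N%:R.
  have e0 : 0 < e by rewrite divr_gt0.
  pose k := (Num.truncn (M / e)).
  exists k; apply/asboolPn => /cubeP /enorm_le_coord.
  apply/negP; rewrite -ltNge mulrC -ltr_pdivlMr// -/e /r.
  rewrite ltr_pdivrMr ?exprn_gt0// -ltr_pdivrMl// mulrC.
  apply: lt_le_trans (truncnS_gt _) _.
  by rewrite -natrX ler_nat ltn_expl.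
case: (ex_minnP ex) => -[|k] /asboolPn nk kmin.
  exfalso; apply: nk; move: yz; rewrite /r expr0 divr1.
  exact.
have ck : cube y (r k) z.
  apply: contrapT => nck; have := kmin k; rewrite ltnn => h.
  by apply: notF; apply: h; apply/asboolPn.
apply: (@le_trans _ _ (F k z)); last first.
  have := @nneseries_lim_ge R (F ^~ z) xpredT 0 k.+1 (fun i _ _ => F0 i z).
  apply: le_trans; rewrite big_nat_recr//= -[leLHS]add0e; apply: leeD => //.
  by apply: sume_ge0.
rewrite /F indicE mem_set// mule1 lee_fin.
rewrite !powRN lef_pV2 ?posrE ?powR_gt0//.
apply: ge0_ler_powR; rewrite ?nnegrE ?(ltW a0) ?(ltW (r0 _)) ?enorm_ge0//.
move/cubeP: nk => /existsNP[i /negP]; rewrite -ltNge => /ltW h.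
exact: le_trans h (coord_le_enorm _ _).
Qed.

End cubes.

(** * The quasi-distance behind the Green kernel *)

Section quasi_distance.
Context (R : realType).
Variables (al ga : R).
Hypotheses (al0 : 0 < al) (ga0 : 0 < ga).
Implicit Types (r a b c t : R).

(** With r = |x-y|, a = delta x, b = delta y, al = N-2s and ga = gamma, the
profile of the Green kernel is a^ga b^ga / qdist r a b; see [profile_qdist]. *)
Definition qdist r a b := r `^ al * Num.max r a `^ ga * Num.max r b `^ ga.

Lemma le_powR2 t a b : 0 <= t -> 0 <= a -> a <= b -> a `^ t <= b `^ t.
Proof. by move=> t0 a0 ab; apply: ge0_ler_powR; rewrite ?nnegrE ?(le_trans a0 ab). Qed.

Lemma powRV t a : 0 <= a -> a^-1 `^ t = (a `^ t)^-1.
Proof. by move=> a0; rewrite -(powR_inv1 a0) -powRrM mulN1r powRN. Qed.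

Lemma qdist_gt0 r a b : 0 < r -> 0 < qdist r a b.
Proof.
move=> r0; have m c : 0 < Num.max r c by rewrite lt_max r0.
by rewrite !mulr_gt0 ?powR_gt0.
Qed.

Lemma qdistC r a b : qdist r a b = qdist r b a.
Proof. by rewrite /qdist mulrAC. Qed.

Lemma profile_qdist r a b : 0 < r -> 0 <= a -> 0 <= b ->
  (r `^ al)^-1 * Num.min (a / r) 1 `^ ga * Num.min (b / r) 1 `^ ga =
  a `^ ga * b `^ ga / qdist r a b.
Proof.
move=> r0 a0 b0.
have E c : 0 <= c -> Num.min (c / r) 1 `^ ga = c `^ ga / Num.max r c `^ ga.
  move=> c0; have m0 : 0 < Num.max r c by rewrite lt_max r0.
  have -> : Num.min (c / r) 1 = c / Num.max r c.
    have [rc|/ltW cr] := leP r c.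
      rewrite min_r ?ler_pdivlMr ?mul1r// divff// gt_eqF//.
      exact: lt_le_trans rc.
    by rewrite min_l ?ler_pdivrMr ?mul1r.
  by rewrite powRM ?invr_ge0 ?(ltW m0)// powRV// ltW.
by rewrite !E// /qdist !invfM; ring.
Qed.

(** Halving r, and moving b to c at the cost of the length t of a leg, changes
each of the three factors by at most the factor 2. *)
Lemma qdist_half r t a b c : 0 < r -> 0 < t -> 0 <= a -> 0 <= c ->
  r <= 2 * t -> b <= c + t ->
  qdist r a b <= 2 `^ (al + ga + ga) * qdist t a c.
Proof.
move=> r0 t0 a0 c0 rt bct.
have mt d : 0 < Num.max t d by rewrite lt_max t0.
have mr d : 0 < Num.max r d by rewrite lt_max r0.
have ale : Num.max r a <= 2 * Num.max t a.
  rewrite ge_max; have : t <= Num.max t a by rewrite le_max lexx.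
  have : a <= Num.max t a by rewrite le_max lexx orbT.
  by move=> h1 h2; apply/andP; split; lra.
have ble : Num.max r b <= 2 * Num.max t c.
  rewrite ge_max; have : t <= Num.max t c by rewrite le_max lexx.
  have : c <= Num.max t c by rewrite le_max lexx orbT.
  by move=> h1 h2; apply/andP; split; lra.
have -> : 2 `^ (al + ga + ga) * qdist t a c =
    (2 * t) `^ al * (2 * Num.max t a) `^ ga * (2 * Num.max t c) `^ ga.
  rewrite !powRM ?(ltW t0) ?(ltW (mt _))// /qdist !powRD.
  - by ring.
  - by rewrite pnatr_eq0 implybT.
  - by rewrite pnatr_eq0 implybT.
have h (x y : R) e : 0 < e -> 0 < x -> x <= y -> x `^ e <= y `^ e.
  by move=> e0 x0; apply: le_powR2; exact: ltW.
by apply: ler_pM; rewrite ?mulr_ge0 ?powR_ge0//; [apply: ler_pM; rewrite ?powR_ge0//; exact: h|exact: h].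
Qed.

(** The longer leg alone controls the left-hand side. *)
Lemma qdist_triangle r r1 r2 a b c : 0 < r -> 0 < r1 -> 0 < r2 ->
  0 <= a -> 0 <= b -> 0 <= c ->
  r <= r1 + r2 -> a <= c + r1 -> b <= c + r2 ->
  qdist r a b <= 2 `^ (al + ga + ga) * (qdist r1 a c + qdist r2 c b).
Proof.
move=> r0 r10 r20 a0 b0 c0 rr ac bc; rewrite mulrDr.
have [r21|/ltW r12] := leP r2 r1.
  apply: le_trans (@qdist_half r r1 a b c _ _ _ _ _ _) _ => //; try lra.
  by rewrite lerDl mulr_ge0 ?powR_ge0// ltW// qdist_gt0.
rewrite qdistC; apply: le_trans (@qdist_half r r2 b a c _ _ _ _ _ _) _ => //; try lra.
by rewrite (qdistC r2 b) lerDr mulr_ge0 ?powR_ge0// ltW// qdist_gt0.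
Qed.

Lemma qdist_upper r a b M : 0 < r -> r <= M -> a <= M -> b <= M ->
  qdist r a b <= M `^ (al + ga + ga).
Proof.
move=> r0 rM aM bM; have M0 := lt_le_trans r0 rM.
have m c : 0 < Num.max r c by rewrite lt_max r0.
rewrite !powRD ?(gt_eqF M0) ?implybT//.
apply: ler_pM; rewrite ?mulr_ge0 ?powR_ge0//; last first.
  by apply: le_powR2; rewrite ?(ltW ga0) ?(ltW (m _))// ge_max rM.
apply: ler_pM; rewrite ?powR_ge0//; apply: le_powR2; rewrite ?(ltW al0) ?(ltW ga0) ?(ltW r0) ?(ltW (m _))//.
by rewrite ge_max rM.
Qed.

(** Here b^ga is traded once for max(r,b)^ga and once, by b <= a + r, for
2^ga max(r,a)^ga, which cancels both maxima in qdist. *)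
Lemma qdist_weight r a b : 0 < r -> 0 < a -> 0 < b -> b <= a + r ->
  a `^ ga * b `^ ga / qdist r a b * b `^ ga <= 2 `^ ga * a `^ ga * r `^ (- al).
Proof.
move=> r0 a0 b0 bar.
have m c : 0 < Num.max r c by rewrite lt_max r0.
have b1 : b `^ ga <= Num.max r b `^ ga.
  by apply: le_powR2; rewrite ?(ltW ga0) ?(ltW b0)// le_max lexx orbT.
have b2 : b `^ ga <= 2 `^ ga * Num.max r a `^ ga.
  rewrite -powRM ?(ltW (m _))//; apply: le_powR2; rewrite ?(ltW ga0) ?(ltW b0)//.
  have : r <= Num.max r a by rewrite le_max lexx.
  have : a <= Num.max r a by rewrite le_max lexx orbT.
  lra.
rewrite mulrAC ler_pdivrMr ?qdist_gt0// /qdist powRN.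
have -> : 2 `^ ga * a `^ ga / r `^ al *
    (r `^ al * Num.max r a `^ ga * Num.max r b `^ ga) =
    a `^ ga * ((2 `^ ga * Num.max r a `^ ga) * Num.max r b `^ ga).
  by field; rewrite gt_eqF// powR_gt0.
rewrite -[leLHS]mulrA ler_wpM2l ?powR_ge0//.
by rewrite mulrC; apply: ler_pM; rewrite ?powR_ge0.
Qed.

(** The ratio c^ga / qdist r c b is at most r^(-al) max(r,b)^(-ga), and the
remaining c^ga is at most 2^ga max(r,b)^ga. As p > 1 the exponent of max(r,b) is
negative, and max(r,b) >= r. *)
Lemma qdist_moment r b c p : 0 < r -> 0 < b -> 0 < c -> 1 < p -> c <= b + r ->
  c `^ ga * (c `^ ga / qdist r c b) `^ p <=
  2 `^ ga * r `^ (- (al * p + ga * p - ga)).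
Proof.
move=> r0 b0 c0 p1 cbr.
have m e : 0 < Num.max r e by rewrite lt_max r0.
have p0 : 0 < p by exact: lt_trans p1.
have c1 : c `^ ga <= Num.max r c `^ ga.
  by apply: le_powR2; rewrite ?(ltW ga0) ?(ltW b0) ?(ltW c0)// le_max lexx orbT.
have c2 : c `^ ga <= 2 `^ ga * Num.max r b `^ ga.
  rewrite -powRM ?(ltW (m _))//; apply: le_powR2; rewrite ?(ltW ga0) ?(ltW b0) ?(ltW c0)//.
  have : r <= Num.max r b by rewrite le_max lexx.
  have : b <= Num.max r b by rewrite le_max lexx orbT.
  lra.
have h1 : c `^ ga / qdist r c b <= r `^ (- al) * Num.max r b `^ (- ga).
  rewrite ler_pdivrMr ?qdist_gt0// /qdist !powRN.
  have -> : (r `^ al)^-1 / Num.max r b `^ ga *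
    (r `^ al * Num.max r c `^ ga * Num.max r b `^ ga) = Num.max r c `^ ga.
    by field; rewrite !gt_eqF ?powR_gt0.
  exact: c1.
apply: (@le_trans _ _ ((2 `^ ga * Num.max r b `^ ga) *
    (r `^ (- al) * Num.max r b `^ (- ga)) `^ p)).
  apply: ler_pM; rewrite ?powR_ge0//; apply: le_powR2 => //; first exact: ltW.
  by rewrite divr_ge0 ?powR_ge0// ltW// qdist_gt0.
rewrite powRM ?powR_ge0// -!powRrM -!mulrA ler_wpM2l ?powR_ge0// mulrCA.
rewrite -powRD ?(gt_eqF (m _)) ?implybT//.
have -> : - (al * p + ga * p - ga) = - al * p + - (ga * p - ga) by ring.
rewrite (@powRD _ r) ?(gt_eqF r0) ?implybT// ler_wpM2l ?powR_ge0//.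
have -> : ga + - ga * p = - (ga * p - ga) by ring.
have gp0 : 0 <= ga * p - ga by have := ler_pM2l ga0 1 p; rewrite (ltW p1) mulr1; lra.
rewrite !powRN lef_pV2 ?posrE ?powR_gt0//; apply: le_powR2 => //; first exact: ltW.
by rewrite le_max lexx.
Qed.

End quasi_distance.

(** * The Green kernel of a domain *)

(** The 3G inequality for u = g(x,y), v = g(x,z), w = g(z,y), each comparable
with a product of weights over a quasi-distance q1, q2, q3: multiply
q1 <= B (q2 + q3) by D(x) D(z)^2 D(y) / (q1 q2 q3). *)
Lemma three_G_algebra (R : realType) (C B q1 q2 q3 a b c u v w : R) :
  0 < C -> 0 < B -> 0 < q1 -> 0 < q2 -> 0 < q3 -> 0 < a -> 0 < b -> 0 < c ->
  0 <= v -> 0 <= w ->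
  C^-1 * (a * b / q1) <= u -> C^-1 * (a * c / q2) <= v -> v <= C * (a * c / q2) ->
  C^-1 * (c * b / q3) <= w -> w <= C * (c * b / q3) ->
  q1 <= B * (q2 + q3) ->
  v * w <= C * C * C * C * B * u * c * (v / a + w / b).
Proof.
move=> C0 B0 q10 q20 q30 a0 b0 c0 v0 w0 lu lv uv lw uw tri.
apply: (@le_trans _ _ ((C * (a * c / q2)) * (C * (c * b / q3)))).
  exact: ler_pM.
apply: (@le_trans _ _ (C * C * C * C * B * (C^-1 * (a * b / q1)) * c *
    (C^-1 * (c / q2) + C^-1 * (c / q3)))); last first.
  have K0 : 0 <= C * C * C * C * B by rewrite !mulr_ge0// ltW.
  apply: ler_pM.
  - apply: mulr_ge0 (ltW c0); apply: mulr_ge0 K0 _.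
    by rewrite ltW// !mulr_gt0 ?invr_gt0.
  - by rewrite ltW// addr_gt0// !mulr_gt0 ?invr_gt0.
  - apply: ler_wpM2r; first exact: ltW.
    exact: ler_wpM2l.
  apply: lerD; rewrite ler_pdivlMr//.
    by apply: le_trans lv; rewrite le_eqVlt; apply/orP; left; apply/eqP; ring.
  by apply: le_trans lw; rewrite le_eqVlt; apply/orP; left; apply/eqP; ring.
have -> : C * C * C * C * B * (C^-1 * (a * b / q1)) * c *
      (C^-1 * (c / q2) + C^-1 * (c / q3)) =
    (C * C * a * c * c * b / (q2 * q3)) * (B * (q2 + q3) / q1).
  by field; rewrite !gt_eqF.
have -> : C * (a * c / q2) * (C * (c * b / q3)) =
    (C * C * a * c * c * b / (q2 * q3)) * 1.
  by field; rewrite !gt_eqF.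
apply: ler_wpM2l; first by rewrite ltW// !mulr_gt0// invr_gt0 mulr_gt0.
by rewrite ler_pdivlMr// mul1r.
Qed.

Section green_weight.
Context (R : realType) (n : nat).
Local Notation N := n.+1.
Local Notation E := 'rV[R]_N.
Local Notation leb := (@lebesgue_rV R N).
Variables (Omega : set E).
Local Notation delta := (bdist Omega).

(** Extension by zero turns integrals over Omega into integrals over the whole
space, where the results on abstract kernels apply. *)
Definition weight (gamma : R) : E -> R := (fun x => delta x `^ gamma) \_ Omega.

(** The value 0 on the diagonal makes the kernel measurable and nonnegative
everywhere; it is invisible to measures that do not charge points. *)
Definition off_diag (G : E -> E -> R) (x y : E) : R :=
  ((fun z : E * E => G z.1 z.2) \_ (off_diagonal Omega)) (x, y).

Lemma weightT gamma x : Omega x -> weight gamma x = delta x `^ gamma.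
Proof. by move=> Ox; rewrite /weight patchE mem_set. Qed.

Lemma weightC gamma x : ~ Omega x -> weight gamma x = 0.
Proof. by move=> Ox; rewrite /weight patchE memNset. Qed.

Lemma off_diagT G x y : Omega x -> Omega y -> x <> y -> off_diag G x y = G x y.
Proof. by move=> Ox Oy xy; rewrite /off_diag patchE mem_set. Qed.

Lemma off_diagC G x y : ~ off_diagonal Omega (x, y) -> off_diag G x y = 0.
Proof. by move=> h; rewrite /off_diag patchE memNset. Qed.

Lemma off_diagxx G x : off_diag G x x = 0.
Proof. by rewrite off_diagC// => -[_ _ /=]. Qed.

Variables (s gamma : R) (G : E -> E -> R) (GO : (E -> R) -> (E -> R)).
Hypotheses (s0 : 0 < s) (gamma0 : 0 < gamma) (N2s : 2 * s < N%:R).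
Hypotheses (oO : open Omega) (bO : bounded_set Omega) (O0 : Omega !=set0).
Hypothesis (G2 : hyp_G2 Omega s gamma GO G).
Local Notation al := (N%:R - 2 * s).
Local Notation D := (weight gamma).
Local Notation g := (off_diag G).
Let al0 : 0 < al. Proof. by rewrite subr_gt0. Qed.
Let mO : measurable Omega. Proof. exact: open_measurable_mx. Qed.
Let d0 x : Omega x -> 0 < delta x. Proof. exact: bdist_gt0. Qed.

Lemma measurable_off_diagonal : measurable (off_diagonal Omega).
Proof.
have -> : off_diagonal Omega =
    (Omega `*` Omega) `&` (fun z : E * E => z.1 - z.2) @^-1` (~` [set 0]).
  apply/seteqP; split=> [[x y] /= [Ox Oy xy]|[x y] /= [[Ox Oy] xy]].
    by split => // /eqP; rewrite subr_eq0 => /eqP.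
  by split => // xyE; apply: xy; apply/eqP; rewrite subr_eq0; exact/eqP.
apply: measurableI; first exact: measurableX.
rewrite -[X in measurable X]setTI; apply: measurable_sub => //.
by apply: measurableC; exact: measurable_rV1.
Qed.

Lemma weight_ge0 x : 0 <= D x.
Proof.
have [Ox|Ox] := pselect (Omega x); last by rewrite weightC.
by rewrite weightT// powR_ge0.
Qed.

Lemma weight_gt0 x : Omega x -> 0 < D x.
Proof. by move=> Ox; rewrite weightT// powR_gt0// d0. Qed.

Lemma weight_eq0 x : D x = 0 -> ~ Omega x.
Proof. by move=> Dx /weight_gt0; rewrite Dx ltxx. Qed.

Lemma measurable_bdist : measurable_fun setT delta.
Proof. by apply: measurable_continuous; exact: continuous_bdist. Qed.

Lemma measurable_weightD : measurable_fun setT D.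
Proof.
apply/(measurable_restrictT _ mO); apply: measurable_funTS.
exact: (measurableT_comp (measurable_powR gamma) measurable_bdist).
Qed.

Lemma off_diag_ge0 x y : 0 <= g x y.
Proof.
have [h|h] := pselect (off_diagonal Omega (x, y)); last by rewrite off_diagC.
by have [Ox Oy xy] := h; rewrite off_diagT// ltW// (green_pos G2).
Qed.

Lemma off_diag_sym x y : g x y = g y x.
Proof.
have [h|h] := pselect (off_diagonal Omega (x, y)).
  have [/= Ox Oy xy] := h; rewrite !off_diagT//; last by move=> e; exact: xy.
  exact: (green_sym G2).
rewrite !off_diagC// => -[/= Oy Ox yx]; apply: h; split => //= e; exact: yx.
Qed.

Lemma off_diag_kernel : sym_kernel g.
Proof.
split; [exact: off_diag_ge0|exact: off_diag_sym|].
have -> : (fun z : E * E => g z.1 z.2) =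
    (fun z : E * E => G z.1 z.2) \_ (off_diagonal Omega).
  by apply/funext => -[].
apply/(measurable_restrictT _ measurable_off_diagonal).
exact: (green_measurable G2).
Qed.

Lemma off_diag_estimate : exists2 C, 0 < C & forall x y, Omega x -> Omega y -> x <> y ->
  let q := qdist al gamma (enorm (x - y)) (delta x) (delta y) in
  C^-1 * (D x * D y / q) <= g x y <= C * (D x * D y / q).
Proof.
have [C C0 HC] := green_estimate G2; exists C => // x y Ox Oy xy /=.
rewrite off_diagT// !weightT// -profile_qdist ?(ltW (d0 _))//.
  by have := HC x y (And3 Ox Oy xy : off_diagonal Omega (x, y)).
by rewrite enorm_gt0 subr_eq0; apply/eqP.
Qed.

(** One constant for the diameter and for the largest distance to the boundary. *)
Lemma domain_radius : exists2 M, 0 < M &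
  (forall x, Omega x -> delta x <= M) /\
  (forall x y, Omega x -> Omega y -> enorm (x - y) <= M).
Proof.
have [M M0 OM] := bounded_enorm bO; have [x0 Ox0] := O0.
exists (M + delta x0); first by rewrite addr_gt0// d0.
split=> [x Ox|x y Ox Oy].
  apply: le_trans (bdist_lipschitz oO bO O0 x x0) _.
  by rewrite addrC lerD2r OM.
by apply: le_trans (OM _ _ Ox Oy) _; rewrite lerDl ltW// d0.
Qed.

Lemma domain_cube : exists2 M, 0 < M & forall y, Omega y -> Omega `<=` cube y M.
Proof.
have [M M0 [_ OM]] := domain_radius; exists M => // y Oy z Oz; apply/cubeP => i.
by apply: le_trans (coord_le_enorm _ _) _; exact: OM.
Qed.

Lemma singular_integral_domain a : 0 < a < N%:R ->
  exists2 C, 0 <= C & forall y, Omega y ->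
    (\int[leb]_(z in Omega) (enorm (z - y) `^ (- a))%:E <= C%:E)%E.
Proof.
move=> a0N; have [M M0 OM] := domain_cube.
have [C C0 HC] := singular_integral a0N M0.
exists C => // y Oy; apply: le_trans (HC y); apply: ge0_subset_integral => //.
- exact: measurable_cube.
- apply/measurable_EFinP; apply: measurable_funTS.
  exact: (measurableT_comp (measurable_powR (- a)) (measurable_enormB y)).
- by move=> z _; rewrite lee_fin powR_ge0.
- exact: OM.
Qed.

Lemma enorm_gt0P (x y : E) : x <> y -> 0 < enorm (x - y).
Proof. by move=> xy; rewrite enorm_gt0 subr_eq0; apply/eqP. Qed.

Lemma bdist_le_add x y : delta y <= delta x + enorm (x - y).
Proof. by rewrite enormB; exact: bdist_lipschitz. Qed.

(** The quasi-distance is bounded on a bounded domain. *)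
Lemma off_diag_lower : exists2 C, 0 < C & forall x y, x <> y -> D x * D y <= C * g x y.
Proof.
have [C C0 HC] := off_diag_estimate; have [M M0 [dM rM]] := domain_radius.
pose K := M `^ (al + gamma + gamma).
have K0 : 0 < K by rewrite powR_gt0.
exists (C * K) => [|x y xy]; first by rewrite mulr_gt0.
have [Ox|Ox] := pselect (Omega x); last first.
  by rewrite weightC// mul0r !mulr_ge0 ?(ltW C0) ?(ltW K0)// off_diag_ge0.
have [Oy|Oy] := pselect (Omega y); last first.
  by rewrite [D y]weightC// mulr0 !mulr_ge0 ?(ltW C0) ?(ltW K0)// off_diag_ge0.
have /andP[+ _] := HC x y Ox Oy xy; set q := qdist _ _ _ _ _.
have r0 := enorm_gt0P xy.
have q0 : 0 < q by exact: qdist_gt0.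
have qK : q <= K by apply: qdist_upper => //; [exact: rM|exact: dM|exact: dM].
rewrite ler_pdivrMl// => h; rewrite mulrAC -ler_pdivrMr//; apply: le_trans h.
by rewrite ler_wpM2l ?mulr_ge0 ?weight_ge0// lef_pV2.
Qed.

(** By [qdist_weight], g(x,z) D(z) is at most a multiple of
D(x) |x-z|^(-(N-2s)), and N-2s < N. *)
Lemma off_diag_upper : exists2 C, 0 < C & forall x,
  (potential g leb (EFin \o D) x <= (C * D x)%:E)%E.
Proof.
have [C C0 HC] := off_diag_estimate.
have a0N : 0 < al < N%:R by rewrite al0/= gtrBl mulr_gt0.
have [S S0 HS] := singular_integral_domain a0N.
exists (C * 2 `^ gamma * S + 1) => [|x].
  by rewrite ltr_wpDl// !mulr_ge0// ?powR_ge0// ltW.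
have [Ox|Ox] := pselect (Omega x); last first.
  rewrite weightC// mulr0 /potential integral0_eq// => y _.
  by rewrite off_diagC ?mul0e// => -[].
have -> : potential g leb (EFin \o D) x =
    (\int[leb]_(z in Omega) ((g x z)%:E * (D z)%:E))%E.
  rewrite [RHS]integral_mkcond; apply: eq_integral => z _.
  rewrite patchE; case: ifPn => // /negP; rewrite inE => Oz.
  by rewrite /= weightC// mule0.
apply: (@le_trans _ _ (\int[leb]_(z in Omega)
    ((C * 2 `^ gamma * D x)%:E * (enorm (z - x) `^ (- al))%:E)))%E.
  apply: ge0_le_integral => //.
  - by move=> z _; rewrite -EFinM lee_fin mulr_ge0 ?off_diag_ge0 ?weight_ge0.
  - apply: measurable_funTS; apply: (measurable_kernelM (f := EFin \o D)).
      exact: off_diag_kernel.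
    by apply/measurable_EFinP; exact: measurable_weightD.
  - apply: measurable_funTS; apply: emeasurable_funM => //; apply/measurable_EFinP.
    exact: (measurableT_comp (measurable_powR (- al)) (measurable_enormB x)).
  move=> z Oz; rewrite -!EFinM lee_fin.
  have [->|/eqP zx] := eqVneq z x.
    rewrite off_diagxx mul0r.
    by rewrite !mulr_ge0 ?powR_ge0 ?weight_ge0 ?(ltW C0).
  have xz : x <> z by move=> e; exact: zx.
  have /andP[_ h] := HC x z Ox Oz xz.
  apply: le_trans (ler_wpM2r (weight_ge0 z) h) _.
  rewrite -[leLHS]mulrA -!(mulrA C) ler_wpM2l ?(ltW C0)//.
  rewrite (weightT _ Ox) (weightT _ Oz) (enormB z).
  apply: qdist_weight => //; [exact: enorm_gt0P|exact: d0|exact: d0|].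
  exact: bdist_le_add.
rewrite ge0_integralZl//; last 3 first.
- apply: measurable_funTS; apply/measurable_EFinP.
  exact: (measurableT_comp (measurable_powR (- al)) (measurable_enormB x)).
- by move=> z _; rewrite lee_fin powR_ge0.
- by rewrite lee_fin !mulr_ge0 ?powR_ge0 ?weight_ge0 ?(ltW C0).
apply: (le_trans (lee_wpmul2l _ (HS x Ox))).
  by rewrite lee_fin !mulr_ge0 ?powR_ge0 ?weight_ge0 ?(ltW C0).
rewrite -EFinM lee_fin mulrAC ler_wpM2r ?weight_ge0// lerDl//.
Qed.

(** By [qdist_moment], the integrand has a singularity of order
(N-2s) p + gamma p - gamma at y; this is smaller than N if and only if
p < pstar. *)
Lemma off_diag_moment p : 1 < p -> p < (N%:R + gamma) / (N%:R + gamma - 2 * s) ->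
  exists2 C, 0 < C & forall y,
  (\int[leb]_z (D z * (g z y / D y) `^ p)%:E <= C%:E)%E.
Proof.
move=> p1 pp.
have p0 : 0 < p by exact: lt_trans p1.
have [C C0 HC] := off_diag_estimate.
pose a := al * p + gamma * p - gamma.
have a0N : 0 < a < N%:R.
  have den : 0 < N%:R + gamma - 2 * s by rewrite addrAC addr_gt0.
  move: pp; rewrite ltr_pdivlMr// => pp; apply/andP; split.
    by rewrite /a -addrA addr_gt0 ?mulr_gt0// -[X in _ - X]mulr1 -mulrBr mulr_gt0// subr_gt0.
  by rewrite /a; lra.
have [S S0 HS] := singular_integral_domain a0N.
exists (C `^ p * 2 `^ gamma * S + 1) => [|y].
  by rewrite ltr_wpDl// !mulr_ge0// powR_ge0.
have [Oy|Oy] := pselect (Omega y); last first.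
  rewrite integral0_eq ?lee_fin ?addr_ge0 ?mulr_ge0 ?powR_ge0// => z _.
  by rewrite off_diagC ?mul0r ?powR0 ?mulr0 ?gt_eqF// => -[].
have kg := off_diag_kernel.
have -> : (\int[leb]_z (D z * (g z y / D y) `^ p)%:E =
    \int[leb]_(z in Omega) (D z * (g z y / D y) `^ p)%:E)%E.
  rewrite [RHS]integral_mkcond; apply: eq_integral => z _.
  rewrite patchE; case: ifPn => // /negP; rewrite inE => Oz.
  by rewrite weightC// mul0r.
apply: (@le_trans _ _ (\int[leb]_(z in Omega)
    ((C `^ p * 2 `^ gamma)%:E * (enorm (z - y) `^ (- a))%:E)))%E.
  apply: ge0_le_integral => //.
  - by move=> z _; rewrite lee_fin mulr_ge0 ?powR_ge0 ?weight_ge0.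
  - apply: measurable_funTS; apply/measurable_EFinP; apply: measurable_funM.
      exact: measurable_weightD.
    have -> : (fun z => (g z y / D y) `^ p) =
        (@powR R ^~ p) \o (fun z => g y z * (D y)^-1).
      by apply/funext => z /=; rewrite off_diag_sym.
    apply: measurableT_comp; first exact: measurable_powR.
    by apply: measurable_funM => //; exact: measurable_kernel1.
  - apply: measurable_funTS; apply: emeasurable_funM => //; apply/measurable_EFinP.
    exact: (measurableT_comp (measurable_powR (- a)) (measurable_enormB y)).
  move=> z Oz; rewrite -!EFinM lee_fin.
  have [->|/eqP zy] := eqVneq z y.
    rewrite off_diagxx mul0r powR0 ?gt_eqF// mulr0.
    by rewrite !mulr_ge0 ?powR_ge0.
  have /andP[_ h] := HC z y Oz Oy zy.
  have Dy0 := weight_gt0 Oy.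
  have {}h : g z y / D y <= C * (D z / qdist al gamma (enorm (z - y)) (delta z) (delta y)).
    rewrite ler_pdivrMr//; apply: le_trans h _.
    by rewrite -!mulrA ler_wpM2l ?(ltW C0)// ler_wpM2l ?weight_ge0// mulrC.
  have q0 := qdist_gt0 al gamma (delta z) (delta y) (enorm_gt0P zy).
  apply: (@le_trans _ _ (D z * (C * (D z / qdist al gamma (enorm (z - y)) (delta z) (delta y))) `^ p)).
    rewrite ler_wpM2l ?weight_ge0//; apply: le_powR2 => //; first exact: ltW.
    by rewrite divr_ge0 ?off_diag_ge0// ltW.
  rewrite powRM ?(ltW C0) ?divr_ge0 ?weight_ge0 ?(ltW q0)// mulrCA -mulrA.
  rewrite ler_wpM2l ?powR_ge0// (weightT _ Oz).
  apply: qdist_moment => //; [exact: enorm_gt0P|exact: d0|exact: d0|].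
  exact: bdist_lipschitz.
rewrite ge0_integralZl//; last 3 first.
- apply: measurable_funTS; apply/measurable_EFinP.
  exact: (measurableT_comp (measurable_powR (- a)) (measurable_enormB y)).
- by move=> z _; rewrite lee_fin powR_ge0.
- by rewrite lee_fin !mulr_ge0 ?powR_ge0.
apply: (le_trans (lee_wpmul2l _ (HS y Oy))).
  by rewrite lee_fin !mulr_ge0 ?powR_ge0.
by rewrite -EFinM lee_fin lerDl.
Qed.

Lemma off_diag_3G : exists2 C, 0 < C & forall x y z, x <> y ->
  g x z * g z y <= C * g x y * D z * (g x z / D x + g z y / D y).
Proof.
have [C C0 HC] := off_diag_estimate.
pose B := 2 `^ (al + gamma + gamma).
have B0 : 0 < B by rewrite powR_gt0.
pose K := C * C * C * C * B.
have K0 : 0 < K by rewrite !mulr_gt0.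
exists K => // x y z xy.
have rhs0 : 0 <= K * g x y * D z * (g x z / D x + g z y / D y).
  by rewrite !mulr_ge0 ?addr_ge0 ?divr_ge0 ?off_diag_ge0 ?weight_ge0// ltW.
have [[Ox Oz xz]|h] := pselect (off_diagonal Omega (x, z)); last first.
  by rewrite (off_diagC _ h) mul0r; rewrite (off_diagC _ h) in rhs0.
have [[_ Oy zy]|h] := pselect (off_diagonal Omega (z, y)); last first.
  by rewrite (off_diagC _ h) mulr0; rewrite (off_diagC _ h) in rhs0.
move: Ox Oy Oz xz zy => /= Ox Oy Oz xz zy {rhs0}.
have rxy := enorm_gt0P xy; have rxz := enorm_gt0P xz; have rzy := enorm_gt0P zy.
have /andP[lxy _] := HC x y Ox Oy xy.
have /andP[lxz uxz] := HC x z Ox Oz xz.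
have /andP[lzy uzy] := HC z y Oz Oy zy.
have tri : qdist al gamma (enorm (x - y)) (delta x) (delta y) <=
    B * (qdist al gamma (enorm (x - z)) (delta x) (delta z) +
         qdist al gamma (enorm (z - y)) (delta z) (delta y)).
  apply: qdist_triangle => //; rewrite ?(ltW (d0 _))//.
  - exact: enorm_triangle.
  - exact: bdist_lipschitz.
  - exact: bdist_le_add.
move: lxy lxz uxz lzy uzy tri.
have q1 := qdist_gt0 al gamma (delta x) (delta y) rxy.
have q2 := qdist_gt0 al gamma (delta x) (delta z) rxz.
have q3 := qdist_gt0 al gamma (delta z) (delta y) rzy.
move: q1 q2 q3.
move: (qdist _ _ _ _ _) (qdist _ _ _ _ _) (qdist _ _ _ _ _) => q3 q2 q1 q1_0 q2_0 q3_0.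
have := @three_G_algebra R C B q1 q2 q3 (D x) (D y) (D z).
by apply => //; [exact: weight_gt0|exact: weight_gt0|exact: weight_gt0|exact: off_diag_ge0|exact: off_diag_ge0].
Qed.

End green_weight.

(** * Weak and pointwise solutions for an abstract kernel *)

Section weak_pointwise.
Local Open Scope ereal_scope.
Context d (T : measurableType d) (R : realType).
Variables (m mu : {sigma_finite_measure set T -> \bar R}).
Variables (g : T -> T -> R) (D : T -> R) (C : R) (gk : green_kernel m g D C).
Variables (p : R) (p1 : (1 < p)%R).
Hypothesis mu1 : \int[mu]_x (D x)%:E = 1.
Let p0 : (0 < p)%R. Proof. exact: lt_trans p1. Qed.
Let kg := gk_kernel gk.
Let g0 : forall x y, (0 <= g x y)%R. Proof. by case: kg. Qed.
Let C0 := gk_const gk.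
Let D0 := gk_ge0 gk.
Let mDR : measurable_fun setT D. Proof. exact: gk_measurable gk. Qed.
Let mD : measurable_fun setT (EFin \o D).
Proof. exact/measurable_EFinP. Qed.
Let P := potential g mu (cst 1).
Let P0 x : 0 <= P x. Proof. exact: potential_ge0. Qed.
Let mP : measurable_fun setT P. Proof. exact: measurable_potential. Qed.

Definition powerE (u : T -> R) (x : T) : \bar R := (u x `^ p)%:E.

Let powerE_ge0 u x : 0 <= powerE u x. Proof. by rewrite lee_fin powR_ge0. Qed.

Let measurable_powerE u : measurable_fun setT u -> measurable_fun setT (powerE u).
Proof.
move=> mu'; apply/measurable_EFinP.
exact: (measurableT_comp (measurable_powR p) mu').
Qed.

Let DpowerE_ge0 u x : 0 <= (D x)%:E * powerE u x.
Proof. by apply: mule_ge0; [rewrite lee_fin|exact: powerE_ge0]. Qed.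

(** The equation is only required where D is positive, that is inside the
domain. *)
Record pointwise_solution (l : R) (u : T -> R) : Prop := {
  pw_measurable : measurable_fun setT u ;
  pw_ge0 : forall x, (0 <= u x)%R ;
  pw_Lp : \int[m]_x ((D x)%:E * powerE u x) < +oo ;
  pw_eq : {ae m, forall x, D x != 0%R ->
    (u x)%:E = potential g m (powerE u) x + l%:E * P x} }.

(** u <= 1 + u^p, and D is integrable. *)
Lemma weight_L1 (u : T -> R) : measurable_fun setT u -> (forall x, (0 <= u x)%R) ->
  \int[m]_x ((D x)%:E * powerE u x) < +oo ->
  \int[m]_x (D x * u x)%:E < +oo.
Proof.
move=> mu' u0 uoo.
apply: (@le_lt_trans _ _ (\int[m]_x ((D x)%:E + (D x)%:E * powerE u x))).
  apply: ge0_le_integral => //.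
  - by move=> x _; rewrite lee_fin mulr_ge0.
  - by apply/measurable_EFinP; exact: measurable_funM.
  - apply: emeasurable_funD => //; apply: (measurable_weight gk).
    exact: measurable_powerE.
  move=> x _; rewrite -EFinM -EFinD lee_fin -{2}[D x]mulr1 -mulrDr ler_wpM2l//.
  have [u1|u1] := leP (u x) 1%R; first by rewrite (le_trans u1)// lerDl powR_ge0.
  rewrite -[leLHS]add0r lerD// -{1}[u x]powRr1//; apply: ler_powR; exact: ltW.
rewrite ge0_integralD//; last 2 first.
- by move=> x _; rewrite lee_fin.
- by apply: (measurable_weight gk); exact: measurable_powerE.
by rewrite lte_add_pinfty//; exact: gk_integrable gk.
Qed.

Let W l u x := potential g m (powerE u) x + l%:E * P x.

(** The weak formulation is the pairing of D v with the right-hand side of the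
pointwise equation. *)
Lemma pairing_duality (l : R) (u v : T -> R) : (0 <= l)%R ->
  measurable_fun setT u -> measurable_fun setT v -> (forall x, (0 <= v x)%R) ->
  \int[m]_x ((D x * v x)%:E * W l u x) =
  \int[m]_x (powerE u x * potential g m (fun y => (D y * v y)%:E) x) +
  l%:E * \int[mu]_x potential g m (fun y => (D y * v y)%:E) x.
Proof.
move=> l0 mu' mv v0.
pose h x := (D x * v x)%:E.
have h0 x : 0 <= h x by rewrite lee_fin mulr_ge0.
have mh : measurable_fun setT h by apply/measurable_EFinP; exact: measurable_funM.
have mu_p := measurable_powerE mu'.
have mpu : measurable_fun setT (potential g m (powerE u)) by exact: measurable_potential.
have pu0 x : 0 <= potential g m (powerE u) x by exact: potential_ge0.
rewrite -(@potential_duality _ _ _ g m m (powerE u) h)//.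
have -> : \int[mu]_x potential g m (fun y => (D y * v y)%:E) x = \int[m]_x (h x * P x).
  rewrite (@potential_duality _ _ _ g mu m (cst 1) h)//.
  by apply: eq_integral => x _; rewrite mul1e.
rewrite -ge0_integralZl//; last 2 first.
- exact: emeasurable_funM.
- by move=> x _; rewrite mule_ge0.
rewrite -ge0_integralD//; last 4 first.
- by move=> x _; rewrite mule_ge0.
- exact: emeasurable_funM.
- by move=> x _; rewrite !mule_ge0.
- by apply: emeasurable_funM => //; exact: emeasurable_funM.
apply: eq_integral => x _; rewrite /W ge0_muleDr ?mule_ge0//.
by congr (_ + _); rewrite muleCA.
Qed.

(** Testing with D times indicators identifies D u with D times the right-hand
side, almost everywhere; the right-hand side is not known to be finite
beforehand, and D u is integrable by [weight_L1]. *)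
Lemma weak_pointwise (l : R) (u : T -> R) : (0 <= l)%R ->
  measurable_fun setT u -> (forall x, (0 <= u x)%R) ->
  \int[m]_x ((D x)%:E * powerE u x) < +oo ->
  (forall A, measurable A ->
    \int[m]_x (u x * (D x * \1_A x))%:E =
    \int[m]_x (powerE u x * potential g m (fun y => (D y * \1_A y)%:E) x) +
    l%:E * \int[mu]_x potential g m (fun y => (D y * \1_A y)%:E) x) ->
  pointwise_solution l u.
Proof.
move=> l0 mu' u0 uoo H; split => //.
have mWu : measurable_fun setT (W l u).
  apply: emeasurable_funD; last exact: emeasurable_funM.
  by apply: measurable_potential => //; exact: measurable_powerE.
have W0 x : 0 <= W l u x.
  by rewrite adde_ge0 ?mule_ge0//; exact: potential_ge0.
have : ae_eq m setT (fun x => (D x * u x)%:E) (fun x => (D x)%:E * W l u x).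
  apply: integral_ae_eq => //.
  - apply/integrableP; split; first by apply/measurable_EFinP; exact: measurable_funM.
    under eq_integral do rewrite gee0_abs ?lee_fin ?mulr_ge0//.
    exact: weight_L1.
  - exact: (measurable_weight gk).
  move=> A _ mA.
  have -> : \int[m]_(x in A) (D x * u x)%:E = \int[m]_x (u x * (D x * \1_A x))%:E.
    rewrite integral_mkcond; apply: eq_integral => x _; rewrite patchE indicE.
    by case: ifPn => _; rewrite ?mulr1 ?mulr0 1?mulrC.
  have mA1 : measurable_fun setT (\1_A : T -> R) by exact: measurable_indic.
  rewrite H// -pairing_duality//.
  rewrite [RHS]integral_mkcond; apply: eq_integral => x _; rewrite patchE indicE.
  by case: ifPn => _; rewrite ?mulr1 ?mulr0 ?mul0e.
apply: filterS => x /(_ I) + Dx; rewrite /W EFinM => /(congr1 (fun e => (D x)^-1%:E * e)).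
by rewrite !muleA -[(D x)^-1%:E * (D x)%:E]EFinM mulVf// !mul1e.
Qed.

Lemma integral_sub (s : {measure set T -> \bar R}) (a b : T -> \bar R) :
  measurable_fun setT a -> measurable_fun setT b ->
  (forall x, 0 <= a x) -> (forall x, 0 <= b x) ->
  \int[s]_x a x < +oo -> \int[s]_x b x < +oo ->
  \int[s]_x (a x - b x) = \int[s]_x a x - \int[s]_x b x.
Proof.
have I (c : T -> \bar R) : measurable_fun setT c -> (forall x, 0 <= c x) ->
    \int[s]_x c x < +oo -> s.-integrable setT c.
  move=> mc c0 coo; apply/integrableP; split => //.
  by under eq_integral do rewrite gee0_abs//.
by move=> ma mb a0 b0 aoo boo; apply: integralB => //; exact: I.
Qed.

(** For v >= 0 this is [pairing_duality]. In general, v is split into its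
positive and negative parts, and the four integrals subtracted must be finite:
this follows from G[D |v|] <= |M| C D, int D u^p < +oo and int D dmu = 1. *)
Lemma pointwise_weak (l : R) (u v : T -> R) (M : R) : (0 <= l)%R ->
  pointwise_solution l u -> measurable_fun setT v ->
  {ae m, forall x, (`|v x| <= M)%R} ->
  let Gv x := \int[m]_y (g x y * (D y * v y))%:E in
  \int[m]_x (u x * (D x * v x))%:E =
  \int[m]_x (powerE u x * Gv x) + l%:E * \int[mu]_x Gv x.
Proof.
move=> l0 [mu' u0 uoo ueq] mv vM Gv.
pose K : R := `|M|%R.
have K0 : (0 <= K)%R by exact: normr_ge0.
pose vp x := Num.max (v x) 0%R; pose vn x := Num.max (- v x)%R 0%R.
have mvp : measurable_fun setT vp by apply: measurable_maxr.
have mvn : measurable_fun setT vn.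
  by apply: measurable_maxr => //; exact: measurableT_comp.
have vp0 x : (0 <= vp x)%R by rewrite le_max lexx orbT.
have vn0 x : (0 <= vn x)%R by rewrite le_max lexx orbT.
have vE x : v x = (vp x - vn x)%R.
  rewrite /vp /vn; case: (leP (v x) 0%R) => h; rewrite ?(max_r h) ?(max_l (ltW h)).
    by rewrite max_l ?oppr_ge0// sub0r opprK.
  by rewrite max_r ?oppr_le0 ?(ltW h)// subr0.
have vpK : {ae m, forall x, (vp x <= K)%R}.
  apply: filterS vM => x vx; rewrite ge_max K0 andbT.
  exact: le_trans (ler_norm _) (le_trans vx (ler_norm _)).
have vnK : {ae m, forall x, (vn x <= K)%R}.
  apply: filterS vM => x vx; rewrite ge_max K0 andbT.
  by apply: le_trans (ler_norm _) _; rewrite normrN (le_trans vx)// ler_norm.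
have mup := measurable_powerE mu'.
suff main (w : T -> R) : measurable_fun setT w -> (forall x, (0 <= w x)%R) ->
    {ae m, forall x, (w x <= K)%R} ->
    let A x := potential g m (fun y => (D y * w y)%:E) x in
    [/\ forall x, A x < +oo,
      \int[m]_x (u x * (D x * w x))%:E < +oo,
      \int[m]_x (powerE u x * A x) < +oo,
      \int[mu]_x A x < +oo &
      \int[m]_x (u x * (D x * w x))%:E =
        \int[m]_x (powerE u x * A x) + l%:E * \int[mu]_x A x].
  have [Ap1 Xp Yp Zp Ep] := main vp mvp vp0 vpK.
  have [An1 Xn Yn Zn En] := main vn mvn vn0 vnK.
  set Ap := potential g m (fun y => (D y * vp y)%:E) in Ap1 Yp Zp Ep.
  set An := potential g m (fun y => (D y * vn y)%:E) in An1 Yn Zn En.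
  have mDp : measurable_fun setT (fun y => (D y * vp y)%:E).
    by apply/measurable_EFinP; exact: measurable_funM.
  have mDn : measurable_fun setT (fun y => (D y * vn y)%:E).
    by apply/measurable_EFinP; exact: measurable_funM.
  have Dp0 y : 0 <= (D y * vp y)%:E by rewrite lee_fin mulr_ge0.
  have Dn0 y : 0 <= (D y * vn y)%:E by rewrite lee_fin mulr_ge0.
  have mAp : measurable_fun setT Ap by exact: measurable_potential.
  have mAn : measurable_fun setT An by exact: measurable_potential.
  have Ap0 x : 0 <= Ap x by exact: potential_ge0.
  have An0 x : 0 <= An x by exact: potential_ge0.
  have GvE x : Gv x = Ap x - An x.
    rewrite /Gv -integral_sub//.
    - by apply: eq_integral => y _; rewrite vE -!EFinM -EFinB; congr EFin; ring.
    - exact: measurable_kernelM.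
    - exact: measurable_kernelM.
    - by move=> y; apply: mule_ge0 => //; rewrite lee_fin.
    - by move=> y; apply: mule_ge0 => //; rewrite lee_fin.
    - exact: Ap1.
    - exact: An1.
  have mX (w : T -> R) : measurable_fun setT w ->
      measurable_fun setT (fun x => (u x * (D x * w x))%:E).
    by move=> mw; apply/measurable_EFinP; do 2 apply: measurable_funM => //.
  have -> : \int[m]_x (u x * (D x * v x))%:E =
      \int[m]_x (u x * (D x * vp x))%:E - \int[m]_x (u x * (D x * vn x))%:E.
    rewrite -integral_sub//; try exact: mX.
    - by apply: eq_integral => x _; rewrite vE -EFinB; congr EFin; ring.
    - by move=> x; rewrite lee_fin !mulr_ge0.
    - by move=> x; rewrite lee_fin !mulr_ge0.
  have -> : \int[m]_x (powerE u x * Gv x) =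
      \int[m]_x (powerE u x * Ap x) - \int[m]_x (powerE u x * An x).
    rewrite -(@integral_sub m (fun x => powerE u x * Ap x) (fun x => powerE u x * An x)).
    - apply: eq_integral => x _; rewrite GvE muleBr// fin_num_adde_defl//.
      by rewrite fin_numN ge0_fin_numE.
    - exact: emeasurable_funM (measurable_powerE mu') mAp.
    - exact: emeasurable_funM (measurable_powerE mu') mAn.
    - by move=> x; apply: mule_ge0; [exact: powerE_ge0|exact: Ap0].
    - by move=> x; apply: mule_ge0; [exact: powerE_ge0|exact: An0].
    - exact: Yp.
    - exact: Yn.
  have -> : \int[mu]_x Gv x = \int[mu]_x Ap x - \int[mu]_x An x.
    rewrite -(integral_sub mAp mAn Ap0 An0 Zp Zn).
    by apply: eq_integral => x _; rewrite GvE.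
  rewrite Ep En.
  have Yp0 : 0 <= \int[m]_x (powerE u x * Ap x) by apply: integral_ge0 => x _; rewrite mule_ge0.
  have Yn0 : 0 <= \int[m]_x (powerE u x * An x) by apply: integral_ge0 => x _; rewrite mule_ge0.
  have Zp0 : 0 <= \int[mu]_x Ap x by exact: integral_ge0.
  have Zn0 : 0 <= \int[mu]_x An x by exact: integral_ge0.
  move: Yp Yn Zp Zn Yp0 Yn0 Zp0 Zn0.
  case: (\int[m]_x (powerE u x * Ap x)) => [yp|//|//] _.
  case: (\int[m]_x (powerE u x * An x)) => [yn|//|//] _.
  case: (\int[mu]_x Ap x) => [zp|//|//] _.
  case: (\int[mu]_x An x) => [zn|//|//] _ _ _ _ _.
  apply: (congr1 EFin (_ : (yp + l * zp - (yn + l * zn) =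
    yp - yn + l * (zp - zn))%R)).
  by ring.
move=> mw w0 wK A.
have mDw : measurable_fun setT (fun y => (D y * w y)%:E).
  by apply/measurable_EFinP; exact: measurable_funM.
have Dw0 y : 0 <= (D y * w y)%:E by rewrite lee_fin mulr_ge0.
have mA : measurable_fun setT A by exact: measurable_potential.
have A0 x : 0 <= A x by exact: potential_ge0.
have AD x : A x <= (K * C)%:E * (D x)%:E.
  apply: (@le_trans _ _ (potential g m (fun y => K%:E * (EFin \o D) y) x)).
    apply: le_potential => //.
    - exact: emeasurable_funM.
    - by move=> y; rewrite mule_ge0 ?lee_fin.
    - by apply: filterS wK => y wy; rewrite -EFinM lee_fin mulrC ler_wpM2r.
  rewrite potentialZ//.
  by rewrite EFinM -muleA lee_wpmul2l ?lee_fin// -EFinM; exact: gk_upper gk x.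
have KC0 : (0 <= K * C)%R by rewrite mulr_ge0// ltW.
have E1 : \int[m]_x (u x * (D x * w x))%:E = \int[m]_x ((D x * w x)%:E * W l u x).
  apply: ge0_ae_eq_integral => //.
  - by apply/measurable_EFinP; do 2 apply: measurable_funM => //.
  - apply: emeasurable_funM => //; apply: emeasurable_funD; last exact: emeasurable_funM.
    exact: measurable_potential.
  - by move=> x _; rewrite lee_fin !mulr_ge0.
  - move=> x _; rewrite mule_ge0// adde_ge0 ?mule_ge0//.
    exact: potential_ge0.
  apply: filterS ueq => x h _; rewrite /W; have [Dx|/h <-] := eqVneq (D x) 0%R.
    by rewrite Dx mul0r mulr0 mul0e.
  by rewrite -EFinM mulrC.
split.
- by move=> x; apply: le_lt_trans (AD x) _; rewrite -EFinM ltry.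
- apply: (@le_lt_trans _ _ (\int[m]_x (K%:E * (D x * u x)%:E))).
    apply: ae_ge0_le_integral => //.
    + by move=> x _; rewrite lee_fin !mulr_ge0.
    + by apply/measurable_EFinP; do 2 apply: measurable_funM => //.
    + by move=> x _; rewrite mule_ge0 ?lee_fin ?mulr_ge0.
    + apply: emeasurable_funM => //; apply/measurable_EFinP.
      exact: measurable_funM.
    apply: filterS wK => x wx _; rewrite -EFinM lee_fin mulrA (mulrC K) (mulrC (u x)).
    by rewrite ler_wpM2l// mulr_ge0.
  rewrite ge0_integralZl//; last 2 first.
  + by apply/measurable_EFinP; exact: measurable_funM.
  + by move=> x _; rewrite lee_fin mulr_ge0.
  by apply: lte_mul_pinfty; rewrite ?lee_fin//; exact: weight_L1.
- apply: (@le_lt_trans _ _ (\int[m]_x ((K * C)%:E * ((D x)%:E * powerE u x)))).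
    apply: ge0_le_integral => //.
    + by move=> x _; rewrite mule_ge0.
    + exact: emeasurable_funM.
    + by apply: emeasurable_funM => //; exact: (measurable_weight gk).
    by move=> x _; rewrite muleC muleA lee_wpmul2r.
  rewrite ge0_integralZl//; last exact: (measurable_weight gk).
  by apply: lte_mul_pinfty; rewrite ?lee_fin.
- apply: (@le_lt_trans _ _ (\int[mu]_x ((K * C)%:E * (D x)%:E))).
    apply: ge0_le_integral => //.
    exact: emeasurable_funM.
  rewrite ge0_integralZl// ?mu1 ?mule1 ?ltry ?lee_fin//.
  by move=> x _; rewrite lee_fin.
- by rewrite E1 pairing_duality.
Qed.

(** A solution vanishing where D does is a supersolution at every point where
the equation holds, so [picard_sup_min] applies. *)
Lemma pointwise_picard (l : R) (u : T -> R) : (0 <= l)%R -> pointwise_solution l u ->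
  solvable m mu g D p l /\
  {ae m, forall x, D x != 0%R -> picard_sup m mu g p l x <= (u x)%:E}.
Proof.
move=> l0 [mu' u0 uoo ueq].
pose v x := if D x == 0%R then 0 else (u x)%:E.
have mv : measurable_fun setT v.
  apply: measurable_fun_ifT => //; last exact/measurable_EFinP.
  exact: measurable_fun_eqr.
have v0 x : 0 <= v x by rewrite /v; case: ifP => // _; rewrite lee_fin.
have pv x : potential g m (fun y => v y `^ p) x = potential g m (powerE u) x.
  apply: eq_integral => y _; rewrite /v; case: ifPn => // /eqP Dy.
  by case: kg => _ gC _; rewrite gC (gk_support gk)// !mul0e.
have Uv : {ae m, forall x, picard_sup m mu g p l x <= v x}.
  apply: picard_sup_min => //; apply: filterS ueq => x h.
  rewrite pv /v; case: eqVneq => [Dx|/h <-//].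
  by rewrite !(potential_support gk)// mule0 adde0.
split.
  apply: (solvable_le gk p1 l0 mv v0 _ Uv).
  rewrite (_ : \int[m]_x _ = \int[m]_x ((D x)%:E * powerE u x))//.
  apply: eq_integral => x _; rewrite /v; case: ifPn => // /eqP ->.
  by rewrite !mul0e.
by apply: filterS Uv => x + Dx; rewrite /v (negbTE Dx).
Qed.

Lemma picard_pointwise (l : R) : (0 <= l)%R -> solvable m mu g D p l ->
  let u x := fine (picard_sup m mu g p l x) in
  pointwise_solution l u /\ {ae m, forall x, (u x)%:E = picard_sup m mu g p l x}.
Proof.
move=> l0 sl; set U := picard_sup m mu g p l; move=> u.
have U0 x : 0 <= U x by exact: picard_sup_ge0.
have mU : measurable_fun setT U by exact: measurable_picard_sup.
have UE x : U x = potential g m (fun y => U y `^ p) x + l%:E * P x.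
  exact: picard_supE.
have uU : {ae m, forall x, (u x)%:E = U x}.
  apply: filterS (weight_ae_fin gk p0 mU U0 sl) => x h.
  rewrite fineK// ge0_fin_numE//; have [Dx|/h//] := eqVneq (D x) 0%R.
  by rewrite UE /P !(potential_support gk)// mule0 adde0.
have u0 x : (0 <= u x)%R by exact: fine_ge0.
have mu' : measurable_fun setT u by exact: measurableT_comp.
have upU : {ae m, forall x, powerE u x = U x `^ p}.
  by apply: filterS uU => x <-.
split => //; split => //.
  rewrite (_ : \int[m]_x _ = \int[m]_x ((D x)%:E * U x `^ p))//.
  apply: ge0_ae_eq_integral => //.
  - by apply: (measurable_weight gk); exact: measurable_powerE.
  - by apply: (measurable_weight gk); exact: measurable_poweR_comp.
  - by move=> x _; rewrite mule_ge0 ?lee_fin ?poweR_ge0.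
  - by apply: filterS upU => x ->.
apply: filterS uU => x ->; rewrite UE => _; congr (_ + _).
apply: ge0_ae_eq_integral => //.
- by apply: measurable_kernelM => //; exact: measurable_poweR_comp.
- by apply: measurable_kernelM => //; exact: measurable_powerE.
- by move=> y _; rewrite mule_ge0 ?lee_fin ?poweR_ge0.
- by move=> y _; rewrite mule_ge0// lee_fin.
- by apply: filterS upU => y ->.
Qed.

End weak_pointwise.

(** * Weak-dual solutions on a domain *)

Section sigma_finite_packing.
Context d (T : measurableType d) (R : realType) (mu : {measure set T -> \bar R}).

(** A copy of mu that carries the proof of sigma-finiteness in its type, as
needed to form product measures. *)
Definition sf_measure (h : sigma_finite setT mu) : set T -> \bar R := mu.

HB.instance Definition _ h := Measure.on (sf_measure h).
HB.instance Definition _ h :=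
  Measure_isSigmaFinite.Build _ _ _ (sf_measure h) h.

End sigma_finite_packing.

Lemma sigma_finite_measureP d (T : measurableType d) (R : realType)
    (mu : {measure set T -> \bar R}) : sigma_finite setT mu ->
  exists s : {sigma_finite_measure set T -> \bar R},
    s = mu :> {measure set T -> \bar R}.
Proof. by move=> h; exists (sf_measure h); case: mu h. Qed.

Section green_measures.
Context (R : realType) (n : nat).
Local Notation N := n.+1.
Local Notation E := 'rV[R]_N.
Local Notation leb := (@lebesgue_rV R N).
Variables (Omega : set E).
Local Notation delta := (bdist Omega).
Variables (s gamma : R) (G : E -> E -> R) (GO : (E -> R) -> (E -> R)).
Hypotheses (s0 : 0 < s) (gamma0 : 0 < gamma) (N2s : 2 * s < N%:R).
Hypotheses (oO : open Omega) (bO : bounded_set Omega) (O0 : Omega !=set0).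
Hypothesis (G2 : hyp_G2 Omega s gamma GO G).
Local Notation D := (weight Omega gamma).
Local Notation g := (off_diag Omega G).
Let mO : measurable Omega. Proof. exact: open_measurable_mx. Qed.
Let d0 x : Omega x -> 0 < delta x. Proof. exact: bdist_gt0. Qed.
Let mDR : measurable_fun setT D. Proof. exact: measurable_weightD. Qed.
Let mD : measurable_fun setT (EFin \o D). Proof. exact/measurable_EFinP. Qed.
Let D0 x : 0 <= D x. Proof. exact: weight_ge0. Qed.
Let kg : sym_kernel g. Proof. exact: off_diag_kernel G2. Qed.

Let lebesgue_cubeE y r : 0 <= r ->
  (leb : {measure set E -> \bar R}) (cube y r) = ((2 * r) ^+ N)%:E.
Proof. exact: lebesgue_cube. Qed.

Lemma weight_integrable : (\int[leb]_x (D x)%:E < +oo)%E.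
Proof.
have [M M0 [dM _]] := domain_radius oO bO O0.
have [K K0 OK] := domain_cube oO bO O0; have [x0 Ox0] := O0.
apply: (@le_lt_trans _ _ (\int[leb]_(x in cube x0 K) (M `^ gamma)%:E))%E.
  rewrite [leRHS]integral_mkcond; apply: ge0_le_integral => //.
  - by move=> x _; rewrite lee_fin.
  - by apply/(measurable_restrictT _ (measurable_cube x0 K)); exact: measurable_cst.
  move=> x _; rewrite patchE; case: ifPn => [_|/negP xK].
    have [Ox|Ox] := pselect (Omega x); last by rewrite weightC// lee_fin powR_ge0.
    by rewrite weightT// lee_fin; apply: le_powR2; rewrite ?(ltW gamma0) ?(ltW (d0 Ox)) ?dM.
  rewrite weightC// => Ox; apply: xK; rewrite inE; exact: OK Ox0 _ Ox.
rewrite integral_cst; last exact: measurable_cube.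
by rewrite lebesgue_cubeE ?(ltW K0)// -EFinM ltry.
Qed.

(** D is bounded below on a small cube around a point of Omega. *)
Lemma weight_sqr_nontrivial : (0 < \int[leb]_x (D x * D x)%:E)%E.
Proof.
have [x0 Ox0] := O0; have dx0 := d0 Ox0.
pose e := delta x0 / 2 / N%:R.
have e0 : 0 < e by rewrite !divr_gt0.
have nr z : cube x0 e z -> enorm (x0 - z) <= delta x0 / 2.
  move=> /cubeP /enorm_le_coord h; rewrite enormB; apply: le_trans h _.
  by rewrite mulrC divfK.
pose c := (delta x0 / 2) `^ gamma.
have c0 : 0 < c by rewrite powR_gt0// divr_gt0.
apply: (@lt_le_trans _ _ (\int[leb]_(x in cube x0 e) (c * c)%:E))%E.
  rewrite integral_cst; last exact: measurable_cube.
  by rewrite lebesgue_cubeE ?(ltW e0)// -EFinM lte_fin !mulr_gt0// exprn_gt0 ?mulr_gt0.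
rewrite [leLHS]integral_mkcond; apply: ge0_le_integral => //.
- by move=> x _; rewrite patchE; case: ifP => // _; rewrite lee_fin mulr_ge0 ?(ltW c0).
- by apply/(measurable_restrictT _ (measurable_cube x0 e)); exact: measurable_cst.
- by apply/measurable_EFinP; exact: measurable_funM.
move=> x _; rewrite patchE; case: ifPn => [|_]; last by rewrite lee_fin mulr_ge0.
rewrite inE => /nr xx0.
have Ox : Omega x.
  by apply: (bdist_ball oO Ox0); apply: le_lt_trans xx0 _; lra.
have cD : c <= D x.
  rewrite weightT//; apply: le_powR2; rewrite ?(ltW gamma0) ?divr_ge0 ?(ltW dx0)//.
  by have := bdist_lipschitz oO bO O0 x0 x; lra.
by rewrite lee_fin; apply: ler_pM; rewrite ?(ltW c0).
Qed.

Lemma green_kernel_domain : exists2 C0, 0 < C0 &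
  forall C, C0 <= C -> green_kernel leb g D C.
Proof.
have [C1 C10 H1] := off_diag_lower gamma0 N2s oO bO O0 G2.
have [C2 C20 H2] := off_diag_upper s0 gamma0 N2s oO bO O0 G2.
exists (C1 + C2) => [|C CC]; first exact: addr_gt0.
split => //.
- exact: weight_integrable.
- exact: weight_sqr_nontrivial.
- exact: measurable_rV1.
- exact: lebesgue_rV1.
- by apply: lt_le_trans CC; exact: addr_gt0.
- move=> x y /(weight_eq0 oO bO O0) Ox.
  by apply: off_diagC => -[].
- move=> x y xy; apply: le_trans (H1 x y xy) _; apply: ler_wpM2r; last lra.
  exact: off_diag_ge0 G2 _ _.
- move=> x; apply: le_trans (H2 x) _; rewrite lee_fin; apply: ler_wpM2r => //; lra.
Qed.

Lemma subcritical_kernel_domain p : 1 < p ->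
  p < (N%:R + gamma) / (N%:R + gamma - 2 * s) -> exists2 C0, 0 < C0 &
  forall C, C0 <= C -> subcritical_kernel leb g D C p.
Proof.
move=> p1 pp.
have [C1 C10 H1] := off_diag_moment gamma0 N2s oO bO O0 G2 p1 pp.
have [C2 C20 H2] := off_diag_3G gamma0 N2s oO bO O0 G2.
exists (C1 + C2) => [|C CC]; first exact: addr_gt0.
have g0 x y : 0 <= g x y by exact: off_diag_ge0 G2 _ _.
split => //.
- by move=> y; apply: le_trans (H1 y) _; rewrite lee_fin; lra.
- move=> x y z xy; apply: le_trans (H2 x y z xy) _.
  do 3 (apply: ler_wpM2r; rewrite ?addr_ge0 ?divr_ge0//); lra.
Qed.

(** The sets D >= 1/(k+1) have finite measure, by the inequality of Markov, and
together with the complement of Omega they cover the space. *)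
Lemma weighted_sigma_finite (mu : {measure set E -> \bar R}) :
  mu (~` Omega) = 0%E -> (\int[mu]_(x in Omega) (delta x `^ gamma)%:E < +oo)%E ->
  sigma_finite setT mu.
Proof.
move=> muO muoo.
pose F k : set E := [set x | Omega x -> k.+1%:R^-1 <= D x].
have FE k : F k = ~` Omega `|` (D @^-1` `[k.+1%:R^-1, +oo[%classic).
  apply/seteqP; split=> [x /= Fx|x [Ox|Dx]].
  - have [Ox|Ox] := pselect (Omega x); [right|by left].
    by rewrite in_itv/= andbT; exact: Fx.
  - by move=> /Ox.
  - by move=> _; move: Dx; rewrite /= in_itv/= andbT.
have mDk k : measurable (D @^-1` `[k.+1%:R^-1, +oo[%classic).
  by rewrite -[X in measurable X]setTI; exact: mDR.
exists F.
  apply/seteqP; split=> // x _.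
  have [Ox|Ox] := pselect (Omega x); last by exists 0%N => //= /Ox.
  have Dx := weight_gt0 gamma oO bO O0 Ox.
  exists (Num.truncn (D x)^-1) => //= _.
  rewrite -[leRHS]invrK lef_pV2 ?posrE ?invr_gt0//.
  by apply: ltW; exact: truncnS_gt.
move=> k; split.
  by rewrite FE; apply: measurableU => //; exact: measurableC.
set A := D @^-1` `[k.+1%:R^-1, +oo[%classic.
apply: (@le_lt_trans _ _ (mu (~` Omega) + mu A)%E).
  by rewrite FE; apply: measureU2 => //; exact: measurableC.
rewrite [X in (X + _ < _)%E]muO add0e.
have : (\int[mu]_(x in A) (k.+1%:R^-1)%:E <= \int[mu]_(x in Omega) (delta x `^ gamma)%:E)%E.
  have -> : (\int[mu]_(x in Omega) (delta x `^ gamma)%:E = \int[mu]_x (D x)%:E)%E.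
    rewrite integral_mkcond; apply: eq_integral => x _; rewrite /weight !patchE.
    by case: ifP.
  rewrite integral_mkcond; apply: ge0_le_integral => //.
  - by move=> x _; rewrite patchE; case: ifP => // _; rewrite lee_fin.
  - by apply/(measurable_restrictT _ (mDk k)); exact: measurable_cst.
  move=> x _; rewrite patchE; case: ifPn => [|_]; last by rewrite lee_fin.
  by rewrite inE /A /= in_itv/= andbT lee_fin.
rewrite integral_cst//; last exact: mDk.
move=> /le_lt_trans/(_ muoo); case: (mu A) (measure_ge0 mu A) => // r.
  by move=> _ _; rewrite ltry.
by rewrite gt0_muley// lte_fin invr_gt0.
Qed.

(** Tonelli on the diagonal: the integral of mu({x}) dx is the mu-integral of
the Lebesgue measure of points. This allows measures mu with atoms although
the kernel estimates fail at y = x. *)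
Lemma ae_atomless (mu : {sigma_finite_measure set E -> \bar R}) :
  {ae leb, forall x, mu [set x] = 0%E}.
Proof.
pose d : set (E * E) := (fun z => z.1 - z.2) @^-1` [set 0].
have md : measurable d.
  rewrite -[X in measurable X]setTI; apply: measurable_sub => //.
  exact: measurable_rV1.
pose f (z : E * E) : \bar R := (\1_d z)%:E.
have mf : measurable_fun setT f by apply/measurable_EFinP; exact: measurable_indic.
have f0 z : (0 <= f z)%E by rewrite lee_fin.
have dE x y : f (x, y) = (\1_[set x] y)%:E.
  rewrite /f !indicE; congr ((nat_of_bool _)%:R%:E); apply/idP/idP; rewrite !inE /d/=.
    by move/eqP; rewrite subr_eq0 => /eqP.
  by move=> ->; rewrite subrr.
have dE' x y : f (x, y) = (\1_[set y] x)%:E.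
  rewrite /f !indicE; congr ((nat_of_bool _)%:R%:E); apply/idP/idP; rewrite !inE /d/=.
    by move/eqP; rewrite subr_eq0 => /eqP.
  by move=> ->; rewrite subrr.
have muE x : (\int[mu]_y f (x, y) = mu [set x])%E.
  under eq_integral do rewrite dE.
  by rewrite integral_indic ?setIT//; exact: measurable_rV1.
have lebE y : (\int[leb]_x f (x, y) = 0)%E.
  under eq_integral do rewrite dE'.
  rewrite integral_indic ?setIT//; last exact: measurable_rV1.
  exact: lebesgue_rV1.
have : (\int[leb]_x `|mu [set x]| = 0)%E.
  transitivity (\int[leb]_x \int[mu]_y f (x, y))%E.
    by apply: eq_integral => x _; rewrite muE gee0_abs.
  rewrite (fubini_tonelli f mf f0); apply: integral0_eq => y _.
  exact: lebE.
move/ae_eq_integral_abs => /(_ measurableT).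
have mm : measurable_fun setT (fun x => mu [set x]).
  rewrite (_ : (fun x => mu [set x]) = (fun x => \int[mu]_y f (x, y))%E); last first.
    by apply/funext => x; rewrite muE.
  exact: measurable_fun_fubini_tonelli_F.
by move=> /(_ mm); apply: filterS => x /(_ I).
Qed.

Lemma integral_off_diag (m : {measure set E -> \bar R}) x (f : E -> R) :
  Omega x -> m [set x] = 0%E -> measurable_fun Omega f ->
  (\int[m]_(y in Omega) (G x y * f y)%:E = \int[m]_y (g x y * (f \_ Omega) y)%:E)%E.
Proof.
move=> Ox mx mf.
have mgf : measurable_fun Omega (fun y => g x y * f y).
  apply: measurable_funM => //; apply: measurable_funTS.
  exact: measurable_kernel1.
have mGf : measurable_fun Omega (fun y => G x y * f y).
  have mx1 := measurable_rV1 x.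
  have -> : Omega = (Omega `\` [set x]) `|` [set x].
    by rewrite setUC setDUK// => _ ->.
  apply/measurable_funU => //; first exact: measurableD.
  split; last exact: measurable_fun_set1.
  apply: (eq_measurable_fun (fun y => g x y * f y)).
    move=> y; rewrite inE => -[Oy /= yx]; rewrite off_diagT//.
    by move=> e; apply: yx.
  by apply: measurable_funS mgf => //; exact: subDsetl.
transitivity (\int[m]_(y in Omega) (g x y * f y)%:E)%E.
  apply: ae_eq_integral => //; [exact/measurable_EFinP|exact/measurable_EFinP|].
  exists [set x]; split => //; first exact: measurable_rV1.
  move=> y /=; apply: contra_notP => yx Oy; rewrite off_diagT//.
  by move=> e; apply: yx.
rewrite integral_mkcond; apply: eq_integral => y _; rewrite !patchE.
by case: ifPn => // _; rewrite mulr0.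
Qed.

Lemma green_measureE (mu : {sigma_finite_measure set E -> \bar R}) :
  {ae leb, forall x, Omega x ->
    green_measure Omega G mu x = potential g mu (cst 1%E) x}.
Proof.
apply: filterS (ae_atomless mu) => x mux Ox.
have h := @integral_off_diag mu x (cst 1) Ox mux (@measurable_cst _ _ _ _ _ _).
rewrite /green_measure; under eq_integral do rewrite -[G x _]mulr1.
rewrite h; apply: eq_integral => y _; rewrite mule1 patchE; case: ifPn; rewrite ?mulr1//.
by move=> /negP; rewrite inE => Oy; rewrite off_diagC ?mul0r// => -[].
Qed.

Lemma green_funE (v : E -> R) x : Omega x -> measurable_fun Omega v ->
  green_fun Omega G (fun y => delta y `^ gamma * v y) x =
  (\int[leb]_y (g x y * (D y * (v \_ Omega) y))%:E)%E.
Proof.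
move=> Ox mv; rewrite /green_fun integral_off_diag//.
- apply: eq_integral => y _; rewrite /weight !patchE.
  by case: ifP; rewrite ?mulr0.
- exact: lebesgue_rV1.
apply: measurable_funM => //; apply: measurable_funTS.
apply: (measurableT_comp (measurable_powR gamma)).
exact: measurable_bdist.
Qed.

Section weak_dual.
Variables (C : R) (gk : green_kernel leb g D C) (p : R) (p1 : 1 < p).
Variables (mu : {sigma_finite_measure set E -> \bar R}).
Hypothesis mu1 : (\int[mu]_x (D x)%:E = 1)%E.
Let p0 : 0 < p. Proof. exact: lt_trans p1. Qed.

(** A test function delta^gamma v enters through the extension of v by zero,
and [pointwise_weak] applies. *)
Lemma pointwise_weak_dual l u : 0 <= l ->
  pointwise_solution leb mu g D p l u ->
  weak_dual_solution Omega gamma p G l mu u.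
Proof.
move=> l0 pw; have [mu' u0 uoo ueq] := pw; split.
- exact: aeW.
- split; first exact: measurable_funTS.
  rewrite integral_mkcond (_ : (\int[leb]_x _ = \int[leb]_x ((D x)%:E * powerE p u x))%E)//.
  apply: eq_integral => x _; rewrite /weight /powerE !patchE.
  by case: ifP => _; rewrite ?mul0e// ger0_norm// -EFinM mulrC.
move=> _ [v [mv [M vM]] <-].
pose v0 := v \_ Omega.
have mv0 : measurable_fun setT v0 by exact/(measurable_restrictT _ mO).
have vM0 : {ae leb, forall x, `|v0 x| <= `|M|}.
  apply: filterS vM => x vMx; rewrite /v0 patchE; case: ifPn => [|_].
    by rewrite inE => /vMx h; apply: le_trans h (ler_norm _).
  by rewrite normr0.
pose Gv x := (\int[leb]_y (g x y * (D y * v0 y))%:E)%E.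
have H : (\int[leb]_x (u x * (D x * v0 x))%:E =
    \int[leb]_x (powerE p u x * Gv x) + l%:E * \int[mu]_x Gv x)%E.
  by have := pointwise_weak gk p1 mu1 l0 pw mv0 vM0; exact.
have Gv0 x : ~ Omega x -> Gv x = 0%E.
  move=> Ox; apply: integral0_eq => y _.
  by rewrite off_diagC ?mul0r// => -[].
have GvE x : Omega x -> green_fun Omega G (fun y => delta y `^ gamma * v y) x = Gv x.
  by move=> Ox; rewrite green_funE.
transitivity (\int[leb]_x (u x * (D x * v0 x))%:E)%E.
  rewrite integral_mkcond; apply: eq_integral => x _; rewrite /v0 /weight !patchE.
  by case: ifP => _; rewrite ?mulr0.
rewrite H.
have E1 : (\int[leb]_x (powerE p u x * Gv x) = \int[leb]_(x in Omega)
    ((u x `^ p)%:E * green_fun Omega G (fun y => (delta y `^ gamma * v y)%R) x))%E.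
  rewrite [RHS]integral_mkcond; apply: eq_integral => x _; rewrite patchE.
  case: ifPn => [|/negP]; rewrite inE => Ox; first by rewrite GvE.
  by rewrite Gv0// mule0.
have E2 : (\int[mu]_x Gv x = \int[mu]_(x in Omega)
    green_fun Omega G (fun y => (delta y `^ gamma * v y)%R) x)%E.
  rewrite [RHS]integral_mkcond; apply: eq_integral => x _; rewrite patchE.
  by case: ifPn => [|/negP]; rewrite inE => Ox; [rewrite GvE|rewrite Gv0].
by rewrite E1 E2.
Qed.

(** The function |u| extended by zero is nonnegative and measurable everywhere
and equals u almost everywhere in Omega; it is tested with the functions
delta^gamma 1_A. *)
Lemma weak_dual_pointwise l u : 0 <= l ->
  weak_dual_solution Omega gamma p G l mu u ->
  let w := (fun x => `|u x|) \_ Omega in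
  pointwise_solution leb mu g D p l w /\ {ae leb, forall x, Omega x -> u x = w x}.
Proof.
move=> l0 [u0 [mu' uoo] H] w.
have mw : measurable_fun setT w.
  by apply/(measurable_restrictT _ mO); exact: measurableT_comp.
have wT x : Omega x -> w x = `|u x| by move=> Ox; rewrite /w patchE mem_set.
have w0 x : 0 <= w x by rewrite /w patchE; case: ifP.
have uw : {ae leb, forall x, Omega x -> u x = w x}.
  by apply: filterS u0 => x ux Ox; rewrite wT// ger0_norm// ux.
split; last exact: uw.
have woo : (\int[leb]_x ((D x)%:E * powerE p w x) < +oo)%E.
  move: uoo; rewrite integral_mkcond; congr (_ < _)%E.
  apply: eq_integral => x _; rewrite /weight /powerE /w !patchE.
  by case: ifP => _; rewrite ?mul0e// -EFinM mulrC.
apply: (weak_pointwise gk p1 l0 mw w0 woo).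
move=> A mA.
have m1 : measurable_fun Omega (\1_A : E -> R).
  by apply: measurable_funTS; exact: measurable_indic.
have xiL : delta_Linfty Omega gamma (fun x => delta x `^ gamma * \1_A x).
  exists \1_A => //; split => //; exists 1; apply: aeW => x _.
  by rewrite indicE; case: (_ \in _); rewrite ?normr1 ?normr0.
pose h x : \bar R := (D x * \1_A x)%:E.
have mh : measurable_fun setT h.
  by apply/measurable_EFinP; apply: measurable_funM => //; exact: measurable_indic.
have h0 x : (0 <= h x)%E by rewrite lee_fin mulr_ge0.
have mpot : measurable_fun setT (potential g leb h) by exact: measurable_potential.
have GE x : Omega x ->
    green_fun Omega G (fun y => delta y `^ gamma * \1_A y) x = potential g leb h x.
  move=> Ox; rewrite green_funE//; apply: eq_integral => y _.
  rewrite /h -EFinM /weight !patchE.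
  by case: ifP => _; rewrite ?mul0r ?mulr0.
have pot0 x : ~ Omega x -> potential g leb h x = 0%E.
  by move=> Ox; apply: potential_support gk _ _ _ _; rewrite weightC.
have := H _ xiL => HA.
transitivity (\int[leb]_(x in Omega) (u x * (delta x `^ gamma * \1_A x))%:E)%E.
  transitivity (\int[leb]_(x in Omega) (w x * (D x * \1_A x))%:E)%E.
    rewrite [RHS]integral_mkcond; apply: eq_integral => x _; rewrite patchE.
    by case: ifPn => // /negP; rewrite inE => Ox; rewrite weightC// mul0r mulr0.
  apply: ae_eq_integral => //.
  - apply: measurable_funTS; apply/measurable_EFinP; apply: measurable_funM => //.
    by apply: measurable_funM => //; exact: measurable_indic.
  - apply/measurable_EFinP; apply: measurable_funM => //; apply: measurable_funM => //.
    apply: measurable_funTS; apply: (measurableT_comp (measurable_powR gamma)).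
    exact: measurable_bdist.
  - by apply: filterS uw => x ux Ox; rewrite ux// weightT.
rewrite HA.
have E1 : (\int[leb]_(x in Omega) ((u x `^ p)%:E *
      green_fun Omega G (fun y => (delta y `^ gamma * \1_A y)%R) x) =
    \int[leb]_x (powerE p w x * potential g leb h x))%E.
  transitivity (\int[leb]_(x in Omega) ((u x `^ p)%:E * potential g leb h x))%E.
    by apply: eq_integral => x; rewrite inE => Ox; rewrite GE.
  transitivity (\int[leb]_(x in Omega) (powerE p w x * potential g leb h x))%E.
    apply: ae_eq_integral.
    - exact: mO.
    - apply: emeasurable_funM; last exact: measurable_funTS.
      apply/measurable_EFinP.
      exact: (measurableT_comp (measurable_powR p) mu').
    - apply: measurable_funTS; apply: emeasurable_funM => //; apply/measurable_EFinP.
      exact: (measurableT_comp (measurable_powR p) mw).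
    - by apply: filterS uw => x ux Ox; rewrite /powerE ux.
  rewrite integral_mkcond; apply: eq_integral => x _; rewrite patchE.
  by case: ifPn => // /negP; rewrite inE => Ox; rewrite pot0// mule0.
have E2 : (\int[mu]_(x in Omega)
      green_fun Omega G (fun y => (delta y `^ gamma * \1_A y)%R) x =
    \int[mu]_x potential g leb h x)%E.
  rewrite integral_mkcond; apply: eq_integral => x _; rewrite patchE.
  by case: ifPn => [|/negP]; rewrite inE => Ox; [rewrite GE|rewrite pot0].
by rewrite E1 E2.
Qed.

End weak_dual.
End green_measures.

(** * Divergence of moments above the critical exponent *)

Section supercritical.
Context (R : realType) (n : nat).
Local Notation N := n.+1.
Local Notation E := 'rV[R]_N.
Local Notation leb := (@lebesgue_rV R N).
Variables (Omega : set E).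
Local Notation delta := (bdist Omega).
Variables (s gamma : R) (G : E -> E -> R) (GO : (E -> R) -> (E -> R)).
Hypotheses (s0 : 0 < s) (gamma0 : 0 < gamma) (N2s : 2 * s < N%:R).
Hypotheses (oO : open Omega) (bO : bounded_set Omega) (O0 : Omega !=set0).
Hypothesis (G2 : hyp_G2 Omega s gamma GO G).
Variables (p : R) (p1 : 1 < p).
Hypothesis pstar : (N%:R + gamma) / (N%:R + gamma - 2 * s) <= p.
Local Notation D := (weight Omega gamma).
Local Notation g := (off_diag Omega G).
Local Notation al := (N%:R - 2 * s).
Let al0 : 0 < al. Proof. by rewrite subr_gt0. Qed.
Let p0 : 0 < p. Proof. exact: lt_trans p1. Qed.
Let mO : measurable Omega. Proof. exact: open_measurable_mx. Qed.
Let d0 x : Omega x -> 0 < delta x. Proof. exact: bdist_gt0. Qed.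
Let mDR : measurable_fun setT D. Proof. exact: measurable_weightD. Qed.
Let D0 x : 0 <= D x. Proof. exact: weight_ge0. Qed.
Let kg : sym_kernel g. Proof. exact: off_diag_kernel G2. Qed.
Let g0 x y : 0 <= g x y. Proof. by case: kg. Qed.

(** The integrand of [sk_moment], with the pole y as parameter. *)
Definition moment_density y z := D z * (g z y / D y) `^ p.

Lemma moment_density_ge0 y z : 0 <= moment_density y z.
Proof. by rewrite mulr_ge0// powR_ge0. Qed.

Lemma measurable_moment_density y : measurable_fun setT (moment_density y).
Proof.
apply: measurable_funM => //.
have -> : (fun z => (g z y / D y) `^ p) =
    (@powR R ^~ p) \o (fun z => g y z * (D y)^-1).
  by apply/funext => z /=; case: kg => _ gC _; rewrite gC.
apply: measurableT_comp; first exact: measurable_powR.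
by apply: measurable_funM => //; exact: measurable_kernel1.
Qed.

(** Contribution of a cube of side comparable with t, at distance comparable
with t from the boundary: the left factor t^gamma is the weight, the power p
comes from the kernel, t^N is the volume. The total exponent
N + gamma - (N-2s+gamma) p is nonpositive for p >= pstar, so that small t are no
worse than t = d. *)
Lemma dyadic_lower_bound (A d t : R) : 0 < A -> 0 < d -> 0 < t -> t <= d ->
  A * d `^ (N%:R + gamma - (al + gamma) * p) <=
  A * (t `^ gamma * (t `^ gamma / t `^ (al + gamma + gamma)) `^ p * t ^+ N).
Proof.
move=> A0 d_gt0 t0 td; rewrite ler_wpM2l ?(ltW A0)//.
have tn : t != 0 by rewrite gt_eqF.
have -> : t `^ gamma / t `^ (al + gamma + gamma) = t `^ (- (al + gamma)).
  rewrite -powRN -powRD ?tn ?implybT//; congr (_ `^ _); ring.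
rewrite -powRrM -powR_mulrn ?(ltW t0)// -!powRD ?tn ?implybT//.
have -> : gamma + - (al + gamma) * p + N%:R = - ((al + gamma) * p - N%:R - gamma) by ring.
have -> : N%:R + gamma - (al + gamma) * p = - ((al + gamma) * p - N%:R - gamma) by ring.
have e0 : 0 <= (al + gamma) * p - N%:R - gamma.
  have den : 0 < N%:R + gamma - 2 * s by rewrite addrAC addr_gt0.
  by move: pstar; rewrite ler_pdivrMr//; lra.
rewrite !powRN lef_pV2 ?posrE ?powR_gt0//; apply: le_powR2 => //; exact: ltW.
Qed.

(** Points x(tau k), with tau k = d/4^k, go to the boundary along a segment on
which delta is the distance to its end point z0, and carry disjoint cubes Q k.
For the pole y = x(tau j) and k < j, points of Q k are at distance at most
(5/2) tau k from y, which bounds the quasi-distance from above and the density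
from below by a constant c k. By [dyadic_lower_bound] the cubes Q 0, ..., Q (j-1)
contribute at least kap each, and j is arbitrary. *)
Lemma moment_unbounded (M : R) : exists2 y, Omega y &
  (M%:E <= \int[leb]_z (moment_density y z)%:E)%E.
Proof.
have [C C0 HC] := off_diag_estimate oO bO O0 G2.
have [x1 Ox1] := O0; have [z0 Bz0 dz0] := bdist_attained oO bO O0 x1.
set d := delta x1 in dz0; have d_gt0 : 0 < d by exact: d0.
pose x t : E := z0 + (t / d) *: (x1 - z0).
have xz0 t : 0 <= t -> enorm (x t - z0) = t.
  move=> t0; rewrite /x addrC addKr enormZ -dz0 ger0_norm ?divr_ge0 ?(ltW d_gt0)//.
  by rewrite divfK// gt_eqF.
have xx1 t : t <= d -> enorm (x1 - x t) = d - t.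
  move=> td; have -> : x1 - x t = (1 - t / d) *: (x1 - z0).
    by rewrite /x scalerBl scale1r opprD addrA.
  rewrite enormZ -dz0 ger0_norm ?subr_ge0 ?ler_pdivrMr ?mul1r//.
  by rewrite mulrBl mul1r divfK// gt_eqF.
have Ox t : 0 < t -> t <= d -> Omega (x t).
  by move=> t0 td; apply: (bdist_ball oO Ox1); rewrite xx1// -/d; lra.
have dx t : 0 < t -> t <= d -> delta (x t) = t.
  move=> t0 td; apply/eqP; rewrite eq_le; apply/andP; split.
    by apply: le_trans (bdist_le (x t) Bz0) _; rewrite xz0// ltW.
  by have := bdist_lipschitz oO bO O0 x1 (x t); rewrite xx1// -/d; lra.
(* The ratio 4 exceeds 3 = (3/2)/(1/2), the ratio between the extreme distances
   to z0 within one cube; this makes the cubes disjoint. *)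
pose tau k : R := d / 4 ^+ k.
have t0 k : 0 < tau k by rewrite divr_gt0// exprn_gt0.
have tS k : tau k.+1 = tau k / 4 by rewrite /tau exprS invfM mulrA mulrAC.
have tlt i k : (i < k)%N -> tau k <= tau i / 4.
  move=> ik; rewrite -(subnKC ik) addSn; elim: (k - i.+1)%N => [|l IH].
    by rewrite addn0 tS.
  by rewrite addnS tS; apply: le_trans IH; have := t0 (i + l).+1; lra.
have td k : tau k <= d.
  rewrite /tau ler_pdivrMr ?exprn_gt0// ler_peMr ?(ltW d_gt0)//.
  by rewrite exprn_ege1// ler1n.
clearbody x tau d.
(* Division by N makes the Euclidean radius of the cube at most tau k / 2. *)
pose Q k := cube (x (tau k)) (tau k / 2 / N%:R).
have Qx k z : Q k z -> enorm (x (tau k) - z) <= tau k / 2.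
  move=> /cubeP /enorm_le_coord h; rewrite enormB; apply: le_trans h _.
  by rewrite mulrC divfK.
have Qz0 k z : Q k z -> tau k / 2 <= enorm (z - z0) <= 3 * tau k / 2.
  move=> /Qx h; have := xz0 _ (ltW (t0 k)).
  have := enorm_triangle z (x (tau k)) z0.
  have := enorm_triangle (x (tau k)) z z0; rewrite (enormB z (x (tau k))) => h1 h2 h3.
  by apply/andP; split; lra.
have Qd k z : Q k z -> [/\ Omega z, tau k / 2 <= delta z & delta z <= 3 * tau k / 2].
  move=> Qz; have h := Qx k z Qz; have dk := dx _ (t0 k) (td k).
  have tk := t0 k; split.
  - by apply: (bdist_ball oO (Ox _ (t0 k) (td k))); rewrite dk; lra.
  - by have := bdist_lipschitz oO bO O0 (x (tau k)) z; lra.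
  - apply: le_trans (bdist_le z Bz0) _.
    by have /andP[] := Qz0 k z Qz.
have Q_disj i k z : (i < k)%N -> Q i z -> Q k z -> False.
  move=> /tlt ik /Qz0/andP[hi _] /Qz0/andP[_ hk].
  by have := t0 i; lra.
have tQ : trivIset setT Q.
  apply/trivIsetP => i k _ _ ik; apply/seteqP; split=> // z [Qi Qk].
  by move: ik; rewrite neq_ltn => /orP[h|h]; [exact: Q_disj h Qi Qk|exact: Q_disj h Qk Qi].
pose h := 2^-1 `^ gamma; pose H := (5 / 2) `^ (al + gamma + gamma).
have h0 : 0 < h by rewrite powR_gt0.
have H0 : 0 < H by rewrite powR_gt0.
pose A := h * (C^-1 * h / H) `^ p * (N%:R^-1) ^+ N.
have A0 : 0 < A.
  by rewrite !mulr_gt0 ?exprn_gt0 ?invr_gt0 ?powR_gt0// !mulr_gt0 ?invr_gt0.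
pose kap := A * d `^ (N%:R + gamma - (al + gamma) * p).
have kap0 : 0 < kap by rewrite mulr_gt0// powR_gt0.
pose c k := (tau k / 2) `^ gamma * (C^-1 * ((tau k / 2) `^ gamma /
  (5 / 2 * tau k) `^ (al + gamma + gamma))) `^ p.
have ckap k : kap <= c k * (2 * (tau k / 2 / N%:R)) ^+ N.
  apply: le_trans (dyadic_lower_bound A0 d_gt0 (t0 k) (td k)) _.
  rewrite le_eqVlt; apply/orP; left; apply/eqP.
  have -> : 2 * (tau k / 2 / N%:R) = tau k * N%:R^-1 by rewrite mulrA mulrCA divff// mulr1.
  have hk : (tau k / 2) `^ gamma = tau k `^ gamma * h.
    by rewrite powRM ?invr_ge0// ltW.
  have Hk : (5 / 2 * tau k) `^ (al + gamma + gamma) =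
      H * tau k `^ (al + gamma + gamma).
    by rewrite powRM// ltW.
  rewrite /c hk Hk (exprMn N (tau k)).
  have -> : C^-1 * (tau k `^ gamma * h / (H * tau k `^ (al + gamma + gamma))) =
      (C^-1 * h / H) * (tau k `^ gamma / tau k `^ (al + gamma + gamma)).
    by rewrite invfM; ring.
  rewrite (@powRM _ (C^-1 * h / H)); last 2 first.
  - by rewrite !mulr_ge0 ?invr_ge0 ?(ltW C0) ?(ltW h0) ?(ltW H0).
  - by rewrite divr_ge0 ?powR_ge0.
  have alg (a b y v w z : R) : a * b * y * (v * w * z) = v * a * (b * w) * (z * y).
    by ring.
  exact: alg.
clearbody kap A h H.
have fc j k z : (k < j)%N -> Q k z -> c k <= moment_density (x (tau j)) z.
  move=> kj Qz; have [Oz lz uz] := Qd k z Qz.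
  have tj := tlt _ _ kj; have tk := t0 k.
  have Oy := Ox _ (t0 j) (td j); have dy := dx _ (t0 j) (td j).
  have yz0 := xz0 _ (ltW (t0 j)).
  have /andP[zl zu] := Qz0 k z Qz.
  have zy : z <> x (tau j).
    by move=> e; move: zl; rewrite e yz0; lra.
  have r0 := enorm_gt0P zy.
  have ru : enorm (z - x (tau j)) <= 5 / 2 * tau k.
    have := enorm_triangle z0 z (x (tau j)); rewrite (enormB z0) yz0; lra.
  have T0 : 0 < 5 / 2 * tau k by lra.
  have zT : delta z <= 5 / 2 * tau k by lra.
  have jT : delta (x (tau j)) <= 5 / 2 * tau k by rewrite dy; lra.
  have tk2 : 0 <= tau k / 2 by lra.
  have Dy0 := weight_gt0 gamma oO bO O0 Oy.
  have Dz : (tau k / 2) `^ gamma <= D z.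
    by rewrite (weightT _ Oz); apply: le_powR2 tk2 lz; exact: ltW.
  have q0 := qdist_gt0 al gamma (delta z) (delta (x (tau j))) r0.
  have qu := qdist_upper al0 gamma0 r0 ru zT jT.
  have /andP[lg _] := HC z _ Oz Oy zy.
  move: q0 qu lg; move: (qdist _ _ _ _ _) => q q0 qu lg.
  have CV0 : 0 <= C^-1 by rewrite invr_ge0 ltW.
  apply: ler_pM; [exact: powR_ge0|exact: powR_ge0|exact: Dz|].
  apply: le_powR2; first exact: ltW.
    by apply: mulr_ge0 CV0 _; rewrite divr_ge0 ?powR_ge0.
  rewrite ler_pdivlMr; last exact: Dy0.
  apply: le_trans _ lg; rewrite -[leLHS]mulrA.
  apply: (ler_wpM2l CV0); rewrite [leLHS]mulrAC.
  apply: ler_pM; rewrite ?invr_ge0 ?powR_ge0 ?mulr_ge0 ?powR_ge0 ?(ltW Dy0)//.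
    by apply: ler_wpM2r; [exact: (ltW Dy0)|exact: Dz].
  by rewrite lef_pV2 ?posrE ?powR_gt0.
pose j := (Num.truncn (M / kap)).+1.
exists (x (tau j)); first exact: Ox.
have mf : measurable_fun setT (fun z => (moment_density (x (tau j)) z)%:E).
  by apply/measurable_EFinP; exact: measurable_moment_density.
have mQ k : measurable (Q k) by exact: measurable_cube.
pose B := \big[setU/set0]_(k <- iota 0 j) Q k.
have mB : measurable B by apply: bigsetU_measurable.
apply: (@le_trans _ _ (\int[leb]_(z in B) (moment_density (x (tau j)) z)%:E))%E; last first.
  apply: ge0_subset_integral => //.
  by move=> z _; rewrite lee_fin moment_density_ge0.
rewrite ge0_integral_bigsetU//; last 4 first.
- exact: iota_uniq.
- exact: sub_trivIset tQ.
- exact: measurable_funTS.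
- by move=> z _; rewrite lee_fin moment_density_ge0.
apply: (@le_trans _ _ (\sum_(k <- iota 0 j) kap%:E)%E).
  rewrite sumEFin lee_fin big_const_seq count_predT size_iota iter_addr addr0.
  rewrite -mulr_natl -ler_pdivrMr//.
  by apply: ltW; exact: truncnS_gt.
rewrite big_seq [leRHS]big_seq; apply: lee_sum => k.
rewrite mem_iota add0n => /andP[_ kj].
apply: (@le_trans _ _ (\int[leb]_(z in Q k) (c k)%:E))%E.
  rewrite integral_cst//.
  have -> : (leb : {measure set E -> \bar R}) (Q k) = ((2 * (tau k / 2 / N%:R)) ^+ N)%:E.
    by apply: lebesgue_cube; rewrite !divr_ge0// ltW.
  by rewrite -EFinM lee_fin.
apply: ge0_le_integral => //.
- by move=> z _; rewrite lee_fin mulr_ge0 ?powR_ge0.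
- exact: measurable_funTS.
by move=> z Qz; rewrite lee_fin fc.
Qed.

End supercritical.

(** * Existence and nonexistence of weak-dual solutions *)

Section dirac_series.
Context d (T : measurableType d) (R : realType).
Variables (w : nat -> {nonneg R}) (y : nat -> T).

Definition dirac_series : {measure set T -> \bar R} :=
  mseries (fun i => mscale (w i) (\d_(y i))) 0.

Lemma integral_dirac_series (f : T -> \bar R) : measurable_fun setT f ->
  (forall x, (0 <= f x)%E) ->
  (\int[dirac_series]_x f x = \sum_(i <oo) ((w i)%:num%:E * f (y i)))%E.
Proof.
move=> mf f0; rewrite ge0_integral_measure_series//.
apply: eq_eseriesr => i _; rewrite ge0_integral_mscale//.
by rewrite integral_dirac// diracT mul1e.
Qed.

Lemma le_integral_dirac_series i (f : T -> \bar R) : measurable_fun setT f ->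
  (forall x, (0 <= f x)%E) ->
  ((w i)%:num%:E * f (y i) <= \int[dirac_series]_x f x)%E.
Proof.
move=> mf f0; rewrite integral_dirac_series//.
have h0 k : (0 <= (w k)%:num%:E * f (y k))%E by rewrite mule_ge0// lee_fin.
have := @nneseries_lim_ge R (fun k => (w k)%:num%:E * f (y k))%E xpredT 0 i.+1 (fun k _ _ => h0 k).
apply: le_trans; rewrite big_nat_recr//= -[leLHS]add0e; apply: leeD => //.
exact: sume_ge0.
Qed.

End dirac_series.

Section nonexistence.
Context (R : realType) (n : nat).
Local Notation N := n.+1.
Local Notation E := 'rV[R]_N.
Local Notation leb := (@lebesgue_rV R N).
Variables (Omega : set E).
Local Notation delta := (bdist Omega).
Variables (s gamma : R) (G : E -> E -> R) (GO : (E -> R) -> (E -> R)).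
Hypotheses (s0 : 0 < s) (gamma0 : 0 < gamma) (N2s : 2 * s < N%:R).
Hypotheses (oO : open Omega) (bO : bounded_set Omega) (O0 : Omega !=set0).
Hypothesis (G2 : hyp_G2 Omega s gamma GO G).
Variables (p : R) (p1 : 1 < p).
Local Notation D := (weight Omega gamma).
Local Notation g := (off_diag Omega G).
Let p0 : 0 < p. Proof. exact: lt_trans p1. Qed.
Let mO : measurable Omega. Proof. exact: open_measurable_mx. Qed.
Let mDR : measurable_fun setT D. Proof. exact: measurable_weightD. Qed.
Let mD : measurable_fun setT (EFin \o D). Proof. exact/measurable_EFinP. Qed.
Let D0 x : 0 <= D x. Proof. exact: weight_ge0. Qed.
Let kg : sym_kernel g. Proof. exact: off_diag_kernel G2. Qed.
Let g0 x y : 0 <= g x y. Proof. by case: kg. Qed.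

Lemma MnormE (mu : {measure set E -> \bar R}) :
  (Mnorm Omega gamma mu = \int[mu]_x (D x)%:E)%E.
Proof.
rewrite /Mnorm integral_mkcond; apply: eq_integral => x _.
by rewrite /weight !patchE; case: ifP.
Qed.

(** On a compact subset of Omega the weight has a positive minimum. *)
Lemma radon_of_Mnorm (mu : {measure set E -> \bar R}) :
  mu (~` Omega) = 0%E -> (Mnorm Omega gamma mu < +oo)%E -> Mplus Omega gamma mu.
Proof.
move=> muO mufin; split => //; split => // K cK KO.
have [->|K0] := eqVneq K set0; first by rewrite measure0.
have mK : measurable K.
  rewrite -[K]setCK; apply: measurableC; apply: open_measurable_mx.
  by apply: closed_openC; apply: compact_closed => //; exact: norm_hausdorff.
have /set0P K0' := K0.
have [|c cK' cmin] := @compact_EVT_min E R delta K K0' cK.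
  by apply: continuous_subspaceT; exact: continuous_bdist.
rewrite inE in cK'.
have Dc : 0 < D c by apply: weight_gt0 => //; exact: KO.
have : (\int[mu]_(x in K) (D c)%:E <= \int[mu]_x (D x)%:E)%E.
  rewrite integral_mkcond; apply: ge0_le_integral => //.
  - by move=> x _; rewrite patchE; case: ifP; rewrite ?lee_fin.
  - by apply/(measurable_restrictT _ mK); exact: measurable_cst.
  move=> x _; rewrite patchE; case: ifPn => [xK|_]; last exact: D0.
  have Kx : K x by rewrite inE in xK.
  rewrite lee_fin (weightT _ (KO _ cK')) (weightT _ (KO _ Kx)).
  apply: le_powR2 (ltW gamma0) _ (cmin x xK).
  exact: bdist_ge0.
rewrite -MnormE => /le_lt_trans/(_ mufin); rewrite integral_cst//.
case: (mu K) (measure_ge0 mu K) => // [r _ _|_]; first exact: ltry.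
by rewrite gt0_muley.
Qed.

(** Choose y_i with int D (g(.,y_i)/D(y_i))^p >= 2^((i+1)p) (i+1), and let mu be
the sum of the Dirac masses at y_i with weights 2^(-(i+1))/D(y_i), which has norm
1. Its potential is at least that of a single term, and
int D (l 2^(-(i+1)) g(.,y_i)/D(y_i))^p >= l^p (i+1) for all i. The conclusion is
stated for the majorants w of l G[mu], which include all solutions. *)
Lemma potential_not_Lp : (N%:R + gamma) / (N%:R + gamma - 2 * s) <= p ->
  exists mu : {measure set E -> \bar R},
    [/\ Mplus Omega gamma mu, Mnorm Omega gamma mu = 1%E &
      forall (l : R) (w : E -> R), 0 < l -> measurable_fun setT w ->
        (forall x, 0 <= w x) ->
        {ae leb, forall x, Omega x ->
          (l%:E * potential g mu (cst 1%E) x <= (w x)%:E)%E} ->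
        (\int[leb]_x ((D x)%:E * (w x `^ p)%:E) = +oo)%E].
Proof.
move=> pp.
have := moment_unbounded gamma0 N2s oO bO O0 G2 p1 pp => mom.
have yex i : exists y, Omega y /\
    (((2 ^+ i.+1) `^ p * i.+1%:R)%:E <=
      \int[leb]_z (moment_density Omega gamma G p y z)%:E)%E.
  by have [y Oy hy] := mom ((2 ^+ i.+1) `^ p * i.+1%:R); exists y.
have [y yP] := choice yex.
have Dy i : 0 < D (y i) by apply: weight_gt0 => //; case: (yP i).
have wge0 i : 0 <= (2 ^+ i.+1)^-1 / D (y i).
  by rewrite divr_ge0 ?invr_ge0 ?exprn_ge0// ltW.
pose c i : {nonneg R} := NngNum (wge0 i).
pose mu := dirac_series c y.
have mu_mass : (\int[mu]_x (D x)%:E = 1)%E.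
  rewrite integral_dirac_series//.
  transitivity (\sum_(k <oo) (1 / (2 ^ (k + 1))%:R)%:E : \bar R)%E.
    apply: eq_eseriesr => k _; rewrite -EFinM /c/= divfK ?gt_eqF//.
    by rewrite addn1 natrX div1r.
  have := @cvg_geometric_eseries_half R 1 0; rewrite expr0 divr1.
  by move/cvg_lim; apply.
have muO : mu (~` Omega) = 0%E.
  have mOC : measurable (~` Omega) by exact: measurableC.
  rewrite -[LHS]mul1e -[LHS](integral_cst mu mOC) integral_mkcond.
  rewrite integral_dirac_series.
  - rewrite eseries0// => i _ _; rewrite patchE memNset ?mule0//.
    by move=> /=; apply; case: (yP i).
  - by apply/(measurable_restrictT _ mOC); exact: measurable_cst.
  - by move=> x; rewrite patchE; case: ifP.
have Mn : Mnorm Omega gamma mu = 1%E by rewrite MnormE.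
exists mu; split => //.
  by apply: radon_of_Mnorm => //; rewrite Mn ltry.
move=> l w l0 mw w0 Pw.
have mwp : measurable_fun setT (fun x => (w x `^ p)%:E).
  by apply/measurable_EFinP; exact: (measurableT_comp (measurable_powR p) mw).
set I := (\int[leb]_x _)%E.
have key i : ((l `^ p * i.+1%:R)%:E <= I)%E.
  have [Oy hy] := yP i.
  apply: (@le_trans _ _ (\int[leb]_z
    ((l `^ p * (2 ^+ i.+1) `^ (- p))%:E * (moment_density Omega gamma G p (y i) z)%:E)))%E.
    rewrite ge0_integralZl//; last 3 first.
    - apply/measurable_EFinP; exact: (measurable_moment_density oO bO O0 G2).
    - by move=> z _; rewrite lee_fin; apply: mulr_ge0; [exact: D0|exact: powR_ge0].
    - by rewrite lee_fin mulr_ge0 ?powR_ge0.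
    apply: le_trans (lee_wpmul2l _ hy); last by rewrite lee_fin mulr_ge0 ?powR_ge0.
    have X0 : (2 ^+ i.+1 : R) `^ p != 0 by rewrite gt_eqF// powR_gt0// exprn_gt0.
    rewrite -EFinM lee_fin powRN -mulrA; apply: ler_wpM2l; first exact: powR_ge0.
    by rewrite mulKf.
  apply: ae_ge0_le_integral => //.
  - move=> z _; rewrite -EFinM lee_fin; apply: mulr_ge0.
      by apply: mulr_ge0; exact: powR_ge0.
    by apply: mulr_ge0; [exact: D0|exact: powR_ge0].
  - apply: emeasurable_funM => //; apply/measurable_EFinP.
    exact: (measurable_moment_density oO bO O0 G2).
  - by move=> z _; rewrite -EFinM lee_fin; apply: mulr_ge0; [exact: D0|exact: powR_ge0].
  - exact: emeasurable_funM.
  apply: filterS Pw => z Pwz _.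
  have [Oz|Oz] := pselect (Omega z); last first.
    by rewrite /moment_density weightC// !mul0r mule0 mul0e.
  have {}Pwz := Pwz Oz.
  have lo : (((2 ^+ i.+1)^-1 / D (y i) * g z (y i))%:E <= potential g mu (cst 1%E) z)%E.
    rewrite /potential; under eq_integral do rewrite mule1.
    have := @le_integral_dirac_series _ _ _ c y i (fun x => (g z x)%:E).
    rewrite -EFinM; apply; last by move=> x; rewrite lee_fin; exact: g0.
    by apply/measurable_EFinP; exact: measurable_kernel1.
  have : l * ((2 ^+ i.+1)^-1 / D (y i) * g z (y i)) <= w z.
    rewrite -lee_fin; apply: le_trans Pwz.
    by rewrite [leLHS]EFinM; apply: lee_wpmul2l lo; rewrite lee_fin ltW.
  move=> lw; rewrite -!EFinM lee_fin /moment_density mulrCA; apply: ler_wpM2l; first exact: D0.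
  rewrite powRN -powRV ?exprn_ge0// -!powRM ?mulr_ge0 ?invr_ge0 ?exprn_ge0 ?divr_ge0 ?(ltW l0)//.
  apply: le_powR2; first exact: ltW.
    by rewrite !mulr_ge0 ?invr_ge0 ?exprn_ge0 ?(ltW l0).
  by apply: le_trans lw; rewrite le_eqVlt; apply/orP; left; apply/eqP; ring.
have lp0 : 0 < l `^ p by rewrite powR_gt0.
have : (0 <= I)%E by apply: integral_ge0 => x _; rewrite mule_ge0 ?lee_fin ?powR_ge0.
case: I key => [r| |//] key r0 //.
have := key (Num.truncn (r / l `^ p)); rewrite lee_fin leNgt => /negP[].
by rewrite mulrC -ltr_pdivrMr// truncnS_gt.
Qed.

(** A solution is a majorant of lambda G[mu] in L^p(D). *)
Lemma supercritical_nonexistence :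
  (N%:R + gamma) / (N%:R + gamma - 2 * s) <= p ->
  forall lambda : R, 0 < lambda -> exists mu : {measure set E -> \bar R},
    [/\ Mplus Omega gamma mu, Mnorm Omega gamma mu = 1%E &
      ~ exists u, weak_dual_solution Omega gamma p G lambda mu u].
Proof.
move=> pp l l0; have [mu0 [Mp Mn H]] := potential_not_Lp pp.
have [C C0 gk] := green_kernel_domain s0 gamma0 N2s oO bO O0 G2.
have [[muO _] muoo] := Mp.
have sf := weighted_sigma_finite oO bO O0 muO muoo.
have [mu muE] := sigma_finite_measureP sf.
exists mu0; split => // -[u]; rewrite -muE => usol.
rewrite -muE in H.
have [[mw w0 woo weq] _] := weak_dual_pointwise oO bO O0 G2 (gk C (lexx C)) p1 (ltW l0) usol.
set w := _ \_ Omega in mw w0 woo weq.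
have := H l w l0 mw w0; move: woo; rewrite /powerE => woo h.
have : (\int[leb]_x ((D x)%:E * (w x `^ p)%:E) = +oo)%E.
  apply: h; apply: filterS weq => x h Ox; rewrite h ?gt_eqF ?weight_gt0//.
  rewrite -[leLHS]add0e; apply: leeD => //.
  by apply: potential_ge0 => // y; rewrite lee_fin powR_ge0.
by move=> e; rewrite e in woo.
Qed.

(** [solvable_threshold] for the Green kernel, read through the equivalence of
weak-dual and pointwise solutions. *)
Lemma subcritical_threshold (mu0 : {measure set E -> \bar R}) :
  p < (N%:R + gamma) / (N%:R + gamma - 2 * s) ->
  Mplus Omega gamma mu0 -> Mnorm Omega gamma mu0 = 1%E ->
  exists lambdastar : R, [/\ 0 < lambdastar,
    exists T : R -> R, [/\
      {in `]0, lambdastar] &, {homo T : a b / a < b}},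
      T l @[l --> 0^'+] --> 0 &
      forall lambda : R, 0 < lambda <= lambdastar ->
        exists u : E -> R, [/\
          minimal_solution Omega gamma p G lambda mu0 u,
          {ae leb, forall x, Omega x -> 0 < u x} &
          {ae leb, forall x, Omega x ->
            (lambda%:E * green_measure Omega G mu0 x <= (u x)%:E <=
             (T lambda)%:E * green_measure Omega G mu0 x)%E}]] &
    forall lambda : R, lambdastar < lambda ->
      ~ exists u, weak_dual_solution Omega gamma p G lambda mu0 u].
Proof.
move=> pp Mp Mn.
have [C0 C00 gk] := green_kernel_domain s0 gamma0 N2s oO bO O0 G2.
have [C1 C10 sk] := subcritical_kernel_domain gamma0 N2s oO bO O0 G2 p1 pp.
have {}gk : green_kernel leb g D (C0 + C1) by apply: gk; rewrite lerDl ltW.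
have {}sk : subcritical_kernel leb g D (C0 + C1) p by apply: sk; rewrite lerDr ltW.
have [[muO _] muoo] := Mp.
have sf := weighted_sigma_finite oO bO O0 muO muoo.
have [mu muE] := sigma_finite_measureP sf.
rewrite -muE in Mn *.
have mu1 : (\int[mu]_x (D x)%:E = 1)%E by rewrite -MnormE.
have at0 := ae_atomless mu.
have [l0 [ls [M [/andP[l0_gt0 l0ls] M0 small big large]]]] :=
  solvable_threshold gk p1 mu1 at0 sk.
have ls0 : 0 < ls by exact: lt_le_trans l0ls.
have GM := green_measureE oO G2 mu.
have Plow := green_potential_lower gk mu1 at0.
exists ls; split => //; last first.
  move=> l lsl [u usol]; have l_ge0 : 0 <= l by apply/ltW/(lt_trans ls0).
  have [pw _] := weak_dual_pointwise oO bO O0 G2 gk p1 l_ge0 usol.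
  have [sl _] := pointwise_picard gk p1 l_ge0 pw.
  exact: large lsl sl.
(* Both branches are increasing and the second one lies above the first; adding
   2 l to M keeps the function strictly increasing. *)
pose T l : R := if l <= l0 then 2 * l else M + 2 * l.
exists T; split.
- move=> a b _ _ ab; rewrite /T; case: ifP => al; case: ifP => bl; lra.
- have lin : 2 * l @[l --> 0^'+] --> (0 : R).
    apply: cvg_at_right_filter; rewrite -[X in _ --> X](mulr0 2).
    by apply: cvgMr; exact: cvg_id.
  apply: cvg_trans lin; apply: near_eq_cvg; near=> l.
  by rewrite /T ifT//; near: l; exact: nbhs_right_le.
move=> l /andP[l_gt0 lls]; have l_ge0 := ltW l_gt0.
have [sl UM] := big l (introT andP (conj l_gt0 lls)).
have [pw uU] := picard_pointwise gk p1 l_ge0 sl.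
set u := fun x => fine _ in pw uU.
have P0 x : (0 <= potential g mu (cst 1%E) x)%E by exact: potential_ge0.
have Ulow x : (l%:E * potential g mu (cst 1%E) x <= picard_sup leb mu g p l x)%E.
  rewrite picard_supE// -[leLHS]add0e; apply: leeD => //.
  by apply: potential_ge0 => // y; exact: poweR_ge0.
have UT : {ae leb, forall x,
    (picard_sup leb mu g p l x <= (T l)%:E * potential g mu (cst 1%E) x)%E}.
  rewrite /T; case: ifPn => [ll0|_].
    by apply: small; rewrite l_gt0.
  apply: filterS UM => x h; apply: le_trans h _; apply: lee_wpmul2r => //.
  by rewrite lee_fin lerDl mulr_ge0.
exists u; split.
- split; first exact: (pointwise_weak_dual oO bO O0 G2 gk p1 mu1 l_ge0 pw).
  move=> v vsol; have [vpw vw] := weak_dual_pointwise oO bO O0 G2 gk p1 l_ge0 vsol.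
  have [_ Uv] := pointwise_picard gk p1 l_ge0 vpw.
  apply: filterS3 uU Uv vw => x ux Uvx vx Ox.
  rewrite -lee_fin ux (vx Ox); apply: Uvx.
  by rewrite gt_eqF// weight_gt0.
- apply: filterS2 uU Plow => x ux Dx Ox; rewrite -lte_fin ux.
  apply: lt_le_trans (Ulow x); rewrite mule_gt0 ?lte_fin//.
  rewrite lt_neqAle P0 andbT eq_sym; apply/eqP => Px0.
  move: Dx; rewrite Px0 mule0 lee_fin leNgt => /negP; apply.
  exact: weight_gt0.
- apply: filterS3 uU UT GM => x ux UTx GMx Ox.
  by rewrite (GMx Ox) ux Ulow UTx.
Unshelve. all: by end_near. Qed.

End nonexistence.

Unset Implicit Arguments.

Theorem theorem3p3 (R : realType) (N : nat) (s gamma p : R)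
    (Omega : set 'rV[R]_N)
    (dom : set ('rV[R]_N -> R)) (L GO : ('rV[R]_N -> R) -> ('rV[R]_N -> R))
    (G : 'rV[R]_N -> 'rV[R]_N -> R)
    (s_range : 0 < s <= 1) (gamma_range : 0 < gamma <= 1)
    (N_gt_2s : 2 * s < N%:R)
    (Omega_domain : bounded_C2_domain Omega)
    (L_linear : linear_operator_L2 Omega dom L)
    (G1 : hyp_G1 Omega dom L GO)
    (G2 : hyp_G2 Omega s gamma GO G)
    (p_gt1 : 1 < p) :
  let pstar : R := (N%:R + gamma) / (N%:R + gamma - 2 * s) in
  (p < pstar ->
    forall mu : {measure set 'rV[R]_N -> \bar R},
      Mplus Omega gamma mu -> Mnorm Omega gamma mu = 1%E ->
      exists lambdastar : R, [/\ 0 < lambdastar,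
        exists T : R -> R, [/\
          {in `]0, lambdastar] &, {homo T : a b / a < b}},
          T l @[l --> 0^'+] --> 0 &
          forall lambda : R, 0 < lambda <= lambdastar ->
            exists u : 'rV[R]_N -> R, [/\
              minimal_solution Omega gamma p G lambda mu u,
              {ae lebesgue_rV N, forall x, Omega x -> 0 < u x} &
              {ae lebesgue_rV N, forall x, Omega x ->
                (lambda%:E * green_measure Omega G mu x <= (u x)%:E <=
                 (T lambda)%:E * green_measure Omega G mu x)%E}]] &
        forall lambda : R, lambdastar < lambda ->
          ~ exists u, weak_dual_solution Omega gamma p G lambda mu u]) /\
  (pstar <= p ->
    forall lambda : R, 0 < lambda ->
      exists mu : {measure set 'rV[R]_N -> \bar R},
        [/\ Mplus Omega gamma mu, Mnorm Omega gamma mu = 1%E &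
          ~ exists u, weak_dual_solution Omega gamma p G lambda mu u]).
Proof.
move=> pstar; have /andP[s0 _] := s_range; have /andP[gamma0 _] := gamma_range.
(* N > 2s > 0, so the space has positive dimension. *)
have N0 : (0 < N)%N by rewrite -(ltr_nat R); apply: lt_trans N_gt_2s; rewrite mulr_gt0.
case: N N0 Omega dom L GO G N_gt_2s Omega_domain L_linear G1 G2 @pstar => // n _.
move=> Omega dom L GO G N2s Om _ _ G2 pstar; have [neO oO _ bO _] := Om.
split=> [pp mu Mp Mn|pp l l0].
  exact: (subcritical_threshold s0 gamma0 N2s oO bO neO G2 p_gt1).
exact: (supercritical_nonexistence s0 gamma0 N2s oO bO neO G2 p_gt1).
Qed.
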